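(* Let $M\ge 1$ be an integer and let $\vec W_M\in\mathcal G_M$ be an admissible state. The moment system $\vec B_M^0\,\partial_t\vec W_M+\vec B_M^1\,\partial_x\vec W_M=\vec S(\vec W_M)$ has the $2M+1$ eigenvalues (i.e. the solutions $\lambda$ of the generalized eigenvalue problem $\lambda\vec B_M^0\vec r=\vec B_M^1\vec r$, $\vec r\neq 0$) $$\lambda_{i,M}=\frac{u-\hat\lambda_{i,M}}{1-u\,\hat\lambda_{i,M}},\qquad i=-M,\dots,M,$$ they satisfy $|\lambda_{i,M}|<1$, and corresponding eigenvectors are $$\vec r_{i,M}=\vec D_M^{-1}\vec P_M^p\,\vec y_{i,M},\qquad i=-M,\dots,M.$$
   Context: Units: speed of light and particle rest mass equal to $1$. **Orthogonal polynomials.** For $\zeta>0$ let $K_n(\zeta)=\int_0^\infty\cosh(n\vartheta)e^{-\zeta\cosh\vartheta}d\vartheta$. For $\ell\in\{0,1\}$ let $\omega^{(\ell)}(x;\zeta)=K_1(\zeta)^{-1}(x^2-1)^{\ell-1/2}e^{-\zeta x}$ on $[1,\infty)$ and $(f,g)_{\omega^{(\ell)}}=\int_1^\infty fg\,\omega^{(\ell)}dx$. $\{P_n^{(\ell)}(x;\zeta)\}_{n\ge0}$ are the orthonormal polynomials for $(\cdot,\cdot)_{\omega^{(\ell)}}$ ($\deg P^{(\ell)}_n=n$, leading coefficient $c_n^{(\ell)}>0$); $P_n^{(\ell)}$ has $n$ simple zeros $1<x_{1,n}^{(\ell)}<\dots<x_{n,n}^{(\ell)}$. Put $a_n^{(\ell)}=c_n^{(\ell)}/c_{n+1}^{(\ell)}$,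 $b_n^{(\ell)}=(xP_n^{(\ell)},P_n^{(\ell)})_{\omega^{(\ell)}}$, $p_n=c_n^{(0)}/c_n^{(1)}$, $q_n=\frac{c_n^{(1)}}{c_{n+1}^{(0)}}\big(\sum_{i=1}^{n+2}x_{i,n+2}^{(0)}-\sum_{i=1}^nx_{i,n}^{(1)}\big)$, $r_n=c_{n-1}^{(1)}/c_{n+1}^{(0)}$ ($n\ge1$). **Matrices.** $\vec J_n^{(\ell)}$ is the $(n+1)\times(n+1)$ symmetric tridiagonal matrix with diagonal $b_0^{(\ell)},\dots,b_n^{(\ell)}$ and off-diagonal $a_0^{(\ell)},\dots,a_{n-1}^{(\ell)}$. $\vec J_{n}$ is the $(n+1)\times(n+2)$ matrix whose entries (rows $k=0,\dots,n$, columns $j=0,\dots,n+1$) are $p_k$ at $(k,k)$, $q_k$ at $(k,k+1)$, $r_{k+1}$ at $(k,k+2)$ when $k+2\le n+1$, and $0$ otherwise. Define the $(2M+1)\times(2M+1)$ matrices $$\vec A_M^0=\begin{pmatrix}\vec J_M^{(0)}&0\\0&\vec J_{M-1}^{(1)}\end{pmatrix},\qquad \vec A_M^1=\begin{pmatrix}0&\vec J_{M-1}^T\\ \vec J_{M-1}&0\end{pmatrix}.$$ **The numbers $\hat\lambda_{i,M}$ and vectors $\vec y_{i,M}$.** The even polynomial $Q_{2M}(x;\zeta)=P_{M+1}^{(0)}(x;\zeta)P_M^{(1)}(-x;\zeta)+P_{M+1}^{(0)}(-x;\zeta)P_M^{(1)}(x;\zeta)$ of degree $2M$ has $2M$ real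 simple zeros $z_{\pm i,M}$, $i=1,\dots,M$, with $z_{-i,M}=-z_{i,M}$, $z_{i,M}\in(1,\infty)$ for $i\ge1$. Put $\hat\lambda_{0,M}=0$, $\hat\lambda_{i,M}=\sqrt{z_{i,M}^2-1}/z_{i,M}$ for $i=\pm1,\dots,\pm M$. With $\vec P_n^{(\ell)}=(P_0^{(\ell)},\dots,P_n^{(\ell)})^T$, put $\vec y_{i,M}=(\vec u_{i,M}^T,\vec v_{i,M}^T)^T$ where, for $i\ne0$ and $z=z_{i,M}$, $\vec u_{i,M}=\vec P_M^{(0)}(z;\zeta)P_M^{(1)}(-z;\zeta)+\vec P_M^{(0)}(-z;\zeta)P_M^{(1)}(z;\zeta)$, $\vec v_{i,M}=\sqrt{z^2-1}\,\big(\vec P_{M-1}^{(1)}(z;\zeta)P_M^{(1)}(-z;\zeta)-\vec P_{M-1}^{(1)}(-z;\zeta)P_M^{(1)}(z;\zeta)\big)$, and $\vec u_{0,M}=\vec P_M^{(0)}(1;\zeta)P_{M+1}^{(0)}(-1;\zeta)-\vec P_M^{(0)}(-1;\zeta)P_{M+1}^{(0)}(1;\zeta)$, $\vec v_{0,M}=0$. **Weighted basis.** For $|u|<1$, $\theta>0$ set $\zeta=1/\theta$, $U^0=(1-u^2)^{-1/2}$, $U^1=uU^0$; for $p\in\mathbb R$ set $p^0=\sqrt{1+p^2}$, $E=U^0p^0-U^1p$, $p_{<1>}=-p+U^1E$, $g_{[u,\theta]}=\frac1{2K_1(\zeta)}e^{-\zeta E}$. Let $\tilde P_k^{(0)}[u,\theta]=g_{[u,\theta]}P_k^{(0)}(E;\zeta)$,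 $\tilde P_k^{(1)}[u,\theta]=g_{[u,\theta]}P_k^{(1)}(E;\zeta)\,p_{<1>}/U^0$. Let $\vec{\mathcal P}_M=(\tilde P_0^{(0)},\tilde P_1^{(0)},\tilde P_0^{(1)},\tilde P_2^{(0)},\tilde P_1^{(1)},\dots,\tilde P_M^{(0)},\tilde P_{M-1}^{(1)})^T$; its components are orthonormal for $\langle f,h\rangle=\int_{\mathbb R}\frac{fh}{g_{[u,\theta]}}\frac{dp}{p^0}$. $\vec P_M^p$ is the permutation matrix with $\vec P_M^p(\tilde P_0^{(0)},\dots,\tilde P_M^{(0)},\tilde P_0^{(1)},\dots,\tilde P_{M-1}^{(1)})^T=\vec{\mathcal P}_M$. **Moment system (order $M$).** Unknowns: $\vec W_M=(\rho,u,\theta,\Pi,\tilde n^1,f_3^0,f_2^1,\dots,f_M^0,f_{M-1}^1)^T\in\mathbb R^{2M+1}$ ($\vec W_1=(\rho,u,\theta)^T$, $\vec W_2=(\rho,u,\theta,\Pi,\tilde n^1)^T$). To $\vec W_M$ associate $\vec f_M=(f_0^0,f_1^0,f_0^1,f_2^0,f_1^1,\dots,f_M^0,f_{M-1}^1)^T$: for $M=1$, $\vec f_1=(\rho/c_0^{(0)},0,0)^T$; for $M\ge2$, $f_0^0=\rho/c_0^{(0)}-c_0^{(0)}\Pi$, $f_1^0=c_1^{(0)}x_{1,1}^{(0)}\Pi$, $f_0^1=-c_0^{(1)}\tilde n^1$, $f_2^0=-c_2^{(0)}x_{1,2}^{(0)}x_{2,2}^{(0)}\Pi$, $f_1^1=c_1^{(1)}x_{1,1}^{(1)}\tilde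 n^1$ (all coefficients at $\zeta=1/\theta$), the remaining components being those of $\vec W_M$. Let $F(\vec W_M;p)=\vec{\mathcal P}_M[u,\theta]^T\vec f_M$. $\vec D_M=\vec D_M(\vec W_M)$ is the $(2M+1)\times(2M+1)$ matrix with $(\vec D_M)_{kj}=\langle\partial F/\partial W_j,(\vec{\mathcal P}_M)_k\rangle$ (the coefficients of the orthogonal projection of $\partial F/\partial W_j$ on the span of $\vec{\mathcal P}_M$). Further $$\vec M_M^t=\vec P_M^p(U^0\vec A_M^0-U^1\vec A_M^1)(\vec P_M^p)^T,\quad \vec M_M^x=\vec P_M^p(U^1\vec A_M^0-U^0\vec A_M^1)(\vec P_M^p)^T,$$ $\vec B_M^0=\vec M_M^t\vec D_M$, $\vec B_M^1=\vec M_M^x\vec D_M$; the source $\vec S$ does not affect the eigenvalues. **Admissible states.** $\mathcal G_M$ is the set of $\vec W_M$ with $\rho>0$, $|u|<1$, $\theta>0$ and, if $M\ge2$, $\Pi>-\rho\theta$; on $\mathcal G_M$ the matrix $\vec D_M$ is invertible. *)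

(* Defs.v *)
From HB Require Import structures.
From mathcomp Require Import all_boot all_order all_algebra.
From mathcomp Require Import all_classical all_reals all_analysis.
From mathcomp Require Import polyrcf.

Set Implicit Arguments.
Unset Strict Implicit.
Unset Printing Implicit Defensive.

Import Order.TTheory GRing.Theory Num.Theory.
Import numFieldNormedType.Exports.

Local Open Scope classical_set_scope.
Local Open Scope ring_scope.

(* Units: the speed of light and the particle rest mass are 1. *)

Definition coshR (R : realType) (x : R) : R := (expR x + expR (- x)) / 2.

Definition besselK (R : realType) (n : nat) (zeta : R) : R :=
  \int[@lebesgue_measure R]_(t in `[0, +oo[)
    (coshR (n%:R * t) * expR (- zeta * coshR t)).

(* omega^(l), used for l = 0, 1; for l = 0 it is singular at x = 1, where powR
   gives the value 0, which is irrelevant since {1} has measure 0. *)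
Definition weight (R : realType) (l : nat) (zeta x : R) : R :=
  (besselK 1 zeta)^-1 * ((x ^+ 2 - 1) `^ (l%:R - 2^-1)) * expR (- zeta * x).

Definition ipw (R : realType) (l : nat) (zeta : R) (f g : {poly R}) : R :=
  \int[@lebesgue_measure R]_(x in `[1, +oo[) (f.[x] * g.[x] * weight l zeta x).

Definition orthonormal_polys (R : realType) (l : nat) (zeta : R)
    (P : nat -> {poly R}) : Prop :=
  [/\ forall n, size (P n) = n.+1,
      forall n, 0 < lead_coef (P n)
    & forall m n, ipw l zeta (P m) (P n) = (m == n)%:R].

(* The (unique) family P_n^(l)(. ; zeta). *)
Definition opoly (R : realType) (l : nat) (zeta : R) : nat -> {poly R} :=
  xget (fun=> 0) [set P | orthonormal_polys l zeta P].

Definition lc (R : realType) (l : nat) (zeta : R) (n : nat) : R :=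
  lead_coef (opoly l zeta n).

(* rootsR lists the distinct real roots of a polynomial in increasing order. *)
Definition zeros (R : realType) (l : nat) (zeta : R) (n : nat) : seq R :=
  rootsR (opoly l zeta n).

(* x_{i,n}^(l), with i = 1, ..., n. *)
Definition xzero (R : realType) (l : nat) (zeta : R) (i n : nat) : R :=
  (zeros l zeta n)`_i.-1.

Definition acoef (R : realType) (l : nat) (zeta : R) (n : nat) : R :=
  lc l zeta n / lc l zeta n.+1.

Definition bcoef (R : realType) (l : nat) (zeta : R) (n : nat) : R :=
  ipw l zeta ('X * opoly l zeta n) (opoly l zeta n).

Definition pcoef (R : realType) (zeta : R) (n : nat) : R :=
  lc 0 zeta n / lc 1 zeta n.

Definition qcoef (R : realType) (zeta : R) (n : nat) : R :=
  lc 1 zeta n / lc 0 zeta n.+1 *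
  (\sum_(1 <= i < n.+3) xzero 0 zeta i n.+2 - \sum_(1 <= i < n.+1) xzero 1 zeta i n).

Definition rcoef (R : realType) (zeta : R) (n : nat) : R :=
  lc 1 zeta n.-1 / lc 0 zeta n.+1.

(* Indices are shifted so that the argument is the number of rows:
   Jmat l zeta n is J_{n-1}^(l) and Jmix zeta n is J_{n-1}, for n >= 1. *)
Definition Jmat (R : realType) (l : nat) (zeta : R) (n : nat) : 'M[R]_n :=
  \matrix_(k < n, j < n)
    (if k == j :> nat then bcoef l zeta k
     else if k.+1 == j :> nat then acoef l zeta k
     else if j.+1 == k :> nat then acoef l zeta j
     else 0).

Definition Jmix (R : realType) (zeta : R) (n : nat) : 'M[R]_(n, n.+1) :=
  \matrix_(k < n, j < n.+1)
    (if j == k :> nat then pcoef zeta k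
     else if j == k.+1 :> nat then qcoef zeta k
     else if j == k.+2 :> nat then rcoef zeta k.+1
     else 0).

(* All square matrices of order 2M+1 are indexed by 'I_(M.+1 + M). *)
Definition Amat0 (R : realType) (M : nat) (zeta : R) : 'M[R]_(M.+1 + M) :=
  block_mx (Jmat 0 zeta M.+1) 0 0 (Jmat 1 zeta M).

Definition Amat1 (R : realType) (M : nat) (zeta : R) : 'M[R]_(M.+1 + M) :=
  block_mx 0 (Jmix zeta M)^T (Jmix zeta M) 0.

(* (l, n) such that the k-th component of the interleaved basis
   (P~_0^(0), P~_1^(0), P~_0^(1), P~_2^(0), P~_1^(1), ...) is P~_n^(l). *)
Definition interleaved (k : nat) : nat * nat :=
  if k == 0%N then (0%N, 0%N)
  else if odd k then (0%N, k./2.+1) else (1%N, k./2.-1).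

(* The same for (P~_0^(0), ..., P~_M^(0), P~_0^(1), ..., P~_{M-1}^(1)). *)
Definition stacked (M : nat) (s : 'I_(M.+1 + M)) : nat * nat :=
  match fintype.split s with
  | inl a => (0%N, a : nat)
  | inr b => (1%N, b : nat)
  end.

Definition Pperm (R : realType) (M : nat) : 'M[R]_(M.+1 + M) :=
  \matrix_(k, s) (interleaved k == stacked s)%:R.

Definition Qpoly (R : realType) (M : nat) (zeta : R) : {poly R} :=
  opoly 0 zeta M.+1 * (opoly 1 zeta M \Po - 'X) +
  (opoly 0 zeta M.+1 \Po - 'X) * opoly 1 zeta M.

(* z_{i,M} for i = +-1, ..., +-M: z_{1,M} < ... < z_{M,M} are the positive zeros
   of Q_{2M} and z_{-i,M} = - z_{i,M}. *)
Definition zQ (R : realType) (M : nat) (zeta : R) (i : int) : R :=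
  (sgz i)%:~R * [seq x <- rootsR (Qpoly M zeta) | 0 < x]`_(`|i|%N.-1).

Definition lambdahat (R : realType) (M : nat) (zeta : R) (i : int) : R :=
  if i == 0 then 0
  else Num.sqrt (zQ M zeta i ^+ 2 - 1) / zQ M zeta i.

(* Pvec l zeta n x = (P_0^(l)(x), ..., P_{n-1}^(l)(x))^T. *)
Definition Pvec (R : realType) (l : nat) (zeta : R) (n : nat) (x : R) :
    'cV[R]_n :=
  \col_(k < n) (opoly l zeta k).[x].

Definition uvec (R : realType) (M : nat) (zeta : R) (i : int) : 'cV[R]_M.+1 :=
  if i == 0 then
    (opoly 0 zeta M.+1).[-1] *: Pvec 0 zeta M.+1 1 -
    (opoly 0 zeta M.+1).[1] *: Pvec 0 zeta M.+1 (-1)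
  else
    let z := zQ M zeta i in
    (opoly 1 zeta M).[- z] *: Pvec 0 zeta M.+1 z +
    (opoly 1 zeta M).[z] *: Pvec 0 zeta M.+1 (- z).

Definition vvec (R : realType) (M : nat) (zeta : R) (i : int) : 'cV[R]_M :=
  if i == 0 then 0
  else
    let z := zQ M zeta i in
    Num.sqrt (z ^+ 2 - 1) *:
      ((opoly 1 zeta M).[- z] *: Pvec 1 zeta M z -
       (opoly 1 zeta M).[z] *: Pvec 1 zeta M (- z)).

Definition yvec (R : realType) (M : nat) (zeta : R) (i : int) :
    'cV[R]_(M.+1 + M) :=
  col_mx (uvec M zeta i) (vvec M zeta i).

Definition U0 (R : realType) (u : R) : R := (Num.sqrt (1 - u ^+ 2))^-1.
Definition U1 (R : realType) (u : R) : R := u * U0 u.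
Definition mom0 (R : realType) (p : R) : R := Num.sqrt (1 + p ^+ 2).
Definition energy (R : realType) (u p : R) : R := U0 u * mom0 p - U1 u * p.
Definition pspace (R : realType) (u p : R) : R := - p + U1 u * energy u p.

Definition gweight (R : realType) (u theta p : R) : R :=
  (2 * besselK 1 theta^-1)^-1 * expR (- theta^-1 * energy u p).

Definition Ptilde (R : realType) (l n : nat) (u theta p : R) : R :=
  gweight u theta p * (opoly l theta^-1 n).[energy u p] *
  (if l == 0%N then 1 else pspace u p / U0 u).

Definition basis (R : realType) (k : nat) (u theta p : R) : R :=
  Ptilde (interleaved k).1 (interleaved k).2 u theta p.

Definition ipg (R : realType) (u theta : R) (f h : R -> R) : R :=
  \int[@lebesgue_measure R]_(p in [set: R])
    (f p * h p / gweight u theta p / mom0 p).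

(* The k-th component of W = (rho, u, theta, Pi, n~^1, f_3^0, f_2^1, ...). The
   value is 0 past the end, so Pi = n~^1 = 0 when M = 1, and fcoef below then
   gives (rho / c_0^(0), 0, 0). *)
Definition Wcomp (R : realType) (M : nat) (W : 'cV[R]_(M.+1 + M)) (k : nat) : R :=
  oapp (fun i => W i ord0) 0 (insub k).

Definition rho_of (R : realType) (M : nat) (W : 'cV[R]_(M.+1 + M)) := Wcomp W 0.
Definition u_of (R : realType) (M : nat) (W : 'cV[R]_(M.+1 + M)) := Wcomp W 1.
Definition theta_of (R : realType) (M : nat) (W : 'cV[R]_(M.+1 + M)) := Wcomp W 2.
Definition Pi_of (R : realType) (M : nat) (W : 'cV[R]_(M.+1 + M)) := Wcomp W 3.
Definition n1_of (R : realType) (M : nat) (W : 'cV[R]_(M.+1 + M)) := Wcomp W 4.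
Definition zeta_of (R : realType) (M : nat) (W : 'cV[R]_(M.+1 + M)) :=
  (theta_of W)^-1.

(* The k-th component of f_M; for k >= 5 it is the k-th component of W. *)
Definition fcoef (R : realType) (M : nat) (W : 'cV[R]_(M.+1 + M)) (k : nat) : R :=
  let zeta := zeta_of W in
  match k with
  | 0 => rho_of W / lc 0 zeta 0 - lc 0 zeta 0 * Pi_of W
  | 1 => lc 0 zeta 1 * xzero 0 zeta 1 1 * Pi_of W
  | 2 => - lc 1 zeta 0 * n1_of W
  | 3 => - lc 0 zeta 2 * xzero 0 zeta 1 2 * xzero 0 zeta 2 2 * Pi_of W
  | 4 => lc 1 zeta 1 * xzero 1 zeta 1 1 * n1_of W
  | _ => Wcomp W k
  end.

Definition Fdist (R : realType) (M : nat) (W : 'cV[R]_(M.+1 + M)) (p : R) : R :=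
  \sum_(k < M.+1 + M) basis k (u_of W) (theta_of W) p * fcoef W k.

(* The partial derivative of F(W; p) with respect to the j-th component of W. *)
Definition dFdist (R : realType) (M : nat) (W : 'cV[R]_(M.+1 + M))
    (j : 'I_(M.+1 + M)) (p : R) : R :=
  derive1 (fun t : R => Fdist (W + t *: delta_mx j ord0) p) 0.

Definition Dmat (R : realType) (M : nat) (W : 'cV[R]_(M.+1 + M)) :
    'M[R]_(M.+1 + M) :=
  \matrix_(k, j)
    ipg (u_of W) (theta_of W) (dFdist W j) (basis k (u_of W) (theta_of W)).

Definition Mt (R : realType) (M : nat) (W : 'cV[R]_(M.+1 + M)) :
    'M[R]_(M.+1 + M) :=
  Pperm R M *m (U0 (u_of W) *: Amat0 M (zeta_of W) -
                U1 (u_of W) *: Amat1 M (zeta_of W)) *m (Pperm R M)^T.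

Definition Mx (R : realType) (M : nat) (W : 'cV[R]_(M.+1 + M)) :
    'M[R]_(M.+1 + M) :=
  Pperm R M *m (U1 (u_of W) *: Amat0 M (zeta_of W) -
                U0 (u_of W) *: Amat1 M (zeta_of W)) *m (Pperm R M)^T.

Definition Bmat0 (R : realType) (M : nat) (W : 'cV[R]_(M.+1 + M)) :
    'M[R]_(M.+1 + M) := Mt W *m Dmat W.

Definition Bmat1 (R : realType) (M : nat) (W : 'cV[R]_(M.+1 + M)) :
    'M[R]_(M.+1 + M) := Mx W *m Dmat W.

Definition admissible (R : realType) (M : nat) (W : 'cV[R]_(M.+1 + M)) : Prop :=
  [/\ 0 < rho_of W, `|u_of W| < 1, 0 < theta_of W
    & (2 <= M)%N -> - (rho_of W * theta_of W) < Pi_of W].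

Definition gen_eigenvector (R : realType) (n : nat) (B0 B1 : 'M[R]_n)
    (lambda : R) (r : 'cV[R]_n) : Prop :=
  r != 0 /\ lambda *: (B0 *m r) = B1 *m r.

Definition gen_eigenvalue (R : realType) (n : nat) (B0 B1 : 'M[R]_n)
    (lambda : R) : Prop :=
  exists r : 'cV[R]_n, gen_eigenvector B0 B1 lambda r.

Definition lambda_of (R : realType) (M : nat) (W : 'cV[R]_(M.+1 + M))
    (i : int) : R :=
  (u_of W - lambdahat M (zeta_of W) i) /
  (1 - u_of W * lambdahat M (zeta_of W) i).

Definition rvec_of (R : realType) (M : nat) (W : 'cV[R]_(M.+1 + M))
    (i : int) : 'cV[R]_(M.+1 + M) :=
  invmx (Dmat W) *m Pperm R M *m yvec M (zeta_of W) i.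

(* Main.v *)
Require Import Defs.
From HB Require Import structures.
From mathcomp Require Import all_boot all_order all_algebra.
From mathcomp Require Import all_classical all_reals all_analysis.
From mathcomp Require Import measurable_realfun polyrcf ring lra zify.

(** With y = P^T D r, where P is the permutation and D the matrix of the change of
    unknowns, the generalized eigenvalue problem becomes
    (lambda - u) A^0 y = (lambda u - 1) A^1 y, because U^1 = u U^0 and U^0 > 0
    ([gen_eigenvector_pencil]). Hence lambda is an eigenvalue exactly if
    (u - lambda) / (1 - u lambda) is one of the pencil (A^0, A^1), and this Moebius map is an
    involution that preserves the interval (-1, 1) ([boostK], [boost_norm_lt1]). Two things
    remain: the pencil has the eigenvalues lambdahat_i with eigenvectors y_i, and the matrix
    of the change of unknowns is invertible.

    The pencil. The substitution x = cosh t turns both inner products into one linear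
    functional [juttner], positive on polynomials that are nonnegative on [1, oo): the
    weight of level 1 is x^2 - 1 times that of level 0 ([ipw_juttner]). The entries of J^(l)
    and J are means, at level l, of X P_k P_j and, at level 1, of P_k^(1) P_j^(0) ([JmatE],
    [JmixE]), so these matrices act on the vectors of polynomial values by truncated
    recurrences, with a remainder proportional to the first omitted polynomial. In y_i the
    remainders cancel, because z_i is a zero of Q or, for i = 0, because x^2 - 1 vanishes at
    1 and -1 ([pencil_eigenvector]). The zeros of P_M^(1) and P_(M+1)^(0) interlace: a
    quadrature at the zeros of P_(M+1)^(0), applied to (X^2 - 1) P_M^(1) times the product
    over all zeros but two, shows a sign change of P_M^(1) between neighbours
    ([zeros_interlace]). So Q has a zero between neighbours, M zeros above 1 in all
    ([positive_roots_Q]), and the 2M + 1 numbers lambdahat_i are distinct. As A^0 is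
    injective, the degree of a characteristic polynomial leaves no room for other
    eigenvalues ([regular_pencil_spectrum]).

    The change of unknowns. The ansatz is g (A(E) + B(E) s), where E is the energy, s the
    space component in the comoving frame, and A, B are polynomials whose coefficients depend
    on W. In rapidity coordinates s^2 = E^2 - 1, and s is odd while E and g are even, so the
    momentum inner product also reduces to the functional ([ipg_juttner]), and a column of
    Dmat consists of the coefficients of two polynomials ([DmatE]). Differentiation in u is
    a boost; differentiation in theta needs the derivative of the polynomials P_n^(l) in
    zeta, which exists by Gram-Schmidt and differentiation under the integral. Neither
    derivative has to be known: the parts of the ansatz in Pi and n~^1 are
    reproducing kernels at 0, so that A and B have explicit means against polynomials of low
    degree ([coef_poly0_reproduce], [coef_poly1_reproduce]), and integration by parts or
    differentiation in zeta carries this over to their derivatives. Testing a kernel vector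
    against 1, X and X^2 then shows that it is 0 ([Dmat_injective]); this uses
    Pi > - rho theta and strict Cauchy-Schwarz inequalities between moments. *)

Set Implicit Arguments.
Unset Strict Implicit.
Unset Printing Implicit Defensive.

Import Order.TTheory GRing.Theory Num.Theory.
Import numFieldNormedType.Exports.

Local Open Scope classical_set_scope.
Local Open Scope ring_scope.

(** * Change of variables over unbounded intervals *)

Section Substitution.
Variable R : realType.
Notation mu := (@lebesgue_measure R).

(** Monotone convergence along compact intervals that exhaust D reduces this to the
    substitution rule on a compact interval. Continuity is asked on E only, so that G may
    blow up at an excluded end of E. *)
Lemma ge0_integral_subst_increasing (F f G : R -> R) (a b : nat -> R)
    (D E : set R) :
  (forall n, a n < b n) ->
  {homo a : m n / (m <= n)%N >-> n <= m} ->
  {homo b : m n / (m <= n)%N >-> m <= n} ->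
  D = \bigcup_n `[a n, b n]%classic ->
  E = \bigcup_n `[F (a n), F (b n)]%classic ->
  (forall x y, D x -> D y -> x < y -> F x < F y) ->
  (forall x : R, is_derive x (1:R) F (f x)) ->
  continuous f ->
  (forall x, D x -> 0 <= f x) ->
  (forall x : R, E x -> {for x, continuous G}) ->
  (forall x, E x -> 0 <= G x) ->
  (\int[mu]_(x in E) (G x)%:E = \int[mu]_(x in D) (G (F x) * f x)%:E)%E.
Proof.
move=> ab da ib DE EE incF dF cf f0 cG G0.
have abD n x : x \in `[a n, b n] -> D x by move=> xab; rewrite DE; exists n.
have aD n : D (a n) by apply: (abD n); rewrite in_itv/= lexx ltW.
have bD n : D (b n) by apply: (abD n); rewrite in_itv/= lexx ltW.
have leF x y : D x -> D y -> x <= y -> F x <= F y.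
  by move=> Dx Dy; rewrite le_eqVlt => /predU1P[->//|xy]; rewrite ltW ?incF.
have Fab n x : x \in `[a n, b n] -> F (a n) <= F x <= F (b n).
  move=> xab; have xD := abD _ _ xab; move: xab; rewrite in_itv/=.
  by move=> /andP[ax xb]; rewrite !leF.
have FE x : D x -> E (F x).
  rewrite {1}DE => -[n _ xab]; rewrite EE; exists n => //=.
  by rewrite in_itv/=; exact: Fab.
have nd_ab : {homo (fun n => `[a n, b n]%classic) : n m / (n <= m)%N >-> (n <= m)%O}.
  move=> m n mn; apply/subsetPset/subset_itv; rewrite bnd_simp; [exact: da|exact: ib].
have nd_Fab : {homo (fun n => `[F (a n), F (b n)]%classic) : n m / (n <= m)%N >-> (n <= m)%O}.
  by move=> m n mn; apply/subsetPset/subset_itv; rewrite bnd_simp; apply: leF => //;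
    [exact: da|exact: ib].
have mG n : measurable_fun `[F (a n), F (b n)] G.
  apply: subspace_continuous_measurable_fun => //.
  apply: continuous_in_subspaceT => x; rewrite inE/= => xab.
  by apply: cG; rewrite EE; exists n.
have cF : continuous F.
  move=> x; have [dFx _] := dF x.
  exact/differentiable_continuous/derivable1_diffP.
have F'E : derive1 F = f.
  by apply/funext => x; have ? := dF x; rewrite derive1E derive_val.
have mGf n : measurable_fun `[a n, b n] (fun x => G (F x) * f x).
  apply: subspace_continuous_measurable_fun => //.
  apply: continuous_in_subspaceT => x; rewrite inE/= => xab.
  have Dx := abD _ _ xab.
  apply: continuousM; last exact: cf.
  apply: continuous_comp; first exact: cF.
  exact/cG/FE.
have lhs : ((\int[mu]_(x in `[F (a n), F (b n)]) (G x)%:E) @[n --> \oo]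
    --> \int[mu]_(x in E) (G x)%:E)%E.
  rewrite EE; apply: ge0_nondecreasing_set_cvg_integral => //.
    by move=> n; apply/measurable_EFinP; exact: mG.
  by move=> n x xab; rewrite lee_fin; apply: G0; rewrite EE; exists n.
have rhs : ((\int[mu]_(x in `[a n, b n]) (G (F x) * f x)%:E) @[n --> \oo]
    --> \int[mu]_(x in D) (G (F x) * f x)%:E)%E.
  rewrite DE; apply: ge0_nondecreasing_set_cvg_integral => //.
    by move=> n; apply/measurable_EFinP; exact: mGf.
  move=> n x xab; rewrite lee_fin; have Dx := abD _ _ xab.
  by rewrite mulr_ge0 ?f0//; apply/G0/FE.
move: lhs; rewrite (_ : (fun n => _) = (fun n => \int[mu]_(x in `[a n, b n]) (G (F x) * f x)%:E)%E); last first.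
  apply/funext => n.
  rewrite integration_by_substitution_increasing//.
  - by apply: eq_integral => x _; rewrite !fctE F'E.
  - exact: ltW.
  - by move=> x y xab yab; apply: incF; [exact: abD xab|exact: abD yab].
  - by rewrite F'E => x _; exact: cf.
  - by rewrite F'E; apply/cvg_ex; exists (f (a n)); apply: cvg_at_right_filter; exact: cf.
  - by rewrite F'E; apply/cvg_ex; exists (f (b n)); apply: cvg_at_left_filter; exact: cf.
  - split; first by move=> x _; have [] := dF x.
      by apply: cvg_at_right_filter; exact: cF.
    by apply: cvg_at_left_filter; exact: cF.
  - apply: continuous_in_subspaceT => x; rewrite inE/= => xab.
    by apply: cG; rewrite EE; exists n.
by move=> lhs; rewrite -(cvg_lim _ lhs)// -(cvg_lim _ rhs).
Qed.

(** The positive and negative parts of G are substituted separately. *)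
Lemma integral_subst_increasing (F f G : R -> R) (a b : nat -> R)
    (D E : set R) :
  (forall n, a n < b n) ->
  {homo a : m n / (m <= n)%N >-> n <= m} ->
  {homo b : m n / (m <= n)%N >-> m <= n} ->
  D = \bigcup_n `[a n, b n]%classic ->
  E = \bigcup_n `[F (a n), F (b n)]%classic ->
  (forall x y, D x -> D y -> x < y -> F x < F y) ->
  (forall x : R, is_derive x (1:R) F (f x)) ->
  continuous f ->
  (forall x, D x -> 0 <= f x) ->
  (forall x : R, E x -> {for x, continuous G}) ->
  \int[mu]_(x in E) G x = \int[mu]_(x in D) (G (F x) * f x).
Proof.
move=> ab da ib DE EE incF dF cf f0 cG; rewrite /Rintegral; congr fine.
rewrite [LHS]integralE [RHS]integralE.
have pos (g : R -> R) : (forall x : R, E x -> {for x, continuous g}) ->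
  (\int[mu]_(x in E) ((EFin \o g)^\+ x) =
   \int[mu]_(x in D) ((EFin \o (fun x => g (F x) * f x)%R)^\+ x))%E.
  move=> cg.
  transitivity (\int[mu]_(x in E) (Num.max (g x) 0)%:E)%E.
    by apply: eq_integral => x _; rewrite funeposE -EFin_max.
  rewrite (@ge0_integral_subst_increasing F f (fun x => Num.max (g x) 0) a b D E)//.
  - apply: eq_integral => x; rewrite inE => Dx; rewrite funeposE -EFin_max.
    by rewrite maxr_pMl ?mul0r ?f0.
  - move=> x Ex; apply: continuous_max; first exact: cg.
    exact: cst_continuous.
  - by move=> x _; rewrite le_max lexx orbT.
have neg (g : R -> R) : ((EFin \o g)^\- = (EFin \o (fun x => (- g x)%R))^\+)%E.
  by apply/funext => x; rewrite funeposE funenegE.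
rewrite (pos G)//; congr (_ - _)%E.
rewrite (neg G) (pos (fun x => - G x)); last by move=> x Ex; apply: continuousN; exact: cG.
rewrite neg; apply: eq_integral => x _; congr (_^\+ x)%E.
by apply/funext => y /=; rewrite mulNr.
Qed.

End Substitution.

(** * Hyperbolic functions and the moments of the weight *)

Section HyperbolicFunctions.
Variable R : realType.
Implicit Types x y : R.

Definition sinhR x : R := (expR x - expR (- x)) / 2.

Lemma is_derive_coshR x : is_derive x 1 (@coshR R) (sinhR x).
Proof.
rewrite /coshR /sinhR.
apply: is_derive_eq; rewrite /GRing.scale/=; ring.
Qed.

Lemma is_derive_sinhR x : is_derive x 1 sinhR (coshR x).
Proof.
rewrite /sinhR /coshR.
apply: is_derive_eq; rewrite /GRing.scale/=; ring.
Qed.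

Lemma continuous_coshR : continuous (@coshR R).
Proof.
move=> x; have [dFx _] := is_derive_coshR x.
exact/differentiable_continuous/derivable1_diffP.
Qed.

Lemma continuous_sinhR : continuous sinhR.
Proof.
move=> x; have [dFx _] := is_derive_sinhR x.
exact/differentiable_continuous/derivable1_diffP.
Qed.

Lemma coshRN x : coshR (- x) = coshR x.
Proof. by rewrite /coshR opprK addrC. Qed.

Lemma sinhRN x : sinhR (- x) = - sinhR x.
Proof. by rewrite /sinhR opprK; ring. Qed.

Lemma coshR0 : coshR (0 : R) = 1.
Proof. by rewrite /coshR oppr0 expR0; field. Qed.

Lemma sinhR0 : sinhR 0 = 0.
Proof. by rewrite /sinhR oppr0 subrr mul0r. Qed.

Lemma coshRD x y : coshR (x + y) = coshR x * coshR y + sinhR x * sinhR y.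
Proof. by rewrite /coshR /sinhR opprD !expRD; field. Qed.

Lemma sinhRD x y : sinhR (x + y) = sinhR x * coshR y + coshR x * sinhR y.
Proof. by rewrite /coshR /sinhR opprD !expRD; field. Qed.

Lemma coshR2 x : coshR x ^+ 2 = 1 + sinhR x ^+ 2.
Proof.
have := coshRD x (- x); rewrite subrr coshR0 coshRN sinhRN => ->; ring.
Qed.

Lemma coshR_gt0 x : 0 < coshR x.
Proof. by rewrite /coshR divr_gt0// addr_gt0// expR_gt0. Qed.

Lemma coshR_ge1 x : 1 <= coshR x.
Proof.
have : 1 <= coshR x ^+ 2 by rewrite coshR2 lerDl sqr_ge0.
by rewrite expr_ge1// ltW// coshR_gt0.
Qed.

Lemma sqrt_1sinhR2 x : Num.sqrt (1 + sinhR x ^+ 2) = coshR x.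
Proof. by rewrite -coshR2 sqrtr_sqr ger0_norm// ltW// coshR_gt0. Qed.

Lemma sinhR_le_coshR x : sinhR x <= coshR x.
Proof. by rewrite /sinhR /coshR ler_pM2r// lerD2l; have := expR_gt0 (- x); lra. Qed.

Lemma sinhR_ge0 x : 0 <= x -> 0 <= sinhR x.
Proof. by move=> x0; rewrite divr_ge0// subr_ge0 ler_expR; lra. Qed.

Lemma sinhR_gt0 x : 0 < x -> 0 < sinhR x.
Proof. by move=> x0; rewrite divr_gt0// subr_gt0 ltr_expR; lra. Qed.

Lemma sinhR_lt x y : x < y -> sinhR x < sinhR y.
Proof.
move=> xy; rewrite /sinhR ltr_pM2r// ltrD// ?ltr_expR//.
by rewrite ltrN2 ltr_expR ltrN2.
Qed.

Lemma sinhR_le x y : x <= y -> sinhR x <= sinhR y.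
Proof. by rewrite le_eqVlt => /predU1P[->//|xy]; rewrite ltW// sinhR_lt. Qed.

Lemma coshR_lt x y : 0 <= x -> x < y -> coshR x < coshR y.
Proof.
move=> x0 xy; rewrite -(@ltr_pXn2r _ 2) ?nnegrE ?(ltW (coshR_gt0 _))// !coshR2.
by rewrite ltrD2l ltr_pXn2r// ?nnegrE ?sinhR_ge0 ?sinhR_lt//; lra.
Qed.

Lemma coshR_le x y : 0 <= x -> x <= y -> coshR x <= coshR y.
Proof. by move=> x0; rewrite le_eqVlt => /predU1P[->//|xy]; rewrite ltW// coshR_lt. Qed.

Lemma ge_sinhR x : 0 <= x -> x <= sinhR x.
Proof.
move=> x0; rewrite -subr_ge0.
pose f (y : R) := sinhR y - y.
have df (y : R) : is_derive y (1:R) f (coshR y - 1).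
  exact: is_deriveB (is_derive_sinhR y) (is_derive_id y 1).
have : f 0 <= f x.
  have [->//|xn0] := eqVneq x 0.
  have x_gt0 : 0 < x by rewrite lt_neqAle eq_sym xn0.
  apply: (@ger0_derive1_le_cc _ f 0 x) => //.
  - move=> y _; have ? := df y; rewrite derive1E derive_val subr_ge0.
    exact: coshR_ge1.
  - apply: continuous_subspaceT => y; have [? _] := df y.
    exact/differentiable_continuous/derivable1_diffP.
  - by rewrite in_itv/= lexx.
  - by rewrite in_itv/= x0 lexx.
by rewrite /f sinhR0 subr0.
Qed.

Lemma ge_coshR x : 0 <= x -> x <= coshR x.
Proof.
move=> /ge_sinhR; have := expR_gt0 (- x); rewrite /coshR /sinhR; lra.
Qed.

End HyperbolicFunctions.

Section CoshMoments.
Variable R : realType.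
Notation mu := (@lebesgue_measure R).

(** From the Taylor lower bound (z y)^k / k! <= exp(z y). *)
Lemma exprM_expRN_le (k : nat) (z y : R) : 0 < z -> 0 <= y ->
  y ^+ k * expR (- z * y) <= k`!%:R / z ^+ k.
Proof.
move=> z0 y0; rewrite mulNr expRN ler_pdivrMr ?expR_gt0//.
rewrite mulrAC ler_pdivlMr ?exprn_gt0// -exprMn.
have zy0 : 0 <= z * y by rewrite mulr_ge0// ltW.
rewrite (mulrC y z); case: k => [|k].
  by rewrite expr0 fact0 mul1r (le_trans _ (expR_ge1Dx _))// lerDl.
rewrite -ler_pdivrMl ?ltr0n ?fact_gt0//.
by rewrite [leLHS]mulrC (le_trans _ (expR_ge1Dxn k zy0))// lerDr.
Qed.

Lemma continuous_expRMcoshR (z : R) : continuous (fun t => expR (- z * coshR t)).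
Proof.
move=> t; apply: (@continuous_comp _ _ _ (fun t => - z * coshR t) (@expR R)).
  apply: (@continuousM _ _ (fun=> - z) (@coshR R)).
    exact: cst_continuous.
  exact: continuous_coshR.
exact: continuous_expR.
Qed.

Definition cosh_integrand (k : nat) (z t : R) : R :=
  coshR t ^+ k * expR (- z * coshR t).

Lemma continuous_cosh_integrand k z : continuous (cosh_integrand k z).
Proof.
move=> t.
apply: (@continuousM _ _ (fun t => coshR t ^+ k) (fun t => expR (- z * coshR t))).
  apply: (@continuous_comp _ _ _ (@coshR R) (fun x => x ^+ k)).
    exact: continuous_coshR.
  exact: exprn_continuous.
exact: continuous_expRMcoshR.
Qed.

(** Since y^(k+1) exp(-z y) is bounded, the integrand decays like 1 / cosh. *)
Lemma cosh_integrand_le k (z t : R) : 0 < z -> 0 <= t ->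
  0 <= cosh_integrand k z t <= (2 * k.+1`!%:R / z ^+ k.+1) * expR (- t).
Proof.
move=> z0 t0; rewrite /cosh_integrand mulr_ge0 ?exprn_ge0 ?expR_ge0 ?(ltW (coshR_gt0 _))//=.
have bound := exprM_expRN_le k.+1 z0 (ltW (coshR_gt0 t)).
have ct : expR t <= 2 * coshR t.
  by rewrite /coshR mulrCA divff// mulr1 lerDl expR_ge0.
rewrite expRN ler_pdivlMr ?expR_gt0// -mulrA.
apply: (@le_trans _ _ (coshR t ^+ k * expR (- z * coshR t) * (2 * coshR t))).
  by rewrite ler_wpM2l// mulr_ge0 ?exprn_ge0 ?expR_ge0 ?(ltW (coshR_gt0 _)).
rewrite (_ : _ * _ * _ = 2 * (coshR t ^+ k.+1 * expR (- z * coshR t))).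
  by rewrite ler_pM2l.
by rewrite exprS; ring.
Qed.

Lemma continuous_expRN : continuous (fun t : R => expR (- t)).
Proof.
move=> x; apply: (@continuous_comp _ _ _ -%R (@expR R)).
  exact: opp_continuous.
exact: continuous_expR.
Qed.

Lemma integrable_expRN :
  mu.-integrable `[0, +oo[ (EFin \o (fun t : R => expR (- t))).
Proof.
apply/integrableP; split.
  apply/measurable_EFinP; apply: measurable_funTS.
  exact: (continuous_measurable_fun continuous_expRN).
rewrite [ltLHS](_ : _ = \int[mu]_(t in `[0%R, +oo[) (expR (- t))%:E)%E; last first.
  by apply: eq_integral => t _ /=; rewrite ger0_norm ?expR_ge0.
rewrite (@ge0_continuous_FTC2y _ _ (fun t : R => - expR (- t)) 0 0)//.
- by rewrite -EFinB ltry.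
- exact/continuous_subspaceT/continuous_expRN.
- rewrite -[X in _ --> X]oppr0; apply: cvgN; exact: cvgr_expR.
- apply: cvg_at_right_filter; apply: cvgN; exact: continuous_expRN.
- move=> x _; rewrite derive1E derive_val /GRing.scale/=; ring.
Qed.

Lemma integrable_cosh_integrand k z : 0 < z ->
  mu.-integrable `[0, +oo[ (EFin \o cosh_integrand k z).
Proof.
move=> z0.
apply: (@le_integrable _ _ _ mu _ _ _
    (EFin \o (fun t => (2 * k.+1`!%:R / z ^+ k.+1) * expR (- t)))) => //.
- apply/measurable_EFinP; apply: measurable_funTS.
  exact: (continuous_measurable_fun (continuous_cosh_integrand (k:=k) (z:=z))).
- move=> t /=; rewrite in_itv/= andbT => t0; rewrite lee_fin.
  have /andP[h0 h] := cosh_integrand_le k z0 t0.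
  by rewrite ger0_norm// ger0_norm// (le_trans h0).
- apply: (integrableZl _ _ integrable_expRN) => //.
Qed.

Definition cosh_moment (k : nat) (z : R) : R :=
  \int[mu]_(t in `[0, +oo[) cosh_integrand k z t.

Lemma besselK1E z : besselK 1 z = cosh_moment 1 z.
Proof.
by apply: eq_Rintegral => t _; rewrite /cosh_integrand expr1 mul1r.
Qed.

(** Differentiation under the integral sign, the derivative being dominated
    on (z/2, 2z) by the integrand at z/2. *)
Lemma is_derive_cosh_moment (k : nat) (z : R) : 0 < z ->
  is_derive z 1 (cosh_moment k) (- cosh_moment k.+1 z).
Proof.
move=> z0.
have dI (w t : R) : is_derive w (1:R) (cosh_integrand k ^~ t) (- cosh_integrand k.+1 w t).
  rewrite /cosh_integrand; apply: is_derive_eq.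
  by rewrite /GRing.scale/= exprS; ring.
have partE w t : partial1of2 (cosh_integrand k) w t = - cosh_integrand k.+1 w t.
  by rewrite partial1of2E; have ? := dI w t; rewrite derive_val.
have zI : z \in `](z / 2), (2 * z)[ by rewrite in_itv/=; apply/andP; split; lra.
have z2 : 0 < z / 2 by lra.
have Igt0 w : w \in `](z / 2), (2 * z)[ -> 0 < w.
  by rewrite in_itv/= => /andP[+ _]; apply: lt_trans.
have cvgD : h^-1 *: (cosh_moment k (h + z) - cosh_moment k z) @[h --> 0^']
    --> \int[mu]_(t in `[0, +oo[) partial1of2 (cosh_integrand k) z t.
  apply: (@cvg_differentiation_under_integral R _ _ mu (cosh_integrand k)
    `[0, +oo[%classic _ z (z / 2) (2 * z) zI _ _ (cosh_integrand k.+1 (z / 2))).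
  - by [].
  - by move=> w /= /Igt0 w0; exact: integrable_cosh_integrand.
  - by move=> w t _ _; have [] := dI w t.
  - by move=> t; rewrite mulr_ge0 ?exprn_ge0 ?expR_ge0 ?(ltW (coshR_gt0 _)).
  - exact: integrable_cosh_integrand.
  - move=> w t /= wI t0; rewrite partE normrN ger0_norm; last first.
      by rewrite mulr_ge0 ?exprn_ge0 ?expR_ge0 ?(ltW (coshR_gt0 _)).
    rewrite ler_wpM2l ?exprn_ge0 ?(ltW (coshR_gt0 _))// ler_expR.
    rewrite ler_pM2r ?coshR_gt0// lerN2 ltW//.
    by move: wI; rewrite in_itv/= => /andP[].
have <- : \int[mu]_(t in `[0, +oo[) partial1of2 (cosh_integrand k) z t
    = - cosh_moment k.+1 z.
  transitivity (\int[mu]_(t in `[0, +oo[) (- 1 * cosh_integrand k.+1 z t)).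
    by apply: eq_Rintegral => t _; rewrite partE mulN1r.
  by rewrite RintegralZl ?mulN1r//; exact: integrable_cosh_integrand.
have scale1 : (fun h : R => h^-1 *: (cosh_moment k (h *: (1 : R) + z) - cosh_moment k z))
    = (fun h => h^-1 *: (cosh_moment k (h + z) - cosh_moment k z)).
  by apply/funext => h; rewrite /GRing.scale/= mulr1.
apply: DeriveDef; first by rewrite /derivable scale1; apply/cvg_ex; eexists; exact: cvgD.
by rewrite /derive scale1; apply/cvg_lim.
Qed.

End CoshMoments.

(** * The positive functional of the weight *)

Section FunctionalOfMoments.
Variables (R : realType) (m : nat -> R).

Definition functional_of_moments (p : {poly R}) : R := \sum_(i < size p) p`_i * m i.

Lemma functional_of_moments_wide n (p : {poly R}) : (size p <= n)%N ->
  functional_of_moments p = \sum_(i < n) p`_i * m i.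
Proof.
move=> pn; rewrite /functional_of_moments.
rewrite (big_ord_widen n (fun i => p`_i * m i) pn) big_mkcond/=.
apply: eq_bigr => i _; case: ifPn => //; rewrite -leqNgt => pi.
by rewrite nth_default// mul0r.
Qed.

Lemma functional_of_moments_is_scalar : scalar functional_of_moments.
Proof.
move=> a p q.
have np : (size p <= maxn (size p) (size q))%N by rewrite leq_maxl.
have nq : (size q <= maxn (size p) (size q))%N by rewrite leq_maxr.
have npq : (size (a *: p + q)%R <= maxn (size p) (size q))%N.
  by rewrite (leq_trans (size_polyD _ _))// geq_max nq (leq_trans (size_scale_leq _ _)).
rewrite (functional_of_moments_wide npq) (functional_of_moments_wide np).
rewrite (functional_of_moments_wide nq) mulr_sumr -big_split/=.
by apply: eq_bigr => i _; rewrite coefD coefZ; ring.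
Qed.

HB.instance Definition _ := GRing.isLinear.Build R {poly R} R _
  functional_of_moments functional_of_moments_is_scalar.

Lemma functional_of_momentsXn n : functional_of_moments 'X^n = m n.
Proof.
rewrite /functional_of_moments size_polyXn big_ord_recr/= coefXn eqxx mul1r.
by rewrite big1 ?add0r// => i _; rewrite coefXn ltn_eqF// mul0r.
Qed.

End FunctionalOfMoments.

Section JuttnerFunctional.
Variable R : realType.
Implicit Types (z : R) (p : {poly R}).
Notation mu := (@lebesgue_measure R).

(** The mean of p(x) for the weight (x^2 - 1)^(-1/2) exp(-z x) / K_1(z), in the variable
    x = cosh t. Defining it by its moments makes it linear for every z. *)
Definition juttner (z : R) : {poly R} -> R :=
  functional_of_moments (fun k => cosh_moment k z / cosh_moment 1 z).

HB.instance Definition _ z := GRing.Linear.on (juttner z).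

Definition juttner_integrand (z : R) (p : {poly R}) (t : R) : R :=
  p.[coshR t] * expR (- z * coshR t).

Lemma juttner_integrandE z p t :
  juttner_integrand z p t = \sum_(i < size p) p`_i * cosh_integrand i z t.
Proof.
rewrite /juttner_integrand horner_coef mulr_suml.
by apply: eq_bigr => i _; rewrite -mulrA.
Qed.

Lemma integrable_juttner_integrand z p : 0 < z ->
  mu.-integrable `[0, +oo[ (EFin \o juttner_integrand z p).
Proof.
move=> z0.
have -> : EFin \o juttner_integrand z p =
    (fun t => \sum_(i < size p) (p`_i * cosh_integrand i z t)%:E)%E.
  by apply/funext => t /=; rewrite juttner_integrandE sumEFin.
apply: integrable_sum => // i _.
exact: (integrableZl _ _ (integrable_cosh_integrand i z0)).
Qed.

Lemma Rintegral_juttner_integrand z p : 0 < z ->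
  \int[mu]_(t in `[0, +oo[) juttner_integrand z p t =
  \sum_(i < size p) p`_i * cosh_moment i z.
Proof.
move=> z0; rewrite /Rintegral.
have -> : (\int[mu]_(t in `[0%R, +oo[) (juttner_integrand z p t)%:E =
   \int[mu]_(t in `[0%R, +oo[) (\sum_(i < size p) (p`_i * cosh_integrand i z t)%:E))%E.
  by apply: eq_integral => t _; rewrite juttner_integrandE sumEFin.
rewrite integral_sum//; last first.
  by move=> i; exact: (integrableZl _ _ (integrable_cosh_integrand i z0)).
have fin i : (\int[mu]_(t in `[0%R, +oo[) (p`_i * cosh_integrand i z t)%:E)%E \is a fin_num.
  by apply: integrable_fin_num => //; exact: (integrableZl _ _ (integrable_cosh_integrand i z0)).
rewrite -sum_fine; last by move=> i _; exact: fin.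
apply: eq_bigr => i _; rewrite -RintegralZl//.
exact: integrable_cosh_integrand.
Qed.

Lemma continuous_juttner_integrand z p : continuous (juttner_integrand z p).
Proof.
move=> t; apply: (@continuousM _ _ (fun t => p.[coshR t]) (fun t => expR (- z * coshR t))).
  apply: (@continuous_comp _ _ _ (@coshR R) (horner p)); first exact: continuous_coshR.
  exact: continuous_horner.
exact: continuous_expRMcoshR.
Qed.

(** A polynomial that is not zero has no root beyond some point, so its
    integrand is bounded below by a positive constant on a unit interval. *)
Lemma Rintegral_juttner_integrand_gt0 (z : R) (p : {poly R}) : 0 < z -> p != 0 ->
  (forall x, 1 <= x -> 0 <= p.[x]) ->
  0 < \int[mu]_(t in `[0, +oo[) juttner_integrand z p t.
Proof.
move=> z0 pn0 p0.
have g0 t : 0 <= juttner_integrand z p t.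
  by rewrite mulr_ge0 ?expR_ge0 ?p0 ?coshR_ge1.
pose c := Num.max 0 (cauchy_bound p).
have gc t : c <= t -> 0 < juttner_integrand z p t.
  rewrite /c ge_max => /andP[t0 tc].
  rewrite lt_neqAle g0 andbT eq_sym mulf_neq0 ?gt_eqF ?expR_gt0//.
  rewrite lt_neqAle p0 ?coshR_ge1// andbT eq_sym.
  apply/negP => /eqP/(cauchy_boundP pn0).
  by rewrite ltNge ger0_norm ?(ltW (coshR_gt0 _))// (le_trans tc)// ge_coshR.
have c0 : 0 <= c by rewrite /c le_max lexx.
have cg := @continuous_juttner_integrand z p.
have cc1 : c <= c + 1 by lra.
have [d dc dmin] := @EVT_min R (juttner_integrand z p) c (c + 1) cc1
  (continuous_subspaceT cg).
have dgt0 : 0 < juttner_integrand z p d.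
  by apply: gc; move: dc; rewrite in_itv/= => /andP[].
have mg : measurable_fun [set: R] (juttner_integrand z p) by exact: continuous_measurable_fun.
have ifin := integrable_juttner_integrand p z0.
have finI : (\int[mu]_(t in `[0%R, +oo[) (juttner_integrand z p t)%:E)%E \is a fin_num.
  exact: integrable_fin_num.
rewrite -lte_fin /Rintegral fineK//.
apply: (@lt_le_trans _ _ (\int[mu]_(t in `[c, (c + 1)%R]) (juttner_integrand z p d)%:E)%E).
  rewrite integral_cst//= lebesgue_measure_itv/= lte_fin ltrDl ltr01.
  by rewrite -EFinB -EFinM lte_fin mulr_gt0// subr_gt0 ltrDl.
apply: (@le_trans _ _ (\int[mu]_(t in `[c, (c + 1)%R]) (juttner_integrand z p t)%:E)%E).
  apply: ge0_le_integral => //=.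
  - by move=> t _; rewrite lee_fin ltW.
  - by apply/measurable_EFinP; exact: measurable_funTS mg.
apply: ge0_subset_integral => //=.
- by apply/measurable_EFinP; exact: measurable_funTS mg.
- by move=> t _; rewrite lee_fin.
- by move=> t /=; rewrite !in_itv/= andbT => /andP[ct _]; exact: le_trans ct.
Qed.

Lemma cosh_moment_gt0 k (z : R) : 0 < z -> 0 < cosh_moment k z.
Proof.
move=> z0; have := @Rintegral_juttner_integrand_gt0 z 'X^k z0 _ _.
rewrite /cosh_moment (_ : juttner_integrand z 'X^k = cosh_integrand k z); last first.
  by apply/funext => t; rewrite /juttner_integrand hornerXn.
apply; first by rewrite -size_poly_gt0 size_polyXn.
by move=> x x1; rewrite hornerXn exprn_ge0// (le_trans ler01).
Qed.

Lemma juttnerE z p : 0 < z -> juttner z p =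
  (cosh_moment 1 z)^-1 * \int[mu]_(t in `[0, +oo[) juttner_integrand z p t.
Proof.
move=> z0; rewrite Rintegral_juttner_integrand// /juttner/functional_of_moments mulr_sumr.
by apply: eq_bigr => i _; ring.
Qed.

Lemma juttner_gt0 z p : 0 < z -> p != 0 -> (forall x, 1 <= x -> 0 <= p.[x]) ->
  0 < juttner z p.
Proof.
move=> z0 pn0 p0; rewrite juttnerE// mulr_gt0 ?invr_gt0 ?cosh_moment_gt0//.
exact: Rintegral_juttner_integrand_gt0.
Qed.

Lemma juttnerX z : 0 < z -> juttner z 'X = 1.
Proof.
by move=> z0; rewrite /juttner -['X]expr1 functional_of_momentsXn divff// gt_eqF// cosh_moment_gt0.
Qed.

End JuttnerFunctional.

(** * The weighted inner products *)

Section HyperbolicSubstitution.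
Variable R : realType.
Implicit Types (z x y t : R) (p q f g : {poly R}).
Notation mu := (@lebesgue_measure R).

Definition arsinh y : R := ln (y + Num.sqrt (1 + y ^+ 2)).

Lemma sqrt1D2_gt y : `|y| < Num.sqrt (1 + y ^+ 2).
Proof. by rewrite -sqrtr_sqr ltr_sqrt ?ltrDr// ltr_pwDl// sqr_ge0. Qed.

Lemma arsinhK : cancel arsinh (@sinhR R).
Proof.
move=> y; have := sqrt1D2_gt y; rewrite ltr_norml => /andP[h1 h2].
have y0 : 0 < y + Num.sqrt (1 + y ^+ 2) by lra.
rewrite /sinhR expRN lnK ?posrE//.
have s2 : Num.sqrt (1 + y ^+ 2) ^+ 2 = 1 + y ^+ 2.
  by rewrite sqr_sqrtr// addr_ge0// sqr_ge0.
have -> : (y + Num.sqrt (1 + y ^+ 2))^-1 = Num.sqrt (1 + y ^+ 2) - y.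
  by apply: (mulfI (lt0r_neq0 y0)); rewrite mulfV ?lt0r_neq0//; ring: s2.
by field.
Qed.

Lemma coshR_arsinh y : coshR (arsinh y) = Num.sqrt (1 + y ^+ 2).
Proof. by rewrite -{2}(arsinhK y) sqrt_1sinhR2. Qed.

Lemma arsinh_gt0 y : 0 < y -> 0 < arsinh y.
Proof.
move=> y0; rewrite ltNge; apply/negP => h.
have : 0 <= sinhR (- arsinh y) by apply: sinhR_ge0; rewrite oppr_ge0.
by rewrite sinhRN arsinhK oppr_ge0 leNgt y0.
Qed.

Lemma coshR_surj x : 1 < x -> exists2 t, 0 < t & coshR t = x.
Proof.
move=> x1; have x21 : 0 < x ^+ 2 - 1 by rewrite subr_gt0 expr_gt1// ltW// (lt_trans ltr01).
exists (arsinh (Num.sqrt (x ^+ 2 - 1))); first by apply: arsinh_gt0; rewrite sqrtr_gt0.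
rewrite coshR_arsinh sqr_sqrtr ?(ltW x21)// addrCA subrr addr0 sqrtr_sqr ger0_norm//.
by rewrite (le_trans ler01)// ltW.
Qed.

Lemma bigcup_itv_gt0 :
  `]0, +oo[%classic = \bigcup_n `[(n.+1%:R : R)^-1, n.+2%:R]%classic.
Proof.
apply/seteqP; split => x /=; last first.
  by case=> n _ /=; rewrite !in_itv/= andbT => /andP[+ _]; apply: lt_le_trans; rewrite invr_gt0.
rewrite in_itv/= andbT => x0.
have xx : 0 <= x + x^-1 by rewrite addr_ge0 ?invr_ge0 ?(ltW x0).
have [_ h] := andP (truncn_itv xx); exists (Num.truncn (x + x^-1)) => //=.
set n := Num.truncn _ in h *.
have xi0 : 0 < x^-1 by rewrite invr_gt0.
have nS : n.+2%:R = n.+1%:R + 1 :> R by rewrite -natr1.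
rewrite in_itv/=; apply/andP; split; last by rewrite nS; lra.
rewrite -[leRHS]invrK lef_pV2 ?posrE ?ltr0n//; lra.
Qed.

Lemma bigcup_itvT : [set: R] = \bigcup_n `[- (n.+1%:R : R), n.+1%:R]%classic.
Proof.
apply/seteqP; split => // x _.
have [_ h] := andP (truncn_itv (normr_ge0 x)).
by exists (Num.truncn `|x|) => //=; rewrite in_itv/= -ler_norml ltW.
Qed.

Lemma bigcup_coshR_itv : `]1, +oo[%classic =
  \bigcup_n `[coshR (n.+1%:R : R)^-1, coshR (n.+2%:R : R)]%classic.
Proof.
apply/seteqP; split => x /=; last first.
  case=> n _ /=; rewrite !in_itv/= andbT => /andP[+ _]; apply: lt_le_trans.
  by rewrite -[ltLHS]coshR0 coshR_lt// invr_gt0.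
rewrite in_itv/= andbT => /coshR_surj[t t0 <-].
have : `]0, +oo[%classic t by rewrite /= in_itv/= t0.
rewrite bigcup_itv_gt0 => -[n _ /=]; rewrite in_itv/= => /andP[h1 h2].
exists n => //=; rewrite in_itv/=.
by rewrite !coshR_le// ?invr_ge0// ltW.
Qed.

Lemma weightE l z x : weight l z x =
  (cosh_moment 1 z)^-1 * (x ^+ 2 - 1) `^ (l%:R - 2^-1) * expR (- z * x).
Proof. by rewrite /weight besselK1E. Qed.

Lemma powR_sinhR2 l t : 0 < t ->
  (coshR t ^+ 2 - 1) `^ (l%:R - 2^-1) * sinhR t = (coshR t ^+ 2 - 1) ^+ l.
Proof.
move=> t0; have s0 := sinhR_gt0 t0.
rewrite coshR2 addrAC subrr add0r -exprM -powR_mulrn ?ltW// -powRrM.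
rewrite -[X in _ * X](powRr1 (ltW s0)) -powRD; last by rewrite (gt_eqF s0) implybT.
rewrite -powR_mulrn ?ltW//; congr (_ `^ _).
by rewrite natrM; field.
Qed.

Lemma is_derive1_continuous (h : R -> R) x (d : R) :
  is_derive x (1:R) h d -> {for x, continuous h}.
Proof.
by case=> dh _; exact/differentiable_continuous/derivable1_diffP.
Qed.

Lemma continuous_weight l z x : 1 < x -> {for x, continuous (weight l z)}.
Proof.
move=> x1; rewrite /weight.
have x21 : 0 < x ^+ 2 - 1 by rewrite subr_gt0 expr_gt1// ltW// (lt_trans ltr01).
have d1 : is_derive x (1:R) (fun y : R => (y ^+ 2 - 1) `^ (l%:R - 2^-1))
   (((l%:R - 2^-1) * (x ^+ 2 - 1) `^ (l%:R - 2^-1 - 1)) * (2 * x)).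
  have d0 : is_derive x (1:R) (fun y : R => y ^+ 2 - 1) (2 * x).
    by apply: is_derive_eq; rewrite /GRing.scale/=; ring.
  exact: (@is_derive1_comp _ (fun y => y `^ (l%:R - 2^-1)) (fun y => y ^+ 2 - 1) _ _ _ (is_derive1_powR _ x21) d0).
have d2 : is_derive x (1:R) (fun y : R => expR (- z * y)) (expR (- z * x) * - z).
  by apply: is_derive_eq; rewrite /GRing.scale/=; ring.
apply: (@continuousM _ _ (fun y => (besselK 1 z)^-1 * (y ^+ 2 - 1) `^ (l%:R - 2^-1)) (fun y => expR (- z * y))).
  apply: (@continuousM _ _ (fun=> (besselK 1 z)^-1) (fun y => (y ^+ 2 - 1) `^ (l%:R - 2^-1))).
    exact: cst_continuous.
  exact: is_derive1_continuous d1.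
exact: is_derive1_continuous d2.
Qed.

(** Under x = cosh t the measure (x^2 - 1)^(l - 1/2) dx becomes (cosh^2 t - 1)^l dt, so
    the singularity at x = 1 disappears and both weights share one functional. *)
Lemma ipw_juttner l z f g : 0 < z -> ipw l z f g = juttner z (('X^2 - 1) ^+ l * (f * g)).
Proof.
move=> z0; rewrite juttnerE// /ipw.
pose h (x : R) := f.[x] * g.[x] * weight l z x.
have cw (x : R) : `]1, +oo[%classic x -> {for x, continuous h}.
  rewrite /= in_itv/= andbT => x1.
  apply: (@continuousM _ _ (fun x => f.[x] * g.[x]) (weight l z)).
    by apply: (@continuousM _ _ (horner f) (horner g)); exact: continuous_horner.
  exact: continuous_weight.
have mw : measurable_fun `](1 : R), +oo[ h.
  apply: open_continuous_measurable_fun; first exact: interval_open.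
  by move=> x; rewrite inE; exact: cw.
rewrite /Rintegral -integral_itv_obnd_cbnd; last by apply/measurable_EFinP.
rewrite -[LHS]/(Rintegral mu `]1, +oo[ h).
rewrite (@integral_subst_increasing R (@coshR R) (@sinhR R) h _ _ _ _ _ _ _
  bigcup_itv_gt0 bigcup_coshR_itv _ (@is_derive_coshR R)); first last.
- exact: cw.
- by move=> x /=; rewrite in_itv/= andbT => x0; rewrite ltW// sinhR_gt0.
- exact: continuous_sinhR.
- by move=> x y; rewrite /= !in_itv/= !andbT => x0 _; apply: coshR_lt; rewrite ltW.
- by move=> m n mn; rewrite ler_nat.
- by move=> m n mn; rewrite lef_pV2 ?posrE// ler_nat.
- by move=> n; rewrite (@le_lt_trans _ _ 1)// ?ltr1n// invf_le1// ler1n.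
have ij := integrable_juttner_integrand (('X^2 - 1) ^+ l * (f * g)) z0.
rewrite -RintegralZl//.
rewrite -Rintegral_itv_obnd_cbnd; last first.
  apply: (@integrableS _ _ _ mu _ _ _ (measurable_itv `[0, +oo[)) => //.
    by move=> x /=; rewrite !in_itv/= !andbT => /ltW.
  exact: (integrableZl _ _ ij).
apply: eq_Rintegral => t; rewrite inE/= in_itv/= andbT => t0.
rewrite /h weightE /juttner_integrand !hornerM horner_exp hornerD hornerN hornerXn hornerC -powR_sinhR2//.
ring.
Qed.

End HyperbolicSubstitution.

(** * Integration by parts *)

Section ImproperIntegrals.
Variable R : realType.
Notation mu := (@lebesgue_measure R).

Lemma bigcup_itv_ge0 : `[0, +oo[%classic = \bigcup_n `[0 : R, n.+1%:R]%classic.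
Proof.
apply/seteqP; split => x /=; last first.
  by case=> n _ /=; rewrite !in_itv/= andbT => /andP[].
rewrite in_itv/= andbT => x0.
have [_ h] := andP (truncn_itv x0).
by exists (Num.truncn x) => //=; rewrite in_itv/= x0 ltW.
Qed.

Lemma cvg_Rintegral_itv (f : R -> R) : continuous f ->
  mu.-integrable `[0, +oo[ (EFin \o f) ->
  \int[mu]_(x in `[0, n.+1%:R]) f x @[n --> \oo] --> \int[mu]_(x in `[0, +oo[) f x.
Proof.
move=> cf intf.
have mf : measurable_fun [set: R] f by exact: continuous_measurable_fun.
have nd : {homo (fun n => `[0 : R, n.+1%:R]%classic) : n m / (n <= m)%N >-> (n <= m)%O}.
  by move=> m n mn; apply/subsetPset/subset_itv; rewrite bnd_simp ?ler_nat.
have part (g : R -> \bar R) : measurable_fun [set: R] g -> (forall x, 0 <= g x)%E ->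
    ((\int[mu]_(x in `[0%R, n.+1%:R]) g x) @[n --> \oo] --> \int[mu]_(x in `[0%R, +oo[) g x)%E.
  move=> mg g0; rewrite bigcup_itv_ge0; apply: ge0_nondecreasing_set_cvg_integral => //.
  by move=> n; exact: measurable_funTS mg.
have mfE : measurable_fun [set: R] (EFin \o f) by apply/measurable_EFinP.
have cp := part _ (measurable_funepos mfE) (fun x => funepos_ge0 _ x).
have cn := part _ (measurable_funeneg mfE) (fun x => funeneg_ge0 _ x).
have fp : (\int[mu]_(x in `[0%R, +oo[) (EFin \o f)^\+%E x)%E \is a fin_num.
  by apply: integrable_fin_num => //; exact: integrable_funepos.
have fn : (\int[mu]_(x in `[0%R, +oo[) (EFin \o f)^\-%E x)%E \is a fin_num.
  by apply: integrable_fin_num => //; exact: integrable_funeneg.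
have h : ((\int[mu]_(x in `[0%R, n.+1%:R]) (f x)%:E) @[n --> \oo] -->
    \int[mu]_(x in `[0%R, +oo[) (f x)%:E)%E.
  rewrite [X in _ --> X]integralE.
  under eq_fun do rewrite integralE.
  apply: cvgeB => //.
  by apply: fin_num_adde_defl; rewrite fin_numN.
rewrite /Rintegral.
apply: fine_cvg; rewrite fineK//.
exact: integrable_fin_num.
Qed.

End ImproperIntegrals.

Section IntegrationByParts.
Variable R : realType.
Implicit Types (z x y t : R) (p q f g : {poly R}).
Notation mu := (@lebesgue_measure R).

Lemma juttner_integrand_le z p : 0 < z ->
  exists C, forall t, 0 <= t -> `|juttner_integrand z p t| <= C * expR (- t).
Proof.
move=> z0; exists (\sum_(i < size p) `|p`_i| * (2 * i.+1`!%:R / z ^+ i.+1)) => t t0.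
rewrite juttner_integrandE (le_trans (ler_norm_sum _ _ _))// mulr_suml ler_sum// => i _.
rewrite normrM -[leRHS]mulrA ler_wpM2l//.
by have /andP[h0 h] := cosh_integrand_le i z0 t0; rewrite ger0_norm.
Qed.

(** The functional annihilates the derivative of sinh t * G(cosh t) exp(-z cosh t),
    a function that vanishes at 0 and at infinity. *)
Lemma juttner_integration_by_parts z (G : {poly R}) : 0 < z ->
  juttner z (('X^2 - 1) * (G^`() - z *: G) + 'X * G) = 0.
Proof.
move=> z0; rewrite juttnerE//.
set f := juttner_integrand z _.
pose H t := sinhR t * juttner_integrand z G t.
have dH (t : R) : is_derive t (1:R) H (f t).
  have d1 : is_derive t (1:R) (fun t => G.[coshR t]) (G^`().[coshR t] * sinhR t).
    exact: (@is_derive1_comp _ (horner G) (@coshR R) _ _ _ (is_derive_poly _ _) (is_derive_coshR t)).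
  have d2 : is_derive t (1:R) (fun t => expR (- z * coshR t)) (expR (- z * coshR t) * (- z * sinhR t)).
    apply: (@is_derive1_comp _ (@expR R) (fun t => - z * coshR t)).
    have ? := is_derive_coshR t.
    by apply: is_derive_eq; rewrite /GRing.scale/=; ring.
  have d3 : is_derive t (1:R) (juttner_integrand z G) _ := is_deriveM d1 d2.
  apply: (is_derive_eq (is_deriveM (is_derive_sinhR t) d3)).
  rewrite /f /juttner_integrand /GRing.scale/=.
  rewrite !(hornerM, hornerD, hornerN, hornerXn, hornerC, hornerX, hornerZ).
  rewrite -expr2 coshR2; ring.
have cf : continuous f by exact: continuous_juttner_integrand.
have cH : continuous H by move=> t; exact: is_derive1_continuous (dH t).
have := cvg_Rintegral_itv cf (integrable_juttner_integrand _ z0).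
rewrite -/f.
have -> : (fun n => \int[mu]_(t in `[0, n.+1%:R]) f t) = (fun n => H n.+1%:R).
  apply/funext => n; rewrite /Rintegral (@continuous_FTC2 _ f H).
  - by rewrite /= /H sinhR0 mul0r subr0.
  - by rewrite ltr0n.
  - exact: continuous_subspaceT.
  - split; first by move=> x _; have [] := dH x.
      by apply: cvg_at_right_filter; exact: cH.
    by apply: cvg_at_left_filter; exact: cH.
  - by move=> x _; have ? := dH x; rewrite derive1E derive_val.
move=> lim1.
suff lim2 : H n.+1%:R @[n --> \oo] --> (0 : R).
  by rewrite -(cvg_lim _ lim1)// (cvg_lim _ lim2)// mulr0.
have [C hC] := juttner_integrand_le ('X * G) z0.
apply: (@squeeze_cvgr _ _ _ _ (fun n => - (C * expR (- n.+1%:R))) (fun n => C * expR (- n.+1%:R))).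
- apply: nearW => n; rewrite -ler_norml (le_trans _ (hC _ _))//.
  set t : R := n.+1%:R; have t0 : 0 <= t by rewrite ler0n.
  rewrite (_ : juttner_integrand z ('X * G) t = coshR t * juttner_integrand z G t); last first.
    by rewrite /juttner_integrand hornerM hornerX -[LHS]mulrA.
  rewrite [H t]/(sinhR t * juttner_integrand z G t) (normrM (sinhR t)) (normrM (coshR t)) ler_wpM2r//.
  by rewrite !ger0_norm ?sinhR_ge0 ?(ltW (coshR_gt0 _)) ?sinhR_le_coshR//.
- rewrite -[0]oppr0 -[X in - X](mulr0 C).
  apply: cvgN; apply: cvgM; first exact: cvg_cst.
  have := @cvgn_expR R; rewrite -cvg_shiftS; exact.
- rewrite -[0](mulr0 C).
  apply: cvgM; first exact: cvg_cst.
  have := @cvgn_expR R; rewrite -cvg_shiftS; exact.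
Qed.

End IntegrationByParts.

(** * The momentum integral *)

Section ReflectedIntegral.
Variable R : realType.
Notation mu := (@lebesgue_measure R).

Lemma ge0_integralT_reflect (f : R -> R) : continuous f -> (forall x, 0 <= f x) ->
  (\int[mu]_x (f x)%:E = \int[mu]_(x in `[0%R, +oo[) (f x)%:E +
     \int[mu]_(x in `[0%R, +oo[) (f (- x))%:E)%E.
Proof.
move=> cf f0.
have mf : measurable_fun [set: R] (EFin \o f).
  by apply/measurable_EFinP; exact: continuous_measurable_fun.
rewrite -(setUv `[0, +oo[%classic) ge0_integral_setU//=; last 4 first.
- exact: measurableC.
- by rewrite setUv.
- by move=> x _; rewrite lee_fin.
- exact/disj_setPCl.
congr (_ + _)%E.
rewrite setCitvr integral_itv_bndo_bndc; last exact: measurable_funTS mf.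
rewrite -[in LHS]oppr0 ge0_integration_by_substitutionNy//.
exact: continuous_subspaceT.
Qed.

Lemma RintegralT_reflect (f : R -> R) : continuous f ->
  mu.-integrable `[0, +oo[ (EFin \o f) ->
  mu.-integrable `[0, +oo[ (EFin \o (fun x => f (- x))) ->
  \int[mu]_x f x = \int[mu]_(x in `[0, +oo[) (f x + f (- x)).
Proof.
move=> cf intf intfN; rewrite RintegralD// /Rintegral integralE.
have part (g : R -> R) : continuous g ->
    (\int[mu]_x (EFin \o g)^\+ x = \int[mu]_(x in `[0%R, +oo[) (EFin \o g)^\+ x +
       \int[mu]_(x in `[0%R, +oo[) (EFin \o (fun x => g (- x)%R))^\+ x)%E.
  move=> cg; transitivity (\int[mu]_x (Num.max (g x) 0)%:E)%E.
    by apply: eq_integral => x _; rewrite funeposE -EFin_max.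
  rewrite (@ge0_integralT_reflect (fun x => Num.max (g x) 0)).
  - by congr (_ + _)%E; apply: eq_integral => x _; rewrite funeposE -EFin_max.
  - move=> x; apply: continuous_max; first exact: cg.
    exact: cst_continuous.
  - by move=> x; rewrite le_max lexx orbT.
have neg (g : R -> R) : ((EFin \o g)^\- = (EFin \o (fun x => (- g x)%R))^\+)%E.
  by apply/funext => x; rewrite funeposE funenegE.
rewrite part// neg part; last by move=> x; apply: continuousN; exact: cf.
rewrite -!neg.
have pf (g : R -> R) : mu.-integrable `[0, +oo[ (EFin \o g) ->
    (\int[mu]_(x in `[0%R, +oo[) (EFin \o g)^\+ x)%E \is a fin_num /\
    (\int[mu]_(x in `[0%R, +oo[) (EFin \o g)^\- x)%E \is a fin_num.
  move=> ig; split; apply: integrable_fin_num => //.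
    exact: integrable_funepos.
  exact: integrable_funeneg.
have [p1 n1] := pf _ intf; have [p2 n2] := pf _ intfN.
rewrite [X in _ = fine X + _]integralE [X in _ = _ + fine X]integralE.
have fineBDD (a b c d : \bar R) : a \is a fin_num -> b \is a fin_num ->
    c \is a fin_num -> d \is a fin_num ->
    fine (a + b - (c + d))%E = fine (a - c)%E + fine (b - d)%E.
  by case: a b c d => [a| |] [b| |] [c| |] [d| |]//= *; ring.
exact: fineBDD.
Qed.

End ReflectedIntegral.

Section MomentumIntegral.
Variable R : realType.
Implicit Types (z x y t u theta p b : R) (A B Q : {poly R}).
Notation mu := (@lebesgue_measure R).

Lemma sqr_lt1 u : `|u| < 1 -> 0 < 1 - u ^+ 2.
Proof.
by move=> u1; rewrite subr_gt0 -real_normK ?num_real// expr_lt1.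
Qed.

Lemma U0_gt0 u : `|u| < 1 -> 0 < U0 u.
Proof. by move=> /sqr_lt1 u1; rewrite invr_gt0 sqrtr_gt0. Qed.

Lemma U0_sqr u : `|u| < 1 -> U0 u ^+ 2 = (1 - u ^+ 2)^-1.
Proof. by move=> /sqr_lt1 u1; rewrite /U0 exprVn sqr_sqrtr// ltW. Qed.

Definition rapidity u : R := arsinh (U1 u).

Lemma sinhR_rapidity u : sinhR (rapidity u) = U1 u.
Proof. exact: arsinhK. Qed.

Lemma coshR_rapidity u : `|u| < 1 -> coshR (rapidity u) = U0 u.
Proof.
move=> u1; rewrite coshR_arsinh /U1 exprMn (_ : 1 + _ = U0 u ^+ 2).
  by rewrite sqrtr_sqr ger0_norm// ltW// U0_gt0.
rewrite U0_sqr//; have := sqr_lt1 u1 => h.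
by rewrite -[X in X + _](mulfV (lt0r_neq0 h)) -mulrDl addrNK mul1r.
Qed.

(** In the variable b = arsinh p - arsinh U^1 the energy and the space
    component of the momentum in the comoving frame are cosh b and - sinh b. *)
Lemma energy_rapidity u b : `|u| < 1 ->
  energy u (sinhR (rapidity u + b)) = coshR b.
Proof.
move=> u1; rewrite /energy /mom0 sqrt_1sinhR2 -(coshR_rapidity u1) -sinhR_rapidity.
rewrite coshRD sinhRD; set ca := coshR (rapidity u); set sa := sinhR (rapidity u).
have : ca ^+ 2 = 1 + sa ^+ 2 by exact: coshR2.
move=> h; ring: h.
Qed.

Lemma pspace_rapidity u b : `|u| < 1 ->
  pspace u (sinhR (rapidity u + b)) / U0 u = - sinhR b.
Proof.
move=> u1; rewrite /pspace energy_rapidity// sinhRD coshR_rapidity// sinhR_rapidity.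
by field; rewrite gt_eqF// U0_gt0.
Qed.

Lemma mom0_gt0 p : 0 < mom0 p.
Proof. by rewrite /mom0 sqrtr_gt0 ltr_pwDl// sqr_ge0. Qed.

Lemma continuous_mom0 : continuous (@mom0 R).
Proof.
move=> p; apply: (@continuous_comp _ _ _ (fun p => 1 + p ^+ 2) (@Num.sqrt R)).
  have : is_derive p (1:R) (fun p : R => 1 + p ^+ 2) (2 * p).
    by apply: is_derive_eq; rewrite /GRing.scale/=; ring.
  exact: is_derive1_continuous.
exact: sqrt_continuous.
Qed.

Lemma continuous_energy u : continuous (energy u).
Proof.
move=> p; apply: (@continuousB _ _ _ (fun p => U0 u * mom0 p) (fun p => U1 u * p)).
  by apply: (@continuousM _ _ (fun=> U0 u) (@mom0 R)); [exact: cst_continuous|exact: continuous_mom0].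
by apply: (@continuousM _ _ (fun=> U1 u) id); [exact: cst_continuous|exact: cvg_id].
Qed.

Lemma continuous_pspace u : continuous (pspace u).
Proof.
move=> p; apply: (@continuousD _ _ _ (fun p => - p) (fun p => U1 u * energy u p)).
  exact: opp_continuous.
by apply: (@continuousM _ _ (fun=> U1 u) (energy u)); [exact: cst_continuous|exact: continuous_energy].
Qed.

Lemma sinhR_shift_lt a : {homo (fun b => sinhR (a + b)) : x y / x < y}.
Proof. by move=> x y xy; rewrite sinhR_lt// ltrD2l. Qed.

Lemma bigcup_sinhR_itv a : [set: R] =
  \bigcup_n `[sinhR (a + - n.+1%:R), sinhR (a + n.+1%:R)]%classic.
Proof.
apply/seteqP; split => // y _.
have : [set: R] (arsinh y - a) by [].
rewrite bigcup_itvT => -[n _ /=]; rewrite in_itv/= => /andP[h1 h2].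
exists n => //=; rewrite in_itv/= -(arsinhK y).
by apply/andP; split; apply: sinhR_le; lra.
Qed.

Lemma integrable_sinhR_juttner_integrand z Q : 0 < z ->
  mu.-integrable `[0, +oo[ (EFin \o (fun t => sinhR t * juttner_integrand z Q t)).
Proof.
move=> z0.
apply: (@le_integrable _ _ _ mu _ _ _ (EFin \o juttner_integrand z ('X * Q))) => //.
- apply/measurable_EFinP; apply: measurable_funTS.
  apply: continuous_measurable_fun => t.
  apply: (@continuousM _ _ (@sinhR R) (juttner_integrand z Q)).
    exact: continuous_sinhR.
  exact: continuous_juttner_integrand.
- move=> t /=; rewrite in_itv/= andbT => t0; rewrite lee_fin.
  rewrite (_ : juttner_integrand z ('X * Q) t = coshR t * juttner_integrand z Q t); last first.
    by rewrite /juttner_integrand hornerM hornerX -[LHS]mulrA.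
  rewrite (normrM (sinhR t)) (normrM (coshR t)) ler_wpM2r//.
  by rewrite !ger0_norm ?sinhR_ge0 ?(ltW (coshR_gt0 _)) ?sinhR_le_coshR.
exact: integrable_juttner_integrand.
Qed.

Lemma juttner_integrandN z Q t : juttner_integrand z Q (- t) = juttner_integrand z Q t.
Proof. by rewrite /juttner_integrand coshRN. Qed.

Lemma RintegralT_even_odd z P Q : 0 < z ->
  \int[mu]_b (juttner_integrand z P b - sinhR b * juttner_integrand z Q b) =
  2 * \int[mu]_(b in `[0, +oo[) juttner_integrand z P b.
Proof.
move=> z0; rewrite RintegralT_reflect.
- rewrite -RintegralZl//; last exact: integrable_juttner_integrand.
  by apply: eq_Rintegral => b _; rewrite !juttner_integrandN sinhRN; ring.
- move=> b; apply: (@continuousB _ _ _ (juttner_integrand z P) (fun b => sinhR b * juttner_integrand z Q b)).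
    exact: continuous_juttner_integrand.
  apply: (@continuousM _ _ (@sinhR R) (juttner_integrand z Q)).
    exact: continuous_sinhR.
  exact: continuous_juttner_integrand.
- apply: (@integrableB _ _ _ mu _ _ (EFin \o juttner_integrand z P)
    (EFin \o (fun b => sinhR b * juttner_integrand z Q b))) => //.
    exact: integrable_juttner_integrand.
  exact: integrable_sinhR_juttner_integrand.
- rewrite (_ : (fun b => _) = (fun b => juttner_integrand z P b + sinhR b * juttner_integrand z Q b)).
    apply: (@integrableD _ _ _ mu _ _ (EFin \o juttner_integrand z P)
      (EFin \o (fun b => sinhR b * juttner_integrand z Q b))) => //.
      exact: integrable_juttner_integrand.
    exact: integrable_sinhR_juttner_integrand.
  by apply/funext => b; rewrite !juttner_integrandN sinhRN; ring.
Qed.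

Lemma gweight_gt0 u theta p : 0 < theta -> 0 < gweight u theta p.
Proof.
move=> th0; rewrite /gweight mulr_gt0 ?expR_gt0// invr_gt0 mulr_gt0// besselK1E.
by rewrite cosh_moment_gt0// invr_gt0.
Qed.

(** In the rapidity variable the energy is even and the space component s is odd, so the
    products of one factor s integrate to 0, while s^2 = E^2 - 1. *)
Lemma ipg_juttner u theta A B Q (l : nat) : `|u| < 1 -> 0 < theta -> (l < 2)%N ->
  ipg u theta
    (fun p => gweight u theta p * (A.[energy u p] + B.[energy u p] * (pspace u p / U0 u)))
    (fun p => gweight u theta p * Q.[energy u p] *
       (if l == 0%N then 1 else pspace u p / U0 u)) =
  juttner theta^-1 (('X^2 - 1) ^+ l * ((if l == 0%N then A else B) * Q)).
Proof.
move=> u1 th0 l2; rewrite /ipg.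
set z := theta^-1; have z0 : 0 < z by rewrite invr_gt0.
pose s p := pspace u p / U0 u.
pose G p := (A.[energy u p] + B.[energy u p] * s p) * (Q.[energy u p] *
  (if l == 0%N then 1 else s p)) * gweight u theta p / mom0 p.
rewrite (_ : Rintegral _ _ _ = \int[mu]_p G p); last first.
  apply: eq_Rintegral => p _; rewrite /G /s.
  have := mom0_gt0 p; have := gweight_gt0 u p th0 => g0 m0.
  by field; rewrite !gt_eqF// U0_gt0.
have cs : continuous s.
  move=> p; apply: (@continuousM _ _ (pspace u) (fun=> (U0 u)^-1)).
    exact: continuous_pspace.
  exact: cst_continuous.
have cE (P : {poly R}) : continuous (fun p => P.[energy u p]).
  move=> p; apply: (@continuous_comp _ _ _ (energy u) (horner P)); first exact: continuous_energy.
  exact: continuous_horner.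
have cg : continuous (gweight u theta).
  move=> p; apply: (@continuousM _ _ (fun=> (2 * besselK 1 theta^-1)^-1) (fun p => expR (- theta^-1 * energy u p))).
    exact: cst_continuous.
  apply: (@continuous_comp _ _ _ (fun p => - theta^-1 * energy u p) (@expR R)).
    by apply: (@continuousM _ _ (fun=> - theta^-1) (energy u)); [exact: cst_continuous|exact: continuous_energy].
  exact: continuous_expR.
have cG : continuous G.
  move=> p.
  apply: (@continuousM _ _ (fun p => (A.[energy u p] + B.[energy u p] * s p) * (Q.[energy u p] *
    (if l == 0%N then 1 else s p)) * gweight u theta p) (fun p => (mom0 p)^-1)); last first.
    apply: continuousV; first by rewrite gt_eqF// mom0_gt0.
    exact: continuous_mom0.
  apply: (@continuousM _ _ (fun p => (A.[energy u p] + B.[energy u p] * s p) * (Q.[energy u p] *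
    (if l == 0%N then 1 else s p))) (gweight u theta)); last exact: cg.
  apply: (@continuousM _ _ (fun p => (A.[energy u p] + B.[energy u p] * s p)) (fun p => (Q.[energy u p] *
    (if l == 0%N then 1 else s p)))).
    apply: (@continuousD _ _ _ (fun p => A.[energy u p]) (fun p => B.[energy u p] * s p)); first exact: cE.
    by apply: (@continuousM _ _ (fun p => B.[energy u p]) s); [exact: cE|exact: cs].
  apply: (@continuousM _ _ (fun p => Q.[energy u p]) (fun p => if l == 0%N then 1 else s p)).
    exact: cE.
  by case: (l == 0%N); [exact: cst_continuous|exact: cs].
pose a := rapidity u.
have dF (b : R) : is_derive b (1:R) (fun b => sinhR (a + b)) (coshR (a + b)).
  have d1 : is_derive b (1:R) (fun b : R => a + b) 1.
    exact: (is_derive_eq (is_deriveD (is_derive_cst a b 1) (is_derive_id b 1)) (add0r _)).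
  apply: (is_derive_eq (@is_derive1_comp _ (@sinhR R) (fun b => a + b) _ _ _ (is_derive_sinhR _) d1)).
  by rewrite mulr1.
rewrite (@integral_subst_increasing R (fun b => sinhR (a + b)) (fun b => coshR (a + b)) G
   _ _ setT setT _ _ _ (bigcup_itvT R) (bigcup_sinhR_itv a) _ dF); first last.
- by move=> p _; exact: cG.
- by move=> b _; rewrite ltW// coshR_gt0.
- move=> b; apply: (@continuous_comp _ _ _ (fun b => a + b) (@coshR R)); last exact: continuous_coshR.
  by apply: (@continuousD _ _ _ (fun=> a) id); [exact: cst_continuous|exact: cvg_id].
- by move=> x y _ _; exact: sinhR_shift_lt.
- by move=> m n mn; rewrite ler_nat.
- by move=> m n mn; rewrite lerN2 ler_nat.
- by move=> n; rewrite gtrN// ltr0n.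
pose P1 := ('X^2 - 1) ^+ l * ((if l == 0%N then A else B) * Q).
pose P2 := (if l == 0%N then B else A) * Q.
pose c := (2 * cosh_moment 1 z)^-1.
transitivity (\int[mu]_b
   (juttner_integrand z (c *: P1) b - sinhR b * juttner_integrand z (c *: P2) b)).
  apply: eq_Rintegral => b _; rewrite /G /s energy_rapidity// pspace_rapidity//.
  rewrite /mom0 sqrt_1sinhR2 (mulfVK (lt0r_neq0 (coshR_gt0 _))).
  rewrite /gweight energy_rapidity// besselK1E -/z /juttner_integrand -/c /P1 /P2.
  case: l l2 {P1 P2 G cG} => [|[|//]] _ /=.
    by rewrite !(hornerZ, hornerM, expr0, hornerC); ring.
  rewrite expr1 !(hornerZ, hornerM, hornerD, hornerN, hornerX, hornerC) -(expr2 (coshR b)) coshR2; ring.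
rewrite RintegralT_even_odd//.
have K0 := cosh_moment_gt0 1 z0.
rewrite -[\int[mu]_(b in _) _](mulVKf (lt0r_neq0 K0)) -juttnerE// linearZ/=.
by rewrite /c; field; rewrite gt_eqF.
Qed.

End MomentumIntegral.

(** * Orthonormal polynomials of a positive functional *)

Section WeightedFunctional.
Variables (R : comNzRingType) (w : {poly R}) (L : {scalar {poly R}}).

Definition weighted (p : {poly R}) : R := L (w * p).

Lemma weighted_is_scalar : scalar weighted.
Proof. by move=> a p q; rewrite /weighted mulrDr -scalerAr linearP. Qed.

HB.instance Definition _ := GRing.isLinear.Build R {poly R} R _
  weighted weighted_is_scalar.

End WeightedFunctional.

Section OrthonormalPolynomials.
Variable R : rcfType.
Implicit Types (L : {scalar {poly R}}) (P : nat -> {poly R}) (p q : {poly R}).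

Definition positive_functional (L : {poly R} -> R) : Prop :=
  forall p, p != 0 -> (forall x, 1 <= x -> 0 <= p.[x]) -> 0 < L p.

Definition orthonormal_for (L : {poly R} -> R) P : Prop :=
  [/\ forall n, size (P n) = n.+1,
      forall n, 0 < lead_coef (P n)
    & forall m n, L (P m * P n) = (m == n)%:R].

Lemma orthonormal_coef_gt0 L P n : orthonormal_for L P -> 0 < (P n)`_n.
Proof. by case=> sP cP _; have := cP n; rewrite /lead_coef sP. Qed.

Lemma size_sub_leading (c : R) n p q : (size p <= n.+1)%N -> (size q <= n.+1)%N ->
  p`_n = c * q`_n -> (size (p - c *: q)%R <= n)%N.
Proof.
move=> sp sq pq; apply/leq_sizeP => j; rewrite leq_eqVlt => /predU1P[<-|nj].
  by rewrite coefB coefZ pq subrr.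
by rewrite coefB coefZ !nth_default ?mulr0 ?subrr// (leq_trans _ nj).
Qed.

Lemma orthonormal_expansion L P n q : orthonormal_for L P -> (size q <= n)%N ->
  q = \sum_(k < n) L (q * P k) *: P k.
Proof.
move=> oP; have [sP _ LP] := oP; elim: n q => [|n IH] q.
  by rewrite leqn0 size_poly_eq0 big_ord0 => /eqP.
move=> sq; pose c := q`_n / (P n)`_n.
have sq' : (size (q - c *: P n)%R <= n)%N.
  apply: size_sub_leading; rewrite ?sP// /c divfK// gt_eqF//.
  exact: orthonormal_coef_gt0 oP.
have q'E := IH _ sq'.
have Lq' : L ((q - c *: P n) * P n) = 0.
  rewrite q'E mulr_suml linear_sum big1// => k _.
  by rewrite -scalerAl linearZ/= LP ltn_eqF ?mulr0.
have Lqn : L (q * P n) = c.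
  move: Lq'; rewrite mulrBl linearB -scalerAl linearZ/= LP eqxx mulr1.
  by move/eqP; rewrite subr_eq0 => /eqP.
rewrite big_ord_recr/= Lqn -[LHS](subrK (c *: P n)); congr (_ + _).
rewrite {1}q'E; apply: eq_bigr => k _; congr (_ *: _).
by rewrite mulrBl linearB -scalerAl linearZ/= LP gtn_eqF ?mulr0 ?subr0.
Qed.

(** P n is orthogonal to the lower degrees, so only the leading term of q counts. *)
Lemma orthonormal_top L P n q : orthonormal_for L P -> (size q <= n.+1)%N ->
  L (q * P n) = q`_n / lead_coef (P n).
Proof.
move=> oP sq; have [sP cP LP] := oP.
have /(congr1 (fun p : {poly R} => p`_n)) := orthonormal_expansion oP sq.
rewrite coef_sum big_ord_recr/= big1 ?add0r => [|k _]; last first.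
  by rewrite coefZ [_`_n]nth_default ?mulr0// sP.
by rewrite coefZ => ->; rewrite /lead_coef sP mulfK// gt_eqF// (orthonormal_coef_gt0 _ oP).
Qed.

Lemma orthonormal_low L P n q : orthonormal_for L P -> (size q <= n)%N ->
  L (q * P n) = 0.
Proof.
move=> oP sq; rewrite (orthonormal_top oP) ?(leq_trans sq)//.
by rewrite nth_default// mul0r.
Qed.

(** Gram-Schmidt, carrying the list of the polynomials built so far. *)
Definition gram_schmidt_step L (s : seq {poly R}) : {poly R} :=
  let n := size s in
  let r := 'X^n - \sum_(k < n) L ('X^n * s`_k) *: s`_k in
  (Num.sqrt (L (r * r)))^-1 *: r.

Fixpoint gram_schmidt_seq L n : seq {poly R} :=
  if n is n'.+1 then
    rcons (gram_schmidt_seq L n') (gram_schmidt_step L (gram_schmidt_seq L n'))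
  else [::].

Lemma size_gram_schmidt_seq L n : size (gram_schmidt_seq L n) = n.
Proof. by elim: n => //= n IH; rewrite size_rcons IH. Qed.

Definition gram_schmidt L n : {poly R} := (gram_schmidt_seq L n.+1)`_n.

Lemma nth_gram_schmidt_seq L n k : (k < n)%N ->
  (gram_schmidt_seq L n)`_k = gram_schmidt L k.
Proof.
elim: n k => // n IH k; rewrite ltnS leq_eqVlt => /predU1P[->//|kn].
by rewrite /= nth_rcons size_gram_schmidt_seq kn IH.
Qed.

Lemma gram_schmidtE L n :
  let r := 'X^n - \sum_(k < n) L ('X^n * gram_schmidt L k) *: gram_schmidt L k in
  gram_schmidt L n = (Num.sqrt (L (r * r)))^-1 *: r.
Proof.
have -> : gram_schmidt L n = gram_schmidt_step L (gram_schmidt_seq L n).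
  by rewrite /gram_schmidt /= nth_rcons size_gram_schmidt_seq ltnn eqxx.
rewrite /gram_schmidt_step size_gram_schmidt_seq.
rewrite (eq_bigr (fun k : 'I_n => L ('X^n * gram_schmidt L k) *: gram_schmidt L k)) => [//|k _].
by rewrite nth_gram_schmidt_seq.
Qed.

Lemma positive_functional_sqr L p : positive_functional L -> p != 0 -> 0 < L (p * p).
Proof.
move=> Lpos p0; apply: Lpos; first by rewrite mulf_neq0.
by move=> x _; rewrite hornerM -expr2 sqr_ge0.
Qed.

Lemma gram_schmidt_orthonormal L : positive_functional L ->
  orthonormal_for L (gram_schmidt L).
Proof.
move=> Lpos; set P := gram_schmidt L.
suff main n : [/\ size (P n) = n.+1, 0 < lead_coef (P n) &
    forall k, (k <= n)%N -> L (P k * P n) = (k == n)%:R].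
  split=> [n|n|m n]; [by have [] := main n|by have [] := main n|].
  have [mn|nm] := leqP m n; first by have [_ _ ->] := main n.
  by rewrite mulrC; have [_ _ ->] := main m; rewrite 1?eq_sym// ltnW.
elim/ltn_ind: n => n IH.
have := gram_schmidtE L n; rewrite -/P /=; set r := 'X^n - _ => PnE.
have sS : (size (\sum_(k < n) L ('X^n * P k) *: P k)%R <= n)%N.
  apply: (leq_trans (size_sum _ _ _)); apply/bigmax_leqP => k _; rewrite (leq_trans (size_scale_leq _ _))//.
  by have [-> _ _] := IH k (ltn_ord k).
have sr : size r = n.+1 by rewrite size_polyDl ?size_polyXn// size_polyN ltnS.
have lr : lead_coef r = 1.
  by rewrite lead_coefDl ?lead_coefXn// size_polyXn size_polyN ltnS.
have r0 : r != 0 by rewrite -lead_coef_eq0 lr oner_eq0.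
have Lrr := positive_functional_sqr Lpos r0.
have rE : r = 'X^n - \sum_(k < n) L ('X^n * P k) *: P k by [].
have s0 : 0 < (Num.sqrt (L (r * r)))^-1 by rewrite invr_gt0 sqrtr_gt0.
split.
- by rewrite PnE size_scale ?gt_eqF.
- by rewrite PnE lead_coefZ lr mulr1.
- move=> k; rewrite leq_eqVlt => /predU1P[->|kn].
    rewrite eqxx PnE -scalerAl -scalerAr !linearZ/=.
    rewrite mulrA -invfM -expr2 sqr_sqrtr ?mulVf ?gt_eqF//; exact: ltW.
  rewrite ltn_eqF// PnE -scalerAr linearZ/= [X in _ * X](_ : _ = 0) ?mulr0//.
  rewrite rE mulrBr linearB mulr_sumr linear_sum.
  rewrite (bigD1 (Ordinal kn))//= big1 => [|j jk].
    rewrite addr0 -scalerAr linearZ/= (_ : L (P k * P k) = 1).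
      by rewrite mulr1 mulrC subrr.
    by have [_ _ ->] := IH k kn; rewrite ?eqxx.
  rewrite -scalerAr linearZ/= (_ : L (P k * P j) = 0) ?mulr0//.
  have kj : (k == j :> nat) = false by apply/negbTE; rewrite eq_sym; exact: jk.
  have [lekj|ltjk] := leqP k j.
    by have [_ _ ->] := IH j (ltn_ord j); rewrite ?kj.
  by rewrite mulrC; have [_ _ ->] := IH k kn; rewrite 1?eq_sym ?kj// ltnW.
Qed.

End OrthonormalPolynomials.

(** * Zeros of orthonormal polynomials *)

Section Zeros.
Variable R : rcfType.
Implicit Types (L : {scalar {poly R}}) (P : nat -> {poly R}) (p q : {poly R}).
Local Notation prod_XsubC s := (\prod_(z <- s) ('X - z%:P)).

Lemma uniq_rootsR p : uniq (rootsR p).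
Proof. exact: uniq_roots. Qed.

Lemma mem_rootsR p x : p != 0 -> (x \in rootsR p) = root p x.
Proof. by move=> p0; rewrite -(roots_on_rootsR p0) in_itv. Qed.

(** The zeros that are added to s are the points where p changes sign: when p
    has a zero a > 1, either a already occurs in the list found for p / (X - a),
    and the two factors cancel, or adding it produces a square. *)
Lemma constant_sign_factor p : p != 0 ->
  exists s : seq R, [/\ uniq s, all (> 1) s, all (root p) s &
    exists2 e : R, e != 0 & forall x, 1 <= x -> 0 <= e * (p * prod_XsubC s).[x]].
Proof.
have [n] := ubnP (size p); elim: n p => // n IH p; rewrite ltnS => sp p0.
have [/hasP[a arp a1]|/hasPn noroot] := boolP (has (> 1) (rootsR p)).
  have rpa : root p a by rewrite -mem_rootsR.
  have /factor_theorem[q pE] := rpa.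
  have q0 : q != 0 by apply: contra_neq p0 => q0; rewrite pE q0 mul0r.
  have sq : (size q < n)%N.
    by move: sp; rewrite pE size_Mmonic ?monicXsubC// size_XsubC addn2.
  have [s [us s1 rs [e e0 he]]] := IH q sq q0.
  have rps : all (root p) s.
    by apply/allP => z /(allP rs) rz; rewrite pE rootM rz.
  have [sa|nsa] := boolP (a \in s).
    exists (rem a s); split.
    - exact: rem_uniq.
    - by apply/allP => z /mem_rem /(allP s1).
    - by apply/allP => z /mem_rem /(allP rps).
    - exists e => // x x1; move: (he x x1).
      by rewrite (perm_big _ (perm_to_rem sa)) big_cons pE mulrA.
  exists (a :: s); split => /=.
  - by rewrite nsa.
  - by rewrite a1.
  - by rewrite rpa.
  - exists e => // x x1; have h := he x x1.
    rewrite big_cons pE (_ : _ * _ = ('X - a%:P) ^+ 2 * (q * prod_XsubC s)); last by ring.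
    by rewrite hornerM mulrCA mulr_ge0// horner_exp sqr_ge0.
exists [::]; split => //; exists p.[2] => [|x x1].
  apply/negP => p2; have : 2 \in rootsR p by rewrite mem_rootsR// rootE p2.
  by move/noroot; rewrite ltr1n.
rewrite big_nil mulr1 leNgt; apply/negP => neg.
have [y yI ry] : exists2 y, 1 < y & root p y.
  have [x2|x2] := leP x 2.
    have neg' : p.[x] * p.[2] < 0 by rewrite mulrC.
    have [y] := poly_ivtoo x2 neg'.
    by rewrite in_itv/= => /andP[xy _] ry; exists y => //; exact: le_lt_trans xy.
  have [y] := poly_ivtoo (ltW x2) neg.
  by rewrite in_itv/= => /andP[xy _] ry; exists y => //; apply: lt_trans xy; rewrite ltr1n.
by have := noroot y; rewrite mem_rootsR// ry yI => /(_ isT).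
Qed.

(** The polynomial of degree n is orthogonal to all lower degrees, hence changes
    sign at n points at least. *)
Lemma orthonormal_zeros L P n : positive_functional L -> orthonormal_for L P ->
  [/\ size (rootsR (P n)) = n, all (> 1) (rootsR (P n)) &
      P n = lead_coef (P n) *: prod_XsubC (rootsR (P n))].
Proof.
move=> Lpos oP; have [sP cP LP] := oP.
have Pn0 : P n != 0 by rewrite -size_poly_gt0 sP.
have [s [us s1 rs [e e0 he]]] := constant_sign_factor Pn0.
have sn : (size s <= n)%N by have := max_poly_roots Pn0 rs us; rewrite sP.
have ns : size s = n.
  apply/eqP; rewrite eqn_leq sn leqNgt; apply/negP => lt_sn.
  have : L (prod_XsubC s * P n) = 0.
    by apply: orthonormal_low oP _; rewrite size_prod_XsubC.
  apply/eqP; rewrite mulrC.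
  have nz : e *: (P n * prod_XsubC s) != 0.
    rewrite scale_poly_eq0 negb_or e0 mulf_neq0// -size_poly_gt0.
    by rewrite size_prod_XsubC.
  have := Lpos _ nz; rewrite linearZ/= => h.
  have : 0 < e * L (P n * prod_XsubC s) by apply: h => x x1; rewrite hornerZ he.
  by apply: contraTneq => ->; rewrite mulr0 ltxx.
have eqs : s =i rootsR (P n).
  have sub : {subset s <= rootsR (P n)}.
    by move=> x /(allP rs); rewrite mem_rootsR.
  have roots_r : all (root (P n)) (rootsR (P n)).
    by apply/allP => x; rewrite mem_rootsR.
  have sz : (size (rootsR (P n)) <= size s)%N.
    by have := max_poly_roots Pn0 roots_r (uniq_rootsR _); rewrite sP ltnS ns.
  by have [_ h] := uniq_min_size us sub sz.
have pss := uniq_perm us (uniq_rootsR (P n)) eqs.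
split.
- by rewrite -(perm_size pss).
- by rewrite -(eq_all_r eqs).
- rewrite -(perm_big _ pss)/=; apply: all_roots_prod_XsubC => //.
    by rewrite sP ns.
  by rewrite uniq_rootsE.
Qed.

Lemma orthonormal_no_small_root L P n x : positive_functional L -> orthonormal_for L P ->
  x <= 1 -> ~~ root (P n) x.
Proof.
move=> Lpos oP x1; have [_ h _] := orthonormal_zeros n Lpos oP.
have [sP _ _] := oP.
rewrite -mem_rootsR -?size_poly_gt0 ?sP//.
by apply/negP => /(allP h) /=; rewrite ltNge x1.
Qed.

(** Factor by factor: |x - a| < |- x - a| for x > 0 and every zero a > 1. *)
Lemma orthonormal_reflection L P n x : positive_functional L -> orthonormal_for L P ->
  0 < x -> (0 < n)%N -> `|(P n).[x]| < `|(P n).[- x]|.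
Proof.
move=> Lpos oP x0 n0; have [sr r1 PE] := orthonormal_zeros n Lpos oP.
have [_ cP _] := oP.
rewrite PE !hornerZ !normrM ltr_pM2l ?normr_gt0 ?gt_eqF//.
rewrite !horner_prod !normr_prod.
have : rootsR (P n) != [::] by rewrite -size_eq0 sr -lt0n.
have lt1 z : 1 < z -> `|x - z| < `|- x - z|.
  move=> z1; rewrite -opprD normrN [ltRHS]ger0_norm; last by lra.
  by rewrite ltr_norml; apply/andP; split; lra.
elim: (rootsR (P n)) r1 => // z s IH /= /andP[z1 s1] _.
rewrite !big_cons !hornerXsubC.
case: s IH s1 => [|y s] IH s1; first by rewrite !big_nil !mulr1 lt1.
by rewrite ltr_pM ?lt1// ?IH// prodr_ge0.
Qed.

End Zeros.

(** * Interlacing of the two families *)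

Section Interlacing.
Variable R : rcfType.
Variables (L : {scalar {poly R}}) (P0 P1 : nat -> {poly R}) (M : nat).
Hypothesis Lpos : positive_functional L.
Hypothesis oP0 : orthonormal_for L P0.
Hypothesis oP1 : orthonormal_for (weighted ('X^2 - 1) L) P1.
Local Notation prod_XsubC s := (\prod_(z <- s) ('X - z%:P)).

Let L1 := weighted ('X^2 - 1) L.

Let xs := rootsR (P0 M.+1).

Lemma horner_prod_XsubC_neq0 (s : seq R) x : x \notin s -> (prod_XsubC s).[x] != 0.
Proof.
move=> xs'; rewrite horner_prod prodf_seq_neq0; apply/allP => z zs /=.
by rewrite hornerXsubC subr_eq0; apply: contraNneq xs' => ->.
Qed.

(** Gauss quadrature at the zeros of P0, written without its weights: a polynomial
    of degree at most 2M+1 that vanishes at all zeros is a multiple of P0 by a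
    factor of degree at most M. *)
Lemma vanish_on_zeros (g : {poly R}) : (size g <= (M.+1).*2)%N ->
  (forall x, x \in xs -> g.[x] = 0) -> L g = 0.
Proof.
move=> sg gx; have [sx _ PE] := orthonormal_zeros M.+1 Lpos oP0.
have [sP cP _] := oP0.
have /uniq_roots_prod_XsubC[|q gE] : all (root g) xs.
- by apply/allP => x /gx; rewrite rootE => ->.
- by rewrite uniq_rootsE uniq_rootsR.
have [q0|q0] := eqVneq q 0; first by rewrite gE q0 mul0r linear0.
have sq : (size q <= M.+1)%N.
  move: sg; rewrite gE size_Mmonic// ?monic_prod_XsubC//.
  by rewrite size_prod_XsubC sx addnS/= -addnn leq_add2r.
have c0 : lead_coef (P0 M.+1) != 0 by rewrite gt_eqF.
have : L (q * P0 M.+1) = 0 by exact: orthonormal_low oP0 sq.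
rewrite PE -scalerAr -gE linearZ/= => /eqP.
by rewrite mulf_eq0 (negPf c0) => /eqP.
Qed.

(** Testing orthogonality against the product over the remaining zeros leaves a
    two-point quadrature with positive weights. *)
Lemma two_point_relation a b : a \in xs -> b \in xs -> a != b ->
  exists T : {poly R}, exists alpha beta : R,
  [/\ (forall x, root T x = (x \in rem b (rem a xs))), 0 < alpha, 0 < beta &
      alpha * ((P1 M).[a] * T.[a]) + beta * ((P1 M).[b] * T.[b]) = 0].
Proof.
move=> ax bx ab; have [sx x1 PE] := orthonormal_zeros M.+1 Lpos oP0.
have ux : uniq xs by exact: uniq_rootsR.
have bra : b \in rem a xs by rewrite mem_rem_uniq// inE eq_sym ab.
pose s := rem b (rem a xs); pose T := prod_XsubC s.
have ura : uniq (rem a xs) by exact: rem_uniq.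
have mems x : (x \in s) = [&& x != b, x != a & x \in xs].
  by rewrite /s mem_rem_uniq// inE mem_rem_uniq// inE.
have ss : (size s).+2 = M.+1.
  have sra : size (rem a xs) = M by rewrite size_rem// sx.
  by rewrite -sx size_rem// sra prednK//; move: bra; rewrite -index_mem sra; apply: leq_ltn_trans.
have sT : size T = M by rewrite size_prod_XsubC; case: ss.
have Ta : T.[a] != 0 by apply: horner_prod_XsubC_neq0; rewrite mems eqxx andbF.
have Tb : T.[b] != 0 by apply: horner_prod_XsubC_neq0; rewrite mems eqxx.
have Tx x : x \in xs -> x != a -> x != b -> T.[x] = 0.
  move=> xx xa xb; apply/eqP; rewrite -/(root _ _) root_prod_XsubC mems.
  by rewrite xa xb.
pose La := T * ('X - b%:P); pose Lb := T * ('X - a%:P).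
pose h := ('X^2 - 1) * (T * P1 M).
have Lh : L h = 0 by apply: (@orthonormal_low _ L1 _ _ _ oP1); rewrite sT.
have LaN0 : La.[a] != 0 by rewrite hornerM hornerXsubC mulf_neq0// subr_eq0.
have LbN0 : Lb.[b] != 0 by rewrite hornerM hornerXsubC mulf_neq0// subr_eq0 eq_sym.
have LaB : La.[b] = 0 by rewrite hornerM hornerXsubC subrr mulr0.
have LbA : Lb.[a] = 0 by rewrite hornerM hornerXsubC subrr mulr0.
have M0 : (0 < M)%N by case: ss => <-.
have sLa : size La = M.+1.
  by rewrite size_Mmonic ?monicXsubC -?size_poly_gt0 ?sT// size_XsubC addn2.
have sLb : size Lb = M.+1.
  by rewrite size_Mmonic ?monicXsubC -?size_poly_gt0 ?sT// size_XsubC addn2.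
have La0 : 0 < L (La * La).
  by apply: positive_functional_sqr => //; rewrite -size_poly_gt0 sLa.
have Lb0 : 0 < L (Lb * Lb).
  by apply: positive_functional_sqr => //; rewrite -size_poly_gt0 sLb.
pose ca := h.[a] / La.[a] ^+ 2; pose cb := h.[b] / Lb.[b] ^+ 2.
have : L (h - (ca *: (La * La) + cb *: (Lb * Lb))) = 0.
  apply: vanish_on_zeros => [|x xx].
    have sq2 (p : {poly R}) : size p = M.+1 -> (size (p * p)%R <= M.+1.*2)%N.
      by move=> sp; rewrite (leq_trans (size_polyMleq _ _))// sp -addnn addSn/= leqW.
    have [sP1 _ _] := oP1.
    rewrite (leq_trans (size_polyD _ _))// geq_max size_polyN; apply/andP; split.
      have sTP : (size (T * P1 M)%R <= M + M)%N.
        by rewrite (leq_trans (size_polyMleq _ _))// sT sP1 addnS.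
      rewrite (leq_trans (size_polyMleq _ _))// size_XnsubC// addSn /= -addnn.
      by rewrite addSn addnS !ltnS.
    rewrite (leq_trans (size_polyD _ _))// geq_max.
    by rewrite !(leq_trans (size_scale_leq _ _))// sq2.
  rewrite hornerD hornerN hornerD !hornerZ (hornerM La La) (hornerM Lb Lb) -!expr2.
  have [->|xa] := eqVneq x a.
    by rewrite LbA expr0n mulr0 addr0 divfK ?expf_neq0// subrr.
  have [->|xb] := eqVneq x b.
    by rewrite LaB expr0n mulr0 add0r divfK ?expf_neq0// subrr.
  have -> : h.[x] = 0 by rewrite !hornerM Tx// mul0r mulr0.
  by rewrite !(hornerM T) Tx// !mul0r expr0n !mulr0 addr0 subr0.
rewrite linearB linearD !linearZ/= Lh sub0r => /eqP.
rewrite oppr_eq0 => /eqP rel.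
have sq1 x : x \in xs -> 0 < ('X^2 - 1 : {poly R}).[x].
  move=> /(allP x1) /= h1; rewrite hornerD hornerN hornerC hornerXn subr_gt0.
  by rewrite expr_gt1// ltW// (lt_trans ltr01).
exists T, (('X^2 - 1 : {poly R}).[a] * L (La * La) / La.[a] ^+ 2),
  (('X^2 - 1 : {poly R}).[b] * L (Lb * Lb) / Lb.[b] ^+ 2); split.
- by move=> x; rewrite root_prod_XsubC.
- by apply: divr_gt0; [apply: mulr_gt0 => //; exact: sq1|rewrite exprn_even_gt0].
- by apply: divr_gt0; [apply: mulr_gt0 => //; exact: sq1|rewrite exprn_even_gt0].
- rewrite -rel /ca /cb /h !hornerM; ring.
Qed.

Lemma root_P1_at_zero a b : a \in xs -> b \in xs -> root (P1 M) a -> root (P1 M) b.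
Proof.
move=> ax bx ra; have [<-//|ab] := eqVneq a b.
have [T [al [be [Troot al0 be0]]]] := two_point_relation ax bx ab.
move: ra; rewrite rootE => /eqP ->; rewrite mul0r mulr0 add0r => /eqP.
rewrite !mulf_eq0 gt_eqF//= -!rootE => /orP[//|]; rewrite Troot.
have ura : uniq (rem a xs) by rewrite rem_uniq// uniq_rootsR.
by rewrite mem_rem_uniq// inE eqxx.
Qed.

(** A common zero would spread to all M + 1 zeros of P0, too many for the degree M of P1. *)
Lemma no_common_zero a : a \in xs -> ~~ root (P1 M) a.
Proof.
move=> ax; apply/negP => ra.
have [sx _ _] := orthonormal_zeros M.+1 Lpos oP0.
have [sP1 _ _] := oP1.
have P10 : P1 M != 0 by rewrite -size_poly_gt0 sP1.
have := max_poly_roots P10 (_ : all (root (P1 M)) xs) (uniq_rootsR _).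
rewrite sP1 /xs sx ltnn => h; apply: notF; apply: h.
by apply/allP => b bx; exact: root_P1_at_zero ra.
Qed.

(** The polynomial T of the two-point relation has no zero between two consecutive zeros
    of P0, hence the same sign at both, which forces a sign change of P1. *)
Lemma zeros_interlace i : (i < M)%N ->
  (P1 M).[xs`_i] * (P1 M).[xs`_i.+1] < 0.
Proof.
move=> iM; have [sx _ _] := orthonormal_zeros M.+1 Lpos oP0.
have so : sorted <%R xs by exact: sorted_roots.
have ls := lt_sorted_ltn_nth 0 so.
have lti (j k : nat) : (j < M.+1)%N -> (k < M.+1)%N -> (xs`_j < xs`_k) = (j < k)%N.
  by move=> jM kM; rewrite (lt_sorted_ltn_nth 0 so)// inE /xs sx.
have iM1 : (i < M.+1)%N by rewrite ltnW.
have ax : xs`_i \in xs by rewrite mem_nth// /xs sx ltnW.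
have bx : xs`_i.+1 \in xs by rewrite mem_nth// /xs sx.
have ab : xs`_i < xs`_i.+1 by rewrite lti.
have [T [al [be [Troot al0 be0 rel]]]] := two_point_relation ax bx (negbT (lt_eqF ab)).
have ura : uniq (rem xs`_i xs) by rewrite rem_uniq// uniq_rootsR.
have ux : uniq xs by exact: uniq_rootsR.
have TT : 0 < T.[xs`_i] * T.[xs`_i.+1].
  rewrite ltNge; apply/negP => /(polyrcf.poly_ivt (ltW ab))[y yI].
  rewrite Troot mem_rem_uniq// inE mem_rem_uniq// inE => /and3P[yb ya /(nthP 0)[j js yE]].
  move: yI ya yb; rewrite -yE in_itv/=; rewrite /xs sx -/xs in js.
  have [ji|ij|->] := ltngtP j i; last by rewrite eqxx.
    by rewrite leNgt lti// ji.
  rewrite leq_eqVlt in ij; case/orP: ij => [/eqP <-|ij]; first by rewrite eqxx.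
  by rewrite [X in _ && X]leNgt lti// ij andbF.
have na := no_common_zero ax; have nb := no_common_zero bx.
rewrite !rootE in na nb.
set pa := (P1 M).[_] in rel na *; set pb := (P1 M).[_] in rel nb *.
set ta := T.[_] in rel TT; set tb := T.[_] in rel TT.
have relE : al * pa * ta = - (be * pb * tb).
  by apply/eqP; rewrite -addr_eq0 -!mulrA; apply/eqP.
have : (al * pa * ta) * (be * pb * tb) < 0.
  have tb0 : tb != 0 by apply: contraTneq TT => ->; rewrite mulr0 ltxx.
  by rewrite relE mulNr oppr_lt0 -expr2 exprn_even_gt0//= !mulf_neq0// gt_eqF.
rewrite (_ : _ * _ = (al * be * (ta * tb)) * (pa * pb)); last by ring.
by rewrite pmulr_rlt0//; apply: mulr_gt0 => //; exact: mulr_gt0.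
Qed.

End Interlacing.

(** * Zeros of the even polynomial Q *)

Section EvenPolynomial.
Variable R : rcfType.
Variables (L : {scalar {poly R}}) (P0 P1 : nat -> {poly R}) (M : nat).
Hypothesis Lpos : positive_functional L.
Hypothesis oP0 : orthonormal_for L P0.
Hypothesis oP1 : orthonormal_for (weighted ('X^2 - 1) L) P1.
Hypothesis M0 : (0 < M)%N.

Let Q : {poly R} := P0 M.+1 * (P1 M \Po - 'X) + (P0 M.+1 \Po - 'X) * P1 M.
Let xs := rootsR (P0 M.+1).

Lemma horner_comp_oppX (p : {poly R}) x : (p \Po - 'X).[x] = p.[- x].
Proof. by rewrite horner_comp hornerN hornerX. Qed.

Lemma size_comp_oppX (p : {poly R}) : size (p \Po - 'X) = size p.
Proof. by rewrite size_comp_poly2// size_polyN size_polyX. Qed.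

Lemma lead_coef_comp_oppX (p : {poly R}) :
  lead_coef (p \Po - 'X) = lead_coef p * (-1) ^+ (size p).-1.
Proof.
by rewrite lead_coef_comp ?size_polyN ?size_polyX// lead_coefN lead_coefX.
Qed.

Lemma horner_Q x : Q.[x] = (P0 M.+1).[x] * (P1 M).[- x] + (P0 M.+1).[- x] * (P1 M).[x].
Proof. by rewrite hornerD !hornerM !horner_comp_oppX. Qed.

(** The two products have opposite leading coefficients. *)
Lemma size_Q : (size Q <= (M.*2).+1)%N.
Proof.
have [s0 _ _] := oP0; have [s1 _ _] := oP1.
have nz0 : P0 M.+1 != 0 by rewrite -size_poly_gt0 s0.
have nz1 : P1 M != 0 by rewrite -size_poly_gt0 s1.
have nc (p : {poly R}) : p != 0 -> p \Po - 'X != 0.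
  by rewrite -!size_poly_gt0 size_comp_oppX.
have sz (p q : {poly R}) : p != 0 -> q != 0 -> size p = M.+2 -> size q = M.+1 ->
    size (p * q) = M.*2.+2.
  by move=> p0 q0 sp sq; rewrite size_mul// sp sq addSn/= addnS -addnn.
have lcp (p q : {poly R}) : p != 0 -> q != 0 -> size p = M.+2 -> size q = M.+1 ->
    (p * q)`_(M.*2.+1) = lead_coef p * lead_coef q.
  by move=> p0 q0 sp sq; rewrite -lead_coefM lead_coefE sz.
have -> : Q = (P0 M.+1 \Po - 'X) * P1 M - (-1) *: (P0 M.+1 * (P1 M \Po - 'X)).
  by rewrite scaleN1r opprK addrC.
apply: size_sub_leading.
- by rewrite sz ?nc// ?size_comp_oppX ?s0.
- by rewrite sz ?nc// ?size_comp_oppX ?s1.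
rewrite !lcp ?nc ?size_comp_oppX ?s0 ?s1// !lead_coef_comp_oppX s0 s1/=.
by rewrite exprS; ring.
Qed.

(** At a zero of P0 only P0(-x) P1(x) remains, where P0(-x) has a constant sign and P1
    changes sign by interlacing. *)
Lemma Q_sign_change i : (i < M)%N -> Q.[xs`_i] * Q.[xs`_i.+1] < 0.
Proof.
move=> iM; have [sx x1 _] := orthonormal_zeros M.+1 Lpos oP0.
have mx (j : nat) : (j < M.+1)%N -> xs`_j \in xs by move=> jM; rewrite mem_nth// /xs sx.
have so : sorted <%R xs by exact: sorted_roots.
have ax : xs`_i \in xs by apply: mx; rewrite ltnW.
have bx : xs`_i.+1 \in xs by exact: mx.
have ab : xs`_i < xs`_i.+1.
  by rewrite (lt_sorted_ltn_nth 0 so)// inE /xs sx// ltnW.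
have nz0 : P0 M.+1 != 0 by have [s0 _ _] := oP0; rewrite -size_poly_gt0 s0.
have r0 x : x \in xs -> (P0 M.+1).[x] = 0.
  by rewrite mem_rootsR// rootE => /eqP.
rewrite !horner_Q (r0 _ ax) (r0 _ bx) !mul0r !add0r.
set a := xs`_i in ab ax *; set b := xs`_i.+1 in ab bx *.
have a1 : 1 < a by have := allP x1 a ax.
have neg : 0 < (P0 M.+1).[- a] * (P0 M.+1).[- b].
  rewrite mulrC ltNge; apply/negP => /(polyrcf.poly_ivt (_ : - b <= - a))[].
    by rewrite lerN2 ltW.
  move=> y; rewrite in_itv/= => /andP[_ ya]; apply/negP; apply: (orthonormal_no_small_root _ Lpos oP0).
  by rewrite (le_trans ya)//; lra.
rewrite (_ : _ * _ = (P0 M.+1).[- a] * (P0 M.+1).[- b] * ((P1 M).[a] * (P1 M).[b])); last by ring.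
by rewrite pmulr_rlt0//; exact: (zeros_interlace Lpos oP0 oP1 iM).
Qed.

Lemma root_QN x : root Q x -> root Q (- x).
Proof.
rewrite !rootE !horner_Q opprK => /eqP h; apply/eqP; rewrite -[RHS]h; ring.
Qed.

(** One zero between any two consecutive zeros of P0, hence M zeros above 1;
    with their opposites they exhaust the degree. *)
Lemma positive_roots_Q :
  size [seq x <- rootsR Q | 0 < x] = M /\ all (> 1) [seq x <- rootsR Q | 0 < x].
Proof.
have [sx x1 _] := orthonormal_zeros M.+1 Lpos oP0.
have so : sorted <%R xs by exact: sorted_roots.
have Q0 : Q != 0.
  by apply/eqP => Q0; have := Q_sign_change M0; rewrite Q0 !horner0 mul0r ltxx.
have lex (j k : nat) : (j <= k)%N -> (k < M.+1)%N -> xs`_j <= xs`_k.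
  rewrite leq_eqVlt => /predU1P[->//|jk kM].
  by rewrite ltW// (lt_sorted_ltn_nth 0 so)// inE /xs sx// (ltn_trans jk).
have ex i : {y : R | (i < M)%N -> xs`_i < y < xs`_i.+1 /\ root Q y}.
  have [iM|iM] := ltnP i M; last by exists 0.
  have [y] := poly_ivtoo (lex i i.+1 (leqnSn i) iM) (Q_sign_change iM).
  by rewrite in_itv/= => yI ry; exists y.
pose y i := sval (ex i).
have yP i : (i < M)%N -> xs`_i < y i < xs`_i.+1 /\ root Q (y i).
  by move=> iM; exact: (svalP (ex i) iM).
pose ys := mkseq y M.
have lty i j : (i < j)%N -> (j < M)%N -> y i < y j.
  move=> ij jM; have [/andP[_ h1] _] := yP i (ltn_trans ij jM).
  have [/andP[h2 _] _] := yP j jM.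
  by rewrite (lt_trans h1)// (le_lt_trans _ h2)// lex// ltnW.
have uys : uniq ys.
  rewrite map_inj_in_uniq ?iota_uniq// => i j; rewrite !mem_iota !add0n /= => iM jM yij.
  have [ij|ij|//] := ltngtP i j.
    by have := lty _ _ ij jM; rewrite yij ltxx.
  by have := lty _ _ ij iM; rewrite yij ltxx.
have ys1 : all (> 1) ys.
  apply/allP => x /mapP[i]; rewrite mem_iota add0n /= => iM xE; rewrite xE.
  have xi : xs`_i \in xs by rewrite mem_nth// /xs sx ltnW.
  have [/andP[h _] _] := yP i iM.
  exact: lt_trans (allP x1 _ xi) h.
have rys : all (root Q) ys.
  by apply/allP => x /mapP[i]; rewrite mem_iota add0n /= => /yP[_ ryi] xE; rewrite xE.
set ps := [seq x <- rootsR Q | 0 < x].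
have ups : uniq ps by rewrite filter_uniq// uniq_rootsR.
have sub : {subset ys <= ps}.
  move=> x xy; rewrite mem_filter mem_rootsR// (allP rys)// andbT.
  exact: lt_trans (allP ys1 x xy).
have rp x : x \in ps -> 0 < x /\ root Q x.
  by rewrite mem_filter mem_rootsR// => /andP[].
have sps : (size ps <= size ys)%N.
  have u2 : uniq (ps ++ [seq - x | x <- ps]).
    rewrite cat_uniq ups map_inj_uniq ?ups ?andbT; last exact: oppr_inj.
    apply/hasPn => _ /mapP[x /rp[x0 _] ->]; apply/negP => /rp[].
    by rewrite oppr_gt0 ltNge (ltW x0).
  have r2 : all (root Q) (ps ++ [seq - x | x <- ps]).
    rewrite all_cat; apply/andP; split; apply/allP => x.
      by move=> /rp[].
    by move=> /mapP[w /rp[_ rw] ->]; exact: root_QN.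
  have := leq_trans (max_poly_roots Q0 r2 u2) size_Q.
  by rewrite size_cat size_map addnn ltnS leq_double size_mkseq.
have [eqsz eqm] := uniq_min_size uys sub sps.
split; first by rewrite -eqsz size_mkseq.
by rewrite -(eq_all_r eqm).
Qed.

End EvenPolynomial.

(** * The two polynomial families of the weight *)

Section JuttnerPolynomials.
Variable R : realType.
Implicit Types (z x : R) (l n : nat) (p q : {poly R}).
Local Notation prod_XsubC s := (\prod_(a <- s) ('X - a%:P)).

(** Both families are orthonormal for one functional, up to the weight x^2 - 1. *)
Definition juttner_level l z : {poly R} -> R := weighted (('X^2 - 1) ^+ l) (juttner z).

HB.instance Definition _ l z := GRing.Linear.on (juttner_level l z).

Lemma juttner_level0 z p : juttner_level 0 z p = juttner z p.
Proof. by rewrite /juttner_level /weighted expr0 mul1r. Qed.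

Lemma juttner_level1 z p : juttner_level 1 z p = juttner z (('X^2 - 1) * p).
Proof. by []. Qed.

Lemma X2sub1_neq0 : ('X^2 - 1 : {poly R}) != 0.
Proof. by rewrite -size_poly_gt0 size_XnsubC. Qed.

Lemma juttner_positive z : 0 < z -> positive_functional (juttner z).
Proof. by move=> z0 p; exact: juttner_gt0. Qed.

Lemma juttner_level_positive l z : 0 < z -> positive_functional (juttner_level l z).
Proof.
move=> z0 p p0 pge0; apply: juttner_gt0 => //.
  by rewrite mulf_neq0// expf_neq0// X2sub1_neq0.
move=> x x1; rewrite hornerM mulr_ge0 ?pge0// horner_exp exprn_ge0//.
by rewrite hornerD hornerN hornerC hornerXn subr_ge0 expr_ge1// (le_trans ler01).
Qed.

Lemma opoly_orthonormal_level l z : 0 < z ->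
  orthonormal_for (juttner_level l z) (opoly l z).
Proof.
move=> z0.
have ex : exists P, orthonormal_polys l z P.
  exists (gram_schmidt (juttner_level l z)).
  have [sP cP LP] := gram_schmidt_orthonormal (juttner_level_positive l z0).
  by split=> // m n; rewrite ipw_juttner//; exact: LP.
have [sP cP LP] : orthonormal_polys l z (opoly l z) by exact: (xgetPex _ ex).
by split=> // m n; rewrite -LP ipw_juttner.
Qed.

Lemma opoly0_orthonormal z : 0 < z -> orthonormal_for (juttner z) (opoly 0 z).
Proof.
move=> z0; have [sP cP LP] := opoly_orthonormal_level 0 z0.
by split=> // m n; rewrite -LP juttner_level0.
Qed.

Lemma opoly1_orthonormal z : 0 < z ->
  orthonormal_for (weighted ('X^2 - 1) (juttner z)) (opoly 1 z).
Proof. exact: opoly_orthonormal_level. Qed.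

Variable z : R.
Hypothesis z0 : 0 < z.
Let oP l := opoly_orthonormal_level l z0.
Let Lpos l := juttner_level_positive l z0.
Local Notation P l n := (opoly l z n).
Local Notation L l := (juttner_level l z).

Lemma size_opoly l n : size (P l n) = n.+1.
Proof. by have [-> _ _] := oP l. Qed.

Lemma lc_gt0 l n : 0 < lc l z n.
Proof. by have [_ h _] := oP l; exact: h. Qed.

Lemma lc_coef l n : (P l n)`_n = lc l z n.
Proof. by rewrite /lc /lead_coef size_opoly. Qed.

Lemma ipw_level l p q : ipw l z p q = L l (p * q).
Proof. by rewrite ipw_juttner. Qed.

Lemma opoly_zeros l n :
  [/\ size (zeros l z n) = n, all (> 1) (zeros l z n) &
      P l n = lc l z n *: prod_XsubC (zeros l z n)].
Proof. exact: orthonormal_zeros (Lpos l) (oP l). Qed.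

(** Vieta: the sums and products of zeros that enter the data are coefficients of P. *)
Lemma opoly_subleading l n : (P l n.+1)`_n = - lc l z n.+1 * \sum_(1 <= i < n.+2) xzero l z i n.+1.
Proof.
have [sz _ PE] := opoly_zeros l n.+1.
have sn0 : size (zeros l z n.+1) != 0%N by rewrite sz.
rewrite PE coefZ -lc_coef PE coefZ.
have -> : (prod_XsubC (zeros l z n.+1))`_n.+1 = 1.
  have := lead_coef_prod_XsubC (zeros l z n.+1) xpredT id.
  by rewrite lead_coefE size_prod_XsubC sz.
have := coefPn_prod_XsubC sn0; rewrite sz /= => ->.
rewrite mulr1 mulNr -mulrN; congr (_ * - _).
rewrite big_add1 /= (big_nth 0) sz; apply: eq_bigr => i _.
by rewrite /xzero.
Qed.

Lemma opoly_at0 l n : (P l n).[0] = (-1) ^+ n * lc l z n * \prod_(1 <= i < n.+1) xzero l z i n.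
Proof.
have [sz _ PE] := opoly_zeros l n.
rewrite PE hornerZ horner_prod (_ : \prod_(a <- _) _ = (-1) ^+ n * \prod_(1 <= i < n.+1) xzero l z i n).
  by ring.
rewrite big_add1 /= (big_nth 0) sz /xzero.
under eq_bigr do rewrite hornerXsubC sub0r -mulN1r.
by rewrite big_split/= prodr_const_nat subn0.
Qed.

(** X P_k has degree k + 1, so orthogonality leaves the neighbouring degrees only. *)
Lemma JmatE l n (k j : 'I_n) : Jmat l z n k j = L l ('X * (P l k * P l j)).
Proof.
have sX m : size ('X * P l m) = m.+2.
  by rewrite mulrC size_mulX -?size_poly_gt0 size_opoly.
have step m : L l ('X * (P l m * P l m.+1)) = acoef l z m.
  rewrite mulrA (orthonormal_top (oP l)) ?sX//.
  by rewrite coefXM /= lc_coef.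
rewrite mxE; have [->|kj] := eqVneq (k : nat) j.
  by rewrite /bcoef ipw_level mulrA.
have [kj1|kj1] := eqVneq k.+1 (j : nat); first by rewrite -kj1 step.
have [jk1|jk1] := eqVneq j.+1 (k : nat); first by rewrite -jk1 -step; congr (L l _); ring.
wlog lt : k j kj kj1 jk1 / (k < j)%N.
  move=> H; have [lt|lt|/eqP e] := ltngtP k j; last by rewrite e in kj.
    exact: H.
  by rewrite [P l k * _]mulrC; apply: H; rewrite // eq_sym.
rewrite mulrA (orthonormal_low (oP l))//.
by rewrite sX ltn_neqAle kj1.
Qed.

End JuttnerPolynomials.

(** * The matrices as Gram matrices *)

Section MatricesAsGramMatrices.
Variables (R : realType) (z : R).
Hypothesis z0 : 0 < z.
Let oP l := opoly_orthonormal_level l z0.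
Let Lpos l := juttner_level_positive l z0.
Local Notation P l n := (opoly l z n).
Local Notation L l := (juttner_level l z).

Lemma size_X2sub1_opoly1 k : size (('X^2 - 1) * P 1 k) = k.+3.
Proof.
have P0 : P 1 k != 0 by rewrite -size_poly_gt0 size_opoly.
by rewrite size_mul ?X2sub1_neq0// size_XnsubC// size_opoly.
Qed.

Lemma coef_X2sub1 (p : {poly R}) i :
  (('X^2 - 1) * p)`_i.+2 = p`_i - p`_i.+2.
Proof. by rewrite mulrBl mul1r coefB coefXnM /= subn2. Qed.

(** (X^2 - 1) P 1 k has degree k + 2 and P 1 k is orthogonal to the lower degrees, so
    three diagonals remain. The middle one is the leading coefficient that appears once
    the top component along P 0 (k + 2) has been subtracted; it compares the subleading
    coefficients of both families, that is, the sums of their zeros. *)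
Lemma JmixE n (k : 'I_n) (j : 'I_n.+1) : Jmix z n k j = L 1 (P 1 k * P 0 j).
Proof.
have o0 := opoly0_orthonormal z0.
have o1 := opoly1_orthonormal z0.
have low m i : (m < i)%N -> juttner z (('X^2 - 1) * P 1 m * P 0 i.+2) = 0.
  by move=> mi; rewrite (orthonormal_low o0)// size_X2sub1_opoly1 !ltnS.
have diag m : L 1 (P 1 m * P 0 m) = pcoef z m.
  by rewrite mulrC (orthonormal_top (oP 1)) ?size_opoly ?lc_coef.
have upp m : juttner z (('X^2 - 1) * P 1 m * P 0 m.+2) = rcoef z m.+1.
  rewrite (orthonormal_top o0) ?size_X2sub1_opoly1// coef_X2sub1 lc_coef//.
  by rewrite [_`_m.+2]nth_default ?subr0// size_opoly// leqnSn.
have mid m : juttner z (('X^2 - 1) * P 1 m * P 0 m.+1) = qcoef z m.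
  pose r := rcoef z m.+1.
  have -> : juttner z (('X^2 - 1) * P 1 m * P 0 m.+1) =
      juttner z ((('X^2 - 1) * P 1 m - r *: P 0 m.+2) * P 0 m.+1).
    have [_ _ o] := o0.
    by rewrite [X in _ = _ X]mulrBl linearB/= -scalerAl linearZ/= o gtn_eqF// mulr0 subr0.
  rewrite (orthonormal_top o0); last first.
    apply: size_sub_leading; rewrite ?size_X2sub1_opoly1 ?size_opoly//.
    rewrite lc_coef// coef_X2sub1 lc_coef// [(P 1 m)`_m.+2]nth_default ?size_opoly//.
    by rewrite subr0 /r /rcoef divfK// gt_eqF// lc_gt0.
  rewrite /qcoef coefB coefZ opoly_subleading// -[lead_coef _]/(lc 0 z m.+1).
  rewrite (_ : (('X^2 - 1) * P 1 m)`_m.+1 =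
      - lc 1 z m * \sum_(1 <= i < m.+1) xzero 1 z i m).
    rewrite /r /rcoef; have := lc_gt0 z0 0 m.+2; have := lc_gt0 z0 0 m.+1 => h1 h2.
    by rewrite /=; field; rewrite !gt_eqF.
  rewrite mulrBl mul1r coefB [(P 1 m)`_m.+1]nth_default ?size_opoly// subr0.
  rewrite coefXnM; case: m {r} => [|m].
    by rewrite ltnS leqnn big_geq// mulr0.
  by rewrite !ltnS ltn0 subSS subn1 opoly_subleading.
rewrite mxE; have [jk|jk] := eqVneq (j : nat) k; first by rewrite jk diag.
have [jk1|jk1] := eqVneq (j : nat) k.+1; first by rewrite jk1 juttner_level1 mulrA mid.
have [jk2|jk2] := eqVneq (j : nat) k.+2; first by rewrite jk2 juttner_level1 mulrA upp.
have [lt|lt|/eqP e] := ltngtP j k; last by rewrite e in jk.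
  by rewrite mulrC (orthonormal_low (oP 1))// size_opoly.
rewrite juttner_level1 mulrA.
case: (j : nat) lt jk jk1 jk2 => [|[|j']] // lt jk jk1 jk2.
  by move: lt jk1; rewrite ltnS leqn0 => /eqP ->.
have k1 : (nat_of_ord k == j'.+1) = false.
  by apply/negbTE; move: jk1; rewrite !eqSS eq_sym.
have k2 : (nat_of_ord k == j') = false.
  by apply/negbTE; move: jk2; rewrite !eqSS eq_sym.
by move: lt; rewrite ltnS leq_eqVlt k1 /= ltnS leq_eqVlt k2 /= => /low ->.
Qed.

Lemma horner_expansion l n (q : {poly R}) x : (size q <= n.+1)%N ->
  q.[x] = \sum_(j < n) L l (q * P l j) * (P l j).[x] + L l (q * P l n) * (P l n).[x].
Proof.
move=> sq; rewrite {1}(orthonormal_expansion (oP l) sq) horner_sum big_ord_recr/=.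
by rewrite hornerZ; congr (_ + _); apply: eq_bigr => j _; rewrite hornerZ.
Qed.

(** The truncated recurrences: the first omitted polynomial occurs with some
    coefficient vector that does not depend on x. *)
Lemma Jmat_recurrence l n : exists e : 'cV[R]_n, forall x,
  Jmat l z n *m Pvec l z n x = x *: Pvec l z n x - (P l n).[x] *: e.
Proof.
exists (\col_k L l ('X * (P l k * P l n))) => x; apply/colP => k; rewrite !mxE.
have sX : (size ('X * P l k)%R <= n.+1)%N.
  by rewrite mulrC size_mulX -?size_poly_gt0 ?size_opoly// ltnS.
have := horner_expansion l x sX; rewrite hornerM hornerX => ->.
rewrite -mulrA [X in _ = _ + X - _]mulrC addrK.
by apply: eq_bigr => j _; rewrite JmatE// !mxE mulrA.
Qed.

Lemma Jmix_recurrence n : exists e : 'cV[R]_n, forall x,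
  Jmix z n *m Pvec 0 z n.+1 x =
  (x ^+ 2 - 1) *: Pvec 1 z n x - (P 0 n.+1).[x] *: e.
Proof.
exists (\col_k L 1 (P 1 k * P 0 n.+1)) => x; apply/colP => k; rewrite !mxE.
have sX : (size (('X^2 - 1) * P 1 k)%R <= n.+2)%N by rewrite size_X2sub1_opoly1 !ltnS.
have := horner_expansion 0 x sX; rewrite hornerM hornerD hornerN hornerC hornerXn => ->.
rewrite juttner_level0 -[X in _ = _ + X - _]mulrC juttner_level1 !mulrA addrK.
by apply: eq_bigr => j _; rewrite JmixE// !mxE juttner_level0 juttner_level1 mulrA.
Qed.

Lemma Jmix_tr_recurrence n : exists e : 'cV[R]_n.+1, forall x,
  (Jmix z n)^T *m Pvec 1 z n x = Pvec 0 z n.+1 x - (P 1 n).[x] *: e.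
Proof.
exists (\col_k L 1 (P 0 k * P 1 n)) => x; apply/colP => k; rewrite !mxE.
have sX : (size (P 0 k) <= n.+1)%N by rewrite size_opoly.
rewrite (horner_expansion 1 x sX) [X in _ = _ + X - _]mulrC addrK.
by apply: eq_bigr => j _; rewrite mxE JmixE// !mxE [P 0 k * _]mulrC.
Qed.

(** The quadratic form of J is the mean of x q(x)^2, positive on [1, oo). *)
Lemma Jmat_injective l n (v : 'cV[R]_n) : Jmat l z n *m v = 0 -> v = 0.
Proof.
move=> Jv; pose q := \sum_(k < n) v k ord0 *: P l k.
have Lqq : L l ('X * (q * q)) = 0.
  transitivity (\sum_(k < n) v k ord0 * (Jmat l z n *m v) k ord0).
    rewrite {1}/q mulr_suml mulr_sumr linear_sum; apply: eq_bigr => k _.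
    rewrite -scalerAl -scalerAr linearZ/=; congr (_ * _).
    rewrite /q !mulr_sumr linear_sum mxE; apply: eq_bigr => j _.
    by rewrite -!scalerAr linearZ/= JmatE// mulrC.
  by rewrite Jv big1// => k _; rewrite mxE mulr0.
have q0 : q = 0.
  have [//|qn0] := eqVneq q 0.
  have qq0 : 'X * (q * q) != 0 by rewrite !mulf_neq0// polyX_eq0.
  suff /(Lpos l qq0) : forall x, 1 <= x -> 0 <= ('X * (q * q)).[x].
    by rewrite Lqq ltxx.
  move=> x x1; rewrite !hornerM hornerX -expr2 mulr_ge0 ?sqr_ge0//.
  exact: le_trans ler01 x1.
apply/colP => k; rewrite mxE.
have [_ _ o] := oP l.
have : L l (q * P l k) = v k ord0.
  rewrite /q mulr_suml linear_sum (bigD1 k)//= big1 => [|j jk].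
    by rewrite -scalerAl linearZ/= o eqxx mulr1 addr0.
  by rewrite -scalerAl linearZ/= o (negPf jk : (j == k :> nat) = false) mulr0.
by rewrite q0 mul0r linear0.
Qed.

End MatricesAsGramMatrices.

(** * Eigenvectors of the pencil (A^0, A^1) *)

Section PencilEigenvectors.
Variables (R : realType) (z : R) (M : nat).
Hypothesis z0 : 0 < z.
Hypothesis M0 : (0 < M)%N.
Local Notation P l n := (opoly l z n).
Local Notation Pv l n x := (Pvec l z n x).

Lemma zQ_spec (i : int) : i != 0 -> (`|i| <= M)%N ->
  [/\ root (Qpoly M z) (zQ M z i), 1 < `|zQ M z i| & Num.sg (zQ M z i) = (sgz i)%:~R].
Proof.
move=> i0 iM; rewrite /zQ; set ps := [seq x <- _ | _].
have [sps ps1] := positive_roots_Q (juttner_positive z0) (opoly0_orthonormal z0)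
  (opoly1_orthonormal z0) M0.
rewrite -/(Qpoly M z) -/ps in sps ps1.
have pi : ps`_(`|i|%N.-1) \in ps by rewrite mem_nth// sps prednK// absz_gt0.
have p1 := allP ps1 _ pi; rewrite /= in p1.
have p0 : 0 < ps`_(`|i|%N.-1) by apply: lt_trans p1.
have rp : root (Qpoly M z) ps`_(`|i|%N.-1).
  move: pi; rewrite mem_filter => /andP[_]; have [->|Q0] := eqVneq (Qpoly M z) 0.
    by rewrite root0.
  by rewrite mem_rootsR.
have rpN := root_QN rp.
have sE : (sgz i)%:~R = Num.sg (i%:~R : R).
  by rewrite sgrEz sgz_int.
rewrite normrM sE normr_sg intr_eq0 i0 mul1r ger0_norm ?ltW//.
rewrite sgrM sgr_id (gtr0_sg p0) mulr1; split => //.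
have [ip|ip|e] := ltrgtP 0 (i%:~R : R).
- by rewrite gtr0_sg// mul1r.
- by rewrite ltr0_sg// mulN1r.
- by move/eqP: e; rewrite eq_sym intr_eq0 (negPf i0).
Qed.

Lemma Q_eq0 x : root (Qpoly M z) x ->
  (P 0 M.+1).[x] * (P 1 M).[- x] = - ((P 0 M.+1).[- x] * (P 1 M).[x]).
Proof.
by rewrite rootE /Qpoly hornerD !hornerM !horner_comp_oppX addr_eq0 => /eqP.
Qed.

(** The velocity of a particle of energy x, with the sign of x. *)
Definition velocity (x : R) : R := Num.sqrt (x ^+ 2 - 1) / x.

Lemma lambdahatE i : lambdahat M z i = if i == 0 then 0 else velocity (zQ M z i).
Proof. by []. Qed.

Lemma velocity_sqr x : 1 < `|x| -> velocity x ^+ 2 = 1 - (x ^+ 2)^-1.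
Proof.
move=> x1; have x21 : 1 < x ^+ 2 by rewrite -real_normK ?num_real// expr_gt1.
have x0 : x != 0 by apply: contraTneq x1 => ->; rewrite normr0 ltNge ler01.
rewrite /velocity exprMn sqr_sqrtr; last by rewrite subr_ge0 ltW.
by field.
Qed.

Lemma velocity_sg x : 1 < `|x| -> Num.sg (velocity x) = Num.sg x.
Proof.
move=> x1; have x21 : 1 < x ^+ 2 by rewrite -real_normK ?num_real// expr_gt1.
by rewrite /velocity sgrM sgrV gtr0_sg ?mul1r// sqrtr_gt0 subr_gt0.
Qed.

Lemma velocity_norm_lt1 x : 1 < `|x| -> `|velocity x| < 1.
Proof.
move=> x1; have x0 : x != 0 by apply: contraTneq x1 => ->; rewrite normr0 ltNge ler01.
rewrite -(@ltr_pXn2r _ 2) ?nnegrE// real_normK ?num_real// expr1n velocity_sqr//.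
by rewrite ltrBlDr ltrDl invr_gt0 exprn_even_gt0.
Qed.

Lemma velocity_inj x y : 1 < `|x| -> 1 < `|y| -> velocity x = velocity y -> x = y.
Proof.
move=> x1 y1 e; have sxy : Num.sg x = Num.sg y by rewrite -velocity_sg// e velocity_sg.
have : velocity x ^+ 2 = velocity y ^+ 2 by rewrite e.
rewrite !velocity_sqr// => /addrI/oppr_inj/invr_inj/eqP.
rewrite eqf_sqr => /orP[/eqP//|/eqP xy].
have : Num.sg y = 0.
  by move: sxy; rewrite xy sgrN => h; lra.
move/eqP; rewrite sgr_eq0 => /eqP y0; move: y1; rewrite y0 normr0 ltNge ler01.
by [].
Qed.

Lemma lambdahat_norm_lt1 i : (`|i| <= M)%N -> `|lambdahat M z i| < 1.
Proof.
rewrite lambdahatE; have [->|i0] := eqVneq i 0; first by rewrite normr0.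
by move=> /(zQ_spec i0)[_ h _]; exact: velocity_norm_lt1.
Qed.

Lemma lambdahat_inj i j : (`|i| <= M)%N -> (`|j| <= M)%N ->
  lambdahat M z i = lambdahat M z j -> i = j.
Proof.
move=> iM jM e.
have sgE k : (`|k| <= M)%N -> Num.sg (lambdahat M z k) = (sgz k)%:~R.
  rewrite lambdahatE; have [->|k0] := eqVneq k 0; first by rewrite sgr0.
  by move=> /(zQ_spec k0)[_ h s]; rewrite velocity_sg.
have sij : sgz i = sgz j.
  by apply: (@intr_inj R); rewrite -!sgE// e.
have [i0|i0] := eqVneq i 0.
  by move: sij; rewrite i0 sgz0 => /esym/eqP; rewrite sgz_eq0 => /eqP ->.
have j0 : j != 0 by rewrite -sgz_eq0 -sij sgz_eq0.
move: e; rewrite !lambdahatE (negPf i0) (negPf j0).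
have [_ zi1 _] := zQ_spec i0 iM; have [_ zj1 _] := zQ_spec j0 jM.
move=> /(velocity_inj zi1 zj1); rewrite /zQ sij.
have sj0 : ((sgz j)%:~R : R) != 0 by rewrite intr_eq0 sgz_eq0.
move=> /(mulfI sj0) /eqP.
have [sps _] := positive_roots_Q (juttner_positive z0) (opoly0_orthonormal z0)
  (opoly1_orthonormal z0) M0.
rewrite nth_uniq ?filter_uniq ?uniq_rootsR//.
- move=> /eqP ij; rewrite [i]intEsg [j]intEsg sij.
  congr (_ * _%:Z).
  by rewrite -[LHS]prednK ?absz_gt0// ij prednK ?absz_gt0.
- by rewrite sps prednK// absz_gt0.
- by rewrite sps prednK// absz_gt0.
Qed.

Lemma Amat0_mul (u : 'cV[R]_M.+1) (v : 'cV[R]_M) :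
  Amat0 M z *m col_mx u v = col_mx (Jmat 0 z M.+1 *m u) (Jmat 1 z M *m v).
Proof. by rewrite mul_block_col !mul0mx addr0 add0r. Qed.

Lemma Amat1_mul (u : 'cV[R]_M.+1) (v : 'cV[R]_M) :
  Amat1 M z *m col_mx u v = col_mx ((Jmix z M)^T *m v) (Jmix z M *m u).
Proof. by rewrite mul_block_col !mul0mx addr0 add0r. Qed.

Lemma Amat0_injective (y : 'cV[R]_(M.+1 + M)) : Amat0 M z *m y = 0 -> y = 0.
Proof.
rewrite -[y]vsubmxK Amat0_mul -[X in _ = X -> _]col_mx0 => /eq_col_mx[h1 h2].
by rewrite (Jmat_injective z0 h1) (Jmat_injective z0 h2) col_mx0.
Qed.

(** Each residue of the truncated recurrences comes with a factor that vanishes: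
    Q at its zero, a commutator of P 1 M with itself, or x^2 - 1 at x = 1 and -1. *)
Lemma pencil_eigenvector i : (`|i| <= M)%N ->
  Amat1 M z *m yvec M z i = lambdahat M z i *: (Amat0 M z *m yvec M z i).
Proof.
move=> iM; rewrite /yvec Amat0_mul Amat1_mul scale_col_mx lambdahatE.
have [e0 J0] := Jmat_recurrence z0 0 M.+1.
have [e1 J1] := Jmat_recurrence z0 1 M.
have [f K] := Jmix_recurrence z0 M.
have [g KT] := Jmix_tr_recurrence z0 M.
have [->|i0] := eqVneq i 0.
  rewrite /uvec /vvec eqxx !scale0r mulmx0; congr col_mx.
  rewrite mulmxBr -!scalemxAr !K sqrrN expr1n subrr !scale0r !sub0r.
  by rewrite !scalerN !scalerA mulrC subrr.
have [rQ x1 _] := zQ_spec i0 iM; have Qx := Q_eq0 rQ.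
rewrite /uvec /vvec (negPf i0).
set x := zQ M z i in rQ x1 Qx *.
have x21 : 1 < x ^+ 2 by rewrite -real_normK ?num_real// expr_gt1.
have x0 : x != 0 by apply: contraTneq x1 => ->; rewrite normr0 ltNge ler01.
have sq : Num.sqrt (x ^+ 2 - 1) ^+ 2 = x ^+ 2 - 1 by rewrite sqr_sqrtr// subr_ge0 ltW.
set s := Num.sqrt _ in sq *.
have vE : velocity x = s / x by [].
congr col_mx.
- rewrite -scalemxAr mulmxBr mulmxDr -!scalemxAr !KT !J0 vE.
  apply/colP => k; rewrite !mxE.
  set a := (P 1 M).[x] in Qx *; set b := (P 1 M).[- x] in Qx *.
  set c := (P 0 M.+1).[x] in Qx *; set d := (P 0 M.+1).[- x] in Qx *.
  apply: (mulfI x0); field: Qx; exact: x0.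
- rewrite -!scalemxAr mulmxBr !mulmxDr -!scalemxAr !K !J1 vE sqrrN.
  apply/colP => k; rewrite !mxE.
  set a := (P 1 M).[x] in Qx *; set b := (P 1 M).[- x] in Qx *.
  set c := (P 0 M.+1).[x] in Qx *; set d := (P 0 M.+1).[- x] in Qx *.
  field: Qx sq; exact: x0.
Qed.

(** The first entry vanishes only if a polynomial has equal moduli at x and - x. *)
Lemma yvec_neq0 i : (`|i| <= M)%N -> yvec M z i != 0.
Proof.
move=> iM; apply/eqP; rewrite /yvec -col_mx0 => /eq_col_mx[+ _].
move=> /colP/(_ ord0) u0.
have P0E x : (P 0 0).[x] = lc 0 z 0.
  have /size_poly1P[c c0 Pc] : size (P 0 0) == 1%N by rewrite size_opoly.
  by rewrite -lc_coef// Pc hornerC coefC eqxx.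
have c0 : lc 0 z 0 != 0 by rewrite gt_eqF// lc_gt0.
have refl l n x := @orthonormal_reflection R _ _ n x (juttner_level_positive l z0)
  (opoly_orthonormal_level l z0).
have [i0|i0] := eqVneq i 0.
  move: u0; rewrite i0 /uvec eqxx !mxE !P0E => /eqP; rewrite -mulrBl mulf_eq0 (negPf c0) orbF subr_eq0 => /eqP e.
  by have := refl 0 M.+1 1 ltr01 isT; rewrite -e ltxx.
move: u0; rewrite /uvec (negPf i0) !mxE !P0E => /eqP; rewrite -mulrDl mulf_eq0 (negPf c0) orbF.
rewrite addr_eq0 => /eqP /(congr1 Num.norm); rewrite normrN.
have [_ x1 _] := zQ_spec i0 iM; move: x1; set x := zQ M z i => x1.
have [xp|xn|x00] := ltrgtP 0 x.
- by move=> e; have := refl 1 M x xp M0; rewrite e ltxx.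
- move=> e; have := refl 1 M (- x) _ M0; rewrite opprK e ltxx.
  by rewrite oppr_gt0 => /(_ xn).
- by move: x1; rewrite -x00 normr0 ltNge ler01.
Qed.

End PencilEigenvectors.

(** * Dependence of the polynomials on the inverse temperature *)

Section PolynomialFamilies.
Variable R : realType.
Implicit Types (p q : R -> {poly R}) (z : R).

Lemma is_derive_sum_ord n (h : 'I_n -> R -> R) (dh : 'I_n -> R) z :
  (forall i, is_derive z (1 : R) (h i) (dh i)) ->
  is_derive z (1 : R) (fun w => \sum_(i < n) h i w) (\sum_(i < n) dh i).
Proof.
move=> H; have -> : (fun w => \sum_(i < n) h i w) = \sum_(i < n) h i.
  by apply/funext => w; rewrite fct_sumE.
exact: is_derive_sum.
Qed.

Lemma is_derive_mul (f g : R -> R) z (df dg : R) :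
  is_derive z (1 : R) f df -> is_derive z (1 : R) g dg ->
  is_derive z (1 : R) (fun w => f w * g w) (df * g z + f z * dg).
Proof.
move=> hf hg; apply: (is_derive_eq (is_deriveM hf hg)).
by rewrite /GRing.scale/=; ring.
Qed.

Lemma near_gt0 (f g : R -> R) z : 0 < z -> (forall w, 0 < w -> f w = g w) ->
  \forall w \near z, f w = g w.
Proof.
by move=> z0 fg; near=> w; apply: fg; near: w; exact: lt_nbhsr.
Unshelve. all: by end_near. Qed.

(** Coefficientwise differentiability of a family of bounded degree. *)
Definition is_derive_coefs z p (p' : {poly R}) : Prop :=
  (exists N, (forall w, size (p w) <= N)%N /\ (size p' <= N)%N) /\
  forall i, is_derive z (1 : R) (fun w => (p w)`_i) p'`_i.

Lemma is_derive_coefs_cst z (q : {poly R}) : is_derive_coefs z (fun=> q) 0.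
Proof.
split; first by exists (size q); split=> //; rewrite size_poly0.
by move=> i; rewrite coef0; exact: is_derive_cst.
Qed.

Lemma is_derive_coefsD z p q (p' q' : {poly R}) : is_derive_coefs z p p' ->
  is_derive_coefs z q q' -> is_derive_coefs z (fun w => p w + q w) (p' + q').
Proof.
move=> [[N1 [sp sp']] dp] [[N2 [sq sq']] dq]; split.
  by exists (maxn N1 N2); split=> [w|]; rewrite (leq_trans (size_polyD _ _))// geq_max
    !leq_max ?sp ?sq ?sp' ?sq' ?orbT.
move=> i; rewrite coefD; under eq_fun do rewrite coefD.
exact: is_deriveD (dp i) (dq i).
Qed.

Lemma is_derive_coefsZ z (c : R -> R) (c' : R) p (p' : {poly R}) : is_derive z (1 : R) c c' ->
  is_derive_coefs z p p' ->
  is_derive_coefs z (fun w => c w *: p w) (c' *: p z + c z *: p').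
Proof.
move=> dc [[N [sp sp']] dp]; split.
  exists N; split=> [w|]; first by rewrite (leq_trans (size_scale_leq _ _)).
  by rewrite (leq_trans (size_polyD _ _))// geq_max !(leq_trans (size_scale_leq _ _)).
move=> i; rewrite coefD !coefZ; under eq_fun do rewrite coefZ.
exact: is_derive_mul.
Qed.

Lemma is_derive_coefsN z p (p' : {poly R}) : is_derive_coefs z p p' ->
  is_derive_coefs z (fun w => - p w) (- p').
Proof.
move=> dp; have := is_derive_coefsZ (is_derive_cst (-1 : R) z (1 : R)) dp.
rewrite scale0r add0r scaleN1r.
by under eq_fun do rewrite scaleN1r.
Qed.

Lemma is_derive_coefs_sum z n (p : 'I_n -> R -> {poly R}) (p' : 'I_n -> {poly R}) :
  (forall k, is_derive_coefs z (p k) (p' k)) ->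
  is_derive_coefs z (fun w => \sum_(k < n) p k w) (\sum_(k < n) p' k).
Proof.
elim: n p p' => [|n IH] p p' H.
  rewrite big_ord0; under eq_fun do rewrite big_ord0.
  exact: is_derive_coefs_cst.
rewrite big_ord_recr/=; under eq_fun do rewrite big_ord_recr/=.
by apply: is_derive_coefsD => //; apply: IH.
Qed.

Lemma is_derive_coefsM z p q (p' q' : {poly R}) : is_derive_coefs z p p' ->
  is_derive_coefs z q q' ->
  is_derive_coefs z (fun w => p w * q w) (p' * q z + p z * q').
Proof.
move=> [[N1 [sp sp']] dp] [[N2 [sq sq']] dq]; split.
  have h (u v : {poly R}) : (size u <= N1)%N -> (size v <= N2)%N ->
      (size (u * v)%R <= N1 + N2)%N.
    move=> su sv; rewrite (leq_trans (size_polyMleq _ _))// (leq_trans (leq_pred _))//.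
    by rewrite leq_add.
  exists (N1 + N2)%N; split=> [w|]; first exact: h.
  by rewrite (leq_trans (size_polyD _ _))// geq_max !h.
move=> i; rewrite coefD !coefM -big_split/=.
under eq_fun do rewrite coefM.
by apply: is_derive_sum_ord => j; exact: is_derive_mul.
Qed.

Lemma is_derive_coefs_horner z p (p' : {poly R}) x : is_derive_coefs z p p' ->
  is_derive z (1 : R) (fun w => (p w).[x]) p'.[x].
Proof.
move=> [[N [sp sp']] dp]; rewrite (horner_coef_wide x sp').
have -> : (fun w => (p w).[x]) = (fun w => \sum_(i < N) (p w)`_i * x ^+ i).
  by apply/funext => w; exact: horner_coef_wide.
apply: is_derive_sum_ord => i.
apply: (is_derive_eq (is_derive_mul (dp i) (is_derive_cst (x ^+ i) z (1:R)))).
by rewrite mulr0 addr0.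
Qed.

(** The weight exp(- z x) / K_1(z) has logarithmic derivative mu_2 - x in z,
    where mu_2 is its second moment. *)
Lemma is_derive_juttner z p (p' : {poly R}) : 0 < z -> is_derive_coefs z p p' ->
  is_derive z (1 : R) (fun w => juttner w (p w))
    (juttner z p' + juttner z ((juttner z 'X^2 *: 1 - 'X) * p z)).
Proof.
move=> z0 [[N [sp sp']] dp].
pose m (k : nat) (w : R) := cosh_moment k w / cosh_moment 1 w.
have K0 : cosh_moment 1 z != 0 by rewrite gt_eqF// cosh_moment_gt0.
have dm k : is_derive z (1:R) (m k) (m 2 z * m k z - m k.+1 z).
  have dV : is_derive z (1:R) (fun w => (cosh_moment 1 w)^-1) (- (cosh_moment 1 z) ^- 2 *: - cosh_moment 2 z).
    exact: (is_deriveV K0 (is_derive_cosh_moment 1 z0)).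
  apply: (is_derive_eq (is_derive_mul (is_derive_cosh_moment k z0) dV)).
  by rewrite /m /GRing.scale/=; field.
have jE w (q : {poly R}) : (size q <= N)%N -> juttner w q = \sum_(i < N) q`_i * m i w.
  exact: functional_of_moments_wide.
have mu2 : juttner z 'X^2 = m 2 z by exact: functional_of_momentsXn.
have jX (q : {poly R}) : (size q <= N)%N -> juttner z ('X * q) = \sum_(i < N) q`_i * m i.+1 z.
  move=> sq.
  have sXq : (size ('X * q)%R <= N.+1)%N.
    by rewrite mulrC (leq_trans (size_polyMleq _ _))// size_polyX addn2/= ltnS.
  rewrite /juttner (functional_of_moments_wide _ sXq) big_ord_recl coefXM eqxx mul0r add0r.
  by apply: eq_bigr => i _; rewrite coefXM.
have -> : (fun w => juttner w (p w)) = (fun w => \sum_(i < N) (p w)`_i * m i w).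
  by apply/funext => w; exact: jE.
rewrite mulrBl linearB -scalerAl mul1r linearZ/= mu2 jX// (jE _ _ sp') (jE _ _ (sp z)).
rewrite mulr_sumr -sumrB -big_split/=.
apply: is_derive_sum_ord => i.
apply: (is_derive_eq (is_derive_mul (dp i) (dm i))).
by rewrite /=; ring.
Qed.

End PolynomialFamilies.

Section OpolyDerivative.
Variable R : realType.
Implicit Types (z : R).

(** Gram-Schmidt holds for every orthonormal family. *)
Lemma orthonormal_recursion (L : {scalar {poly R}}) P n : orthonormal_for L P ->
  let r := 'X^n - \sum_(k < n) L ('X^n * P k) *: P k in
  P n = (Num.sqrt (L (r * r)))^-1 *: r /\ 0 < L (r * r).
Proof.
move=> oP r; have [sP cP LP] := oP.
have c0 := cP n.
have rE : r = (lead_coef (P n))^-1 *: P n.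
  have sz : (size ('X^n - (lead_coef (P n))^-1 *: P n)%R <= n)%N.
    apply: size_sub_leading; rewrite ?size_polyXn ?sP// coefXn eqxx.
    by rewrite lead_coefE sP mulVf// gt_eqF// (orthonormal_coef_gt0 _ oP).
  apply/eqP; rewrite /r subr_eq addrC -subr_eq; apply/eqP.
  rewrite (orthonormal_expansion oP sz); apply: eq_bigr => k _.
  by rewrite mulrBl linearB -scalerAl linearZ/= LP gtn_eqF// mulr0 subr0.
have LrrE : L (r * r) = (lead_coef (P n))^-1 ^+ 2.
  by rewrite rE -scalerAl -scalerAr !linearZ/= LP eqxx mulr1.
split; last by rewrite LrrE exprn_gt0// invr_gt0.
by rewrite LrrE sqrtr_sqr ger0_norm ?invr_ge0 ?ltW// invrK rE scalerA divff ?scale1r// gt_eqF.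
Qed.

(** Holds for every z, because the family is 0 where no orthonormal family exists. *)
Lemma size_opoly_le l z n : (size (opoly l z n) <= n.+1)%N.
Proof.
rewrite /opoly; case: xgetP => [P -> [sP _ _]|_]; first by rewrite sP.
by rewrite size_poly0.
Qed.

(** Induction on n through the Gram-Schmidt recursion, where the square root is taken of
    a positive number. *)
Lemma is_derive_opoly l n z : 0 < z -> exists p', is_derive_coefs z (opoly l ^~ n) p'.
Proof.
move=> z0; elim/ltn_ind: n => n IH.
have [dP dPE] : exists dP : 'I_n -> {poly R}, forall k : 'I_n,
    is_derive_coefs z (opoly l ^~ k) (dP k).
  have H (k : 'I_n) := cid (IH k (ltn_ord k)).
  by exists (fun k => sval (H k)) => k; exact: (svalP (H k)).
pose W : {poly R} := ('X^2 - 1) ^+ l.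
pose r (w : R) : {poly R} := 'X^n - \sum_(k < n) juttner_level l w ('X^n * opoly l w k) *: opoly l w k.
have dLevel p p' : is_derive_coefs z p p' -> exists d,
    is_derive z (1 : R) (fun w => juttner_level l w (p w)) d.
  move=> dp; have dWp := is_derive_coefsM (is_derive_coefs_cst z W) dp.
  by eexists; exact: is_derive_juttner z0 dWp.
have [r' dr] : exists r', is_derive_coefs z r r'.
  have H (k : 'I_n) := cid (dLevel _ _ (is_derive_coefsM (is_derive_coefs_cst z 'X^n) (dPE k))).
  eexists; apply: is_derive_coefsD; first exact: is_derive_coefs_cst.
  apply: is_derive_coefsN; apply: is_derive_coefs_sum => k.
  exact: is_derive_coefsZ (svalP (H k)) (dPE k).
have [d dLrr] := dLevel _ _ (is_derive_coefsM dr dr).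
have rec w : 0 < w -> opoly l w n = (Num.sqrt (juttner_level l w (r w * r w)))^-1 *: r w.
  by move=> w0; have [] := orthonormal_recursion n (opoly_orthonormal_level l w0).
have [_ Lrr0] := orthonormal_recursion n (opoly_orthonormal_level l z0).
rewrite -/(r z) in Lrr0.
have ds : is_derive z (1:R) (fun w => Num.sqrt (juttner_level l w (r w * r w))) _ :=
  is_derive1_comp (is_derive1_sqrt Lrr0) dLrr.
have s0 : Num.sqrt (juttner_level l z (r z * r z)) != 0 by rewrite gt_eqF// sqrtr_gt0.
have dc := @is_deriveV _ (fun w => Num.sqrt (juttner_level l w (r w * r w))) _ _ _ s0 ds.
have dprod := is_derive_coefsZ dc dr.
eexists; split.
  have [[N [_ sp']] _] := dprod.
  exists (maxn N n.+1); split=> [w|]; first by rewrite leq_max size_opoly_le orbT.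
  exact: leq_trans sp' (leq_maxl _ _).
move=> i; have [_ di] := dprod.
apply: near_eq_is_derive (di i).
by apply: near_gt0 => // w w0; rewrite rec.
Qed.

End OpolyDerivative.

(** * The ansatz as two polynomials in the energy *)

Section CoefficientPolynomials.
Variables (R : realType) (M : nat).
Implicit Types (W c : 'cV[R]_(M.+1 + M)) (z : R).

Lemma sum_interleaved (V : nmodType) (F : nat * nat -> V) (N : nat) :
  \sum_(k < N.+1 + N) F (interleaved k) =
  \sum_(n < N.+1) F (0%N, n : nat) + \sum_(n < N) F (1%N, n : nat).
Proof.
rewrite -(big_mkord xpredT (fun k => F (interleaved k))).
elim: N => [|N IH]; first by rewrite big_nat1 big_ord1 big_ord0 addr0.
rewrite addSn addnS 2?big_nat_recr//= IH.
rewrite [in RHS]big_ord_recr [X in _ = _ + X]big_ord_recr/= addrACA -!addrA.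
congr (_ + (_ + _)); rewrite /interleaved addSn addnn/= odd_double/=.
by rewrite uphalf_double doubleK.
Qed.

Lemma interleaved_surj l n : (l < 2)%N -> (n < if l == 0%N then M.+1 else M)%N ->
  exists k : 'I_(M.+1 + M), interleaved k = (l, n).
Proof.
case: l => [|[|//]] _ /= nM.
  case: n nM => [|n] nM; first by exists (Ordinal (isT : 0 < M.+1 + M)%N).
  have kM : (n.*2.+1 < M.+1 + M)%N by rewrite addSn addnn ltnS ltn_double.
  exists (Ordinal kM); rewrite /interleaved /= odd_double/=.
  by rewrite uphalf_double.
have kM : (n.*2.+2 < M.+1 + M)%N by rewrite addSn addnn ltnS -doubleS leq_double.
exists (Ordinal kM); rewrite /interleaved /= odd_double/=.
by rewrite doubleK.
Qed.

Lemma interleaved_bound k : (k < M.+1 + M)%N ->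
  ((interleaved k).1 < 2)%N /\
  ((interleaved k).2 < if (interleaved k).1 == 0%N then M.+1 else M)%N.
Proof.
rewrite addSn addnn ltnS /interleaved; have kE := odd_double_half k.
case: eqP => [//|/eqP k0]; case: ifP kE => /= [_ kE|_ kE] kM.
  by split=> //; rewrite ltnS -ltn_double (leq_trans _ kM)// -[leqRHS]kE.
split=> //; rewrite -ltn_double (leq_trans _ kM)//.
by move: k0; rewrite -[leqRHS]kE -{1}kE add0n; case: (k./2) => [|m]//= _; rewrite doubleS.
Qed.

Lemma Wcomp_linear k a W W' : Wcomp (a *: W + W') k = a * Wcomp W k + Wcomp W' k.
Proof.
rewrite /Wcomp; case: insubP => [i _ _|_] /=; last by rewrite mulr0 addr0.
by rewrite !mxE.
Qed.

Lemma Wcomp_delta (j : 'I_(M.+1 + M)) k : Wcomp (delta_mx j ord0 : 'cV[R]_(M.+1 + M)) k = (k == j)%:R.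
Proof.
rewrite /Wcomp; case: insubP => [i _ <-|] /=.
  by rewrite mxE eqxx andbT.
by move=> kM; case: eqP => // kj; move: kM; rewrite kj ltn_ord.
Qed.

Lemma Wcomp_ord W (j : 'I_(M.+1 + M)) : Wcomp W j = W j ord0.
Proof. by rewrite /Wcomp valK. Qed.

Definition level_size l := if l == 0%N then M.+1 else M.

(** Vieta turns the products of zeros in the coefficients of the ansatz into values at 0,
    so that the terms in Pi and n~^1 are reproducing kernels at 0. In the interleaved
    numbering P~_n^(0) and P~_n^(1) have the indices 2n - 1 and 2n + 2. *)
Definition level_coef l z W n : R :=
  if l == 0%N then
    (n == 0%N)%:R / lc 0 z 0 * rho_of W - (n <= 2)%:R * (opoly 0 z n).[0] * Pi_of W
    + (2 < n)%:R * Wcomp W n.*2.-1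
  else
    - (n <= 1)%:R * (opoly 1 z n).[0] * n1_of W + (1 < n)%:R * Wcomp W n.+1.*2.

Definition coef_poly l z W : {poly R} :=
  \sum_(n < level_size l) level_coef l z W n *: opoly l z n.

Lemma level_coef_linear l z n a W W' :
  level_coef l z (a *: W + W') n = a * level_coef l z W n + level_coef l z W' n.
Proof.
rewrite /level_coef /rho_of /Pi_of /n1_of !Wcomp_linear.
by case: (l == 0%N) => /=; ring.
Qed.

Lemma coef_poly_is_linear l z : linear (coef_poly l z).
Proof.
move=> a W W'; rewrite /coef_poly scaler_sumr -big_split/=; apply: eq_bigr => n _.
by rewrite level_coef_linear scalerDl scalerA.
Qed.

HB.instance Definition _ l z := GRing.isLinear.Build R 'cV[R]_(M.+1 + M) {poly R} _
  (coef_poly l z) (coef_poly_is_linear l z).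

Lemma level_coef_interleaved z W k :
  level_coef (interleaved k.+4.+1).1 z W (interleaved k.+4.+1).2 = Wcomp W k.+4.+1.
Proof.
rewrite /level_coef.
have -> : interleaved k.+4.+1 = if odd k then (1%N, k./2.+2) else (0%N, k./2.+3).
  by rewrite /interleaved /= !negbK uphalf_half; case: odd.
have kE := odd_double_half k.
case: (boolP (odd k)) kE => ok /= kE.
  rewrite oppr0 !mul0r add0r mul1r; congr Wcomp.
  by rewrite -[in RHS]kE !doubleS.
rewrite !mul0r subr0 add0r mul1r; congr Wcomp.
by rewrite -[in RHS]kE !doubleS.
Qed.

Lemma fcoefE W k : 0 < theta_of W ->
  fcoef W k = level_coef (interleaved k).1 (zeta_of W) W (interleaved k).2.
Proof.
move=> th0; have z0 : 0 < zeta_of W by rewrite invr_gt0.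
have at0 l n := opoly_at0 z0 l n.
case: k => [|[|[|[|[|k]]]]]; last by rewrite level_coef_interleaved.
all: rewrite /fcoef /level_coef /= at0.
- by rewrite big_geq//; ring.
- by rewrite big_nat1; ring.
- by rewrite big_geq//; ring.
- by rewrite big_ltn// big_nat1; ring.
- by rewrite big_nat1; ring.
Qed.

Definition distribution (u theta : R) (A B : {poly R}) (p : R) : R :=
  gweight u theta p * (A.[energy u p] + B.[energy u p] * (pspace u p / U0 u)).

Lemma FdistE W p : 0 < theta_of W ->
  Fdist W p = distribution (u_of W) (theta_of W)
    (coef_poly 0 (zeta_of W) W) (coef_poly 1 (zeta_of W) W) p.
Proof.
move=> th0; rewrite /Fdist.
under eq_bigr do rewrite fcoefE// /Defs.basis.
rewrite (sum_interleaved (fun ln => Ptilde ln.1 ln.2 (u_of W) (theta_of W) p *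
  level_coef ln.1 (zeta_of W) W ln.2))/=.
rewrite /distribution /coef_poly !horner_sum mulrDr mulr_suml !mulr_sumr.
by congr (_ + _); apply: eq_bigr => n _; rewrite hornerZ /Ptilde/=; ring.
Qed.

Lemma basis_ipg u theta A B k : `|u| < 1 -> 0 < theta ->
  ipg u theta (distribution u theta A B) (Defs.basis k u theta) =
  juttner_level (interleaved k).1 theta^-1
    ((if (interleaved k).1 == 0%N then A else B) * opoly (interleaved k).1 theta^-1 (interleaved k).2).
Proof.
move=> u1 th0; apply: (ipg_juttner A B (opoly _ _ _) u1 th0).
by rewrite /interleaved; case: eqP => // _; case: odd.
Qed.

(** The part in Pi is a reproducing kernel at 0 and yields q(0), within the degrees that
    it spans; the higher coefficients of the ansatz do not see q. *)
Lemma coef_poly0_reproduce z W (q : {poly R}) : 0 < z -> (size q <= minn 3 M.+1)%N ->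
  juttner z (coef_poly 0 z W * q) = rho_of W * juttner z q - Pi_of W * q.[0].
Proof.
move=> z0; rewrite leq_min => /andP[s3 sM].
have o0 := opoly0_orthonormal z0.
have P00 : opoly 0 z 0 = (lc 0 z 0)%:P.
  have /size_poly1P[a a0 Pa] : size (opoly 0 z 0) == 1%N by rewrite size_opoly.
  by rewrite -lc_coef// Pa coefC eqxx.
have qE := orthonormal_expansion o0 sM.
have -> : q.[0] = \sum_(n < M.+1) (n <= 2)%:R * (opoly 0 z n).[0] * juttner z (q * opoly 0 z n).
  rewrite {1}qE horner_sum; apply: eq_bigr => n _; rewrite hornerZ.
  have [n2|n2] := leqP n 2; first by rewrite mul1r mulrC.
  by rewrite (orthonormal_low o0) ?mul0r ?mulr0// (leq_trans s3).
have -> : rho_of W * juttner z q =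
    \sum_(n < M.+1) (n == 0%N :> nat)%:R / lc 0 z 0 * rho_of W * juttner z (q * opoly 0 z n).
  rewrite big_ord_recl/= big1 => [|n _]; last by rewrite !mul0r.
  rewrite addr0 P00 mulrC [q * _]mulrC mul_polyC linearZ/=.
  by field; rewrite gt_eqF// lc_gt0.
rewrite [Pi_of W * _]mulr_sumr -sumrB /coef_poly /= mulr_suml linear_sum/=.
apply: eq_bigr => n _; rewrite -scalerAl linearZ/= [opoly 0 z n * q]mulrC /level_coef/=.
have [n2|n2] := leqP n 2; first by rewrite mul0r addr0; ring.
by rewrite (orthonormal_low o0) ?mulr0 ?subr0// (leq_trans s3).
Qed.

Lemma coef_poly1_reproduce z W (q : {poly R}) : 0 < z -> (size q <= minn 2 M)%N ->
  juttner_level 1 z (coef_poly 1 z W * q) = - n1_of W * q.[0].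
Proof.
move=> z0; rewrite leq_min => /andP[s2 sM].
have o1 := opoly_orthonormal_level 1 z0.
have qE := orthonormal_expansion o1 sM.
rewrite {2}qE horner_sum mulr_sumr /coef_poly mulr_suml linear_sum/=.
apply: eq_bigr => n _; rewrite hornerZ.
rewrite -scalerAl linearZ/= [opoly 1 z n * q]mulrC /level_coef/=.
have [n2|n2] := leqP n 1; first by rewrite mul0r addr0 mulr1n; ring.
by rewrite (orthonormal_low o1) ?mulr0 ?mul0r ?mulr0// (leq_trans s2).
Qed.

Lemma coef_poly_opoly l z W n : 0 < z -> (n < level_size l)%N ->
  juttner_level l z (coef_poly l z W * opoly l z n) = level_coef l z W n.
Proof.
move=> z0 nl; have [_ _ o] := opoly_orthonormal_level l z0.
rewrite /coef_poly mulr_suml linear_sum (bigD1 (Ordinal nl))//= big1 => [|k kn].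
  by rewrite -scalerAl linearZ/= o eqxx mulr1 addr0.
rewrite -scalerAl linearZ/= o (_ : (k == n :> nat) = false) ?mulr0//.
by apply/negbTE; exact: kn.
Qed.

Lemma is_derive_coef_poly l z W : 0 < z ->
  exists G' : {poly R}, is_derive_coefs z (fun w => coef_poly l w W) G'.
Proof.
move=> z0.
have dP (n : nat) := cid (is_derive_opoly l n z0).
have dP0 l' (n : nat) : exists d, is_derive z (1 : R) (fun w => (opoly l' w n).[0]) d.
  by eexists; exact: is_derive_coefs_horner (svalP (cid (is_derive_opoly l' n z0))).
have dcoef (n : nat) : exists d, is_derive z (1 : R) (fun w => level_coef l w W n) d.
  have [d0 hd0] := dP0 0%N n; have [d1 hd1] := dP0 1%N n.
  rewrite /level_coef; case: (l == 0%N).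
    have [[N _] dlc] := svalP (cid (is_derive_opoly 0 0 z0)).
    have lcE : (fun w => lc 0 w 0) = (fun w : R => (opoly 0 w 0)`_0).
      apply/funext => w; rewrite /lc lead_coefE; congr (_`_ _).
      by have := size_opoly_le 0 w 0; case: (size _) => [|[|]].
    have c0 : lc 0 z 0 != 0 by rewrite gt_eqF// lc_gt0.
    have dlc0 := dlc 0%N; rewrite -lcE in dlc0.
    have dV := @is_deriveV _ (fun w => lc 0 w 0) _ _ _ c0 dlc0.
    eexists; exact: (is_deriveD
      (is_deriveB
        (is_derive_mul (is_derive_mul (is_derive_cst _ _ _) dV) (is_derive_cst _ _ _))
        (is_derive_mul (is_derive_mul (is_derive_cst _ _ _) hd0) (is_derive_cst _ _ _)))
      (is_derive_cst _ _ _)).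
  eexists; exact: (is_deriveD
      (is_derive_mul (is_derive_mul (is_derive_cst _ _ _) hd1) (is_derive_cst _ _ _))
      (is_derive_cst _ _ _)).
have dc (n : nat) := cid (dcoef n).
eexists; apply: is_derive_coefs_sum => n.
exact: is_derive_coefsZ (svalP (dc n)) (svalP (dP n)).
Qed.

End CoefficientPolynomials.

(** * Velocity and temperature derivatives of the ansatz *)

Section DistributionDerivatives.
Variable R : realType.
Implicit Types (u v theta z p : R) (A B : {poly R}).

Lemma pspace_energy u p : `|u| < 1 -> (pspace u p / U0 u) ^+ 2 = energy u p ^+ 2 - 1.
Proof.
move=> u1; have -> : p = sinhR (rapidity u + (arsinh p - rapidity u)).
  by rewrite addrC subrK arsinhK.
by rewrite pspace_rapidity// energy_rapidity// sqrrN coshR2 addrAC subrr add0r.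
Qed.

Lemma is_derive_U0 u : `|u| < 1 -> is_derive u (1 : R) (@U0 R) (u * U0 u ^+ 3).
Proof.
move=> u1; have w0 := sqr_lt1 u1.
have d1 : is_derive u (1:R) (fun v : R => 1 - v ^+ 2) (- (2 * u)).
  by apply: is_derive_eq; rewrite /GRing.scale/=; ring.
have d2 := @is_derive1_comp _ (@Num.sqrt R) (fun v => 1 - v ^+ 2) _ _ _ (is_derive1_sqrt w0) d1.
have s0 : Num.sqrt (1 - u ^+ 2) != 0 by rewrite gt_eqF// sqrtr_gt0.
apply: (is_derive_eq (@is_deriveV _ (fun v => Num.sqrt (1 - v ^+ 2)) _ _ _ s0 d2)).
by rewrite /U0 /GRing.scale/=; field.
Qed.

Lemma is_derive_energy u p : `|u| < 1 ->
  is_derive u (1 : R) (fun v => energy v p) (U0 u ^+ 2 * (pspace u p / U0 u)).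
Proof.
move=> u1; have dU := is_derive_U0 u1; have U00 := U0_gt0 u1.
have w2 := U0_sqr u1; have u0 := sqr_lt1 u1.
have d1 := is_derive_mul dU (is_derive_cst (mom0 p) u (1:R)).
have d2 := is_derive_mul (is_derive_mul (is_derive_id u (1:R)) dU) (is_derive_cst p u (1:R)).
apply: (is_derive_eq (is_deriveB d1 d2)).
rewrite /pspace /energy /U1 /=.
have e : U0 u ^+ 2 * (1 - u ^+ 2) = 1 by rewrite w2 mulVf// gt_eqF.
apply: (mulIf (lt0r_neq0 u0)).
have e3 : U0 u ^+ 3 * (1 - u ^+ 2) = U0 u by rewrite exprSr mulrAC e mul1r.
have e4 : U0 u ^+ 2 = 1 + u ^+ 2 * U0 u ^+ 2.
  by rewrite -[X in X + _]e; ring.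
field: e e4.
by rewrite gt_eqF.
Qed.

Lemma is_derive_pspace u p : `|u| < 1 ->
  is_derive u (1 : R) (fun v => pspace v p / U0 v) (U0 u ^+ 2 * energy u p).
Proof.
move=> u1; have dU := is_derive_U0 u1; have U00 := U0_gt0 u1.
have dE := is_derive_energy p u1.
have w2 := U0_sqr u1; have u0 := sqr_lt1 u1.
have e : U0 u ^+ 2 * (1 - u ^+ 2) = 1 by rewrite w2 mulVf// gt_eqF.
have d1 := is_derive_mul (is_derive_mul (is_derive_id u (1:R)) dU) dE.
have d2 := is_deriveD (is_derive_cst (- p) u (1:R)) d1.
have dV := @is_deriveV _ (@U0 R) _ _ _ (lt0r_neq0 U00) dU.
apply: (is_derive_eq (is_derive_mul d2 dV)).
rewrite !fctE /GRing.scale/=; set E := energy u p.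
have -> : - p + u * U0 u * E = pspace u p by [].
set s := pspace u p.
have e4 : u ^+ 2 * U0 u ^+ 2 = U0 u ^+ 2 - 1 by rewrite -e; ring.
field: e4.
by rewrite gt_eqF.
Qed.

(** The velocity derivative in the comoving variables: the rapidity derivatives of
    the energy and of the space component are each other. *)
Lemma is_derive_distribution_u u theta A B p : `|u| < 1 ->
  let z := theta^-1 in
  is_derive u (1 : R) (fun v => distribution v theta A B p)
    (distribution u theta
      (U0 u ^+ 2 *: (('X^2 - 1) * (B^`() - z *: B) + 'X * B))
      (U0 u ^+ 2 *: (A^`() - z *: A)) p).
Proof.
move=> u1 z; have dE := is_derive_energy p u1; have ds := is_derive_pspace p u1.
have dH (Q : {poly R}) : is_derive u (1:R) (fun v => Q.[energy v p])
    (Q^`().[energy u p] * (U0 u ^+ 2 * (pspace u p / U0 u))).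
  exact: (@is_derive1_comp _ (horner Q) (fun v => energy v p) _ _ _ (is_derive_poly _ _) dE).
have dzE := is_derive_mul (is_derive_cst (- z) u (1:R)) dE.
have dexp := @is_derive1_comp _ (@expR R) (fun v => - z * energy v p) _ _ _ (is_derive_expR _) dzE.
have dg := is_derive_mul (is_derive_cst ((2 * besselK 1 z)^-1) u (1:R)) dexp.
have dF := is_derive_mul dg (is_deriveD (dH A) (is_derive_mul (dH B) ds)).
apply: (is_derive_eq dF).
rewrite !fctE /distribution /gweight -/z /GRing.scale/=.
rewrite !(hornerM, hornerD, hornerN, hornerX, hornerC, hornerZ) -(expr2 (energy u p)).
have := pspace_energy p u1; set s := pspace u p / U0 u => sE.
by ring: sE.
Qed.

Lemma is_derive_distribution_zeta u z (A B : R -> {poly R}) (A' B' : {poly R}) p :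
  0 < z -> is_derive_coefs z A A' -> is_derive_coefs z B B' ->
  let mu2 := juttner z 'X^2 in
  is_derive z (1 : R) (fun w => distribution u w^-1 (A w) (B w) p)
    (distribution u z^-1 (A' + (mu2 *: 1 - 'X) * A z) (B' + (mu2 *: 1 - 'X) * B z) p).
Proof.
move=> z0 dA dB mu2.
have K0 := cosh_moment_gt0 1 z0.
have dK := is_derive_mul (is_derive_cst (2 : R) z (1:R)) (is_derive_cosh_moment 1 z0).
have K20 : 2 * cosh_moment 1 z != 0 by rewrite gt_eqF// mulr_gt0.
have dV := @is_deriveV _ (fun w => 2 * cosh_moment 1 w) _ _ _ K20 dK.
set E := energy u p.
have dzE := is_derive_mul (is_deriveNid z (1:R)) (is_derive_cst E z (1:R)).
have dexp := @is_derive1_comp _ (@expR R) (fun w => - w * E) _ _ _ (is_derive_expR _) dzE.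
have dg := is_derive_mul dV dexp.
have hA := is_derive_coefs_horner E dA; have hB := is_derive_coefs_horner E dB.
have dF := is_derive_mul dg (is_deriveD hA (is_derive_mul hB (is_derive_cst (pspace u p / U0 u) z (1:R)))).
have -> : (fun w => distribution u w^-1 (A w) (B w) p) =
  (fun w => (2 * cosh_moment 1 w)^-1 * expR (- w * E) *
    ((A w).[E] + (B w).[E] * (pspace u p / U0 u))).
  by apply/funext => w; rewrite /distribution /gweight invrK besselK1E.
apply: (is_derive_eq dF).
rewrite /distribution /gweight invrK besselK1E -/E.
rewrite !(hornerM, hornerD, hornerN, hornerX, hornerC, hornerZ).
have -> : mu2 = cosh_moment 2 z / cosh_moment 1 z by exact: functional_of_momentsXn.
rewrite !fctE /GRing.scale/=; set s := pspace u p / U0 u.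
set K1 := cosh_moment 1 z in K0 *; set K2 := cosh_moment 2 z.
set e := expR _; set a := (A z).[E]; set b := (B z).[E]; set a' := A'.[E]; set b' := B'.[E].
rewrite !(mul0r, mulr0, add0r, addr0).
have K10 : K1 != 0 by rewrite gt_eqF.
clearbody K1 K2 e a b a' b' s E.
by field.
Qed.

End DistributionDerivatives.

(** * The matrix of the change of unknowns *)

Section ChangeOfUnknowns.
Variables (R : realType) (M : nat) (W : 'cV[R]_(M.+1 + M)).
Hypothesis hW : admissible W.
Let u := u_of W.
Let theta := theta_of W.
Let z := zeta_of W.

Let u1 : `|u| < 1. Proof. by case: hW. Qed.
Let th0 : 0 < theta. Proof. by case: hW. Qed.
Let z0 : 0 < z. Proof. by rewrite invr_gt0. Qed.

Let C (l : nat) := coef_poly l z W.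

(** The factor U0^2 is the derivative of the rapidity with respect to u. *)
Definition velocity_direction (l : nat) : {poly R} :=
  U0 u ^+ 2 *: (if l == 0%N then ('X^2 - 1) * ((C 1)^`() - z *: C 1) + 'X * C 1
                else (C 0)^`() - z *: C 0).

Let C' (l : nat) : {poly R} := sval (cid (is_derive_coef_poly l W z0)).

Let dC l : is_derive_coefs z (fun w => coef_poly l w W) (C' l).
Proof. exact: (svalP (cid (is_derive_coef_poly l W z0))). Qed.

(** The factor - z^2 is the derivative of z = 1 / theta with respect to theta. *)
Definition temperature_direction l : {poly R} :=
  - z ^+ 2 *: (C' l + (juttner z 'X^2 *: 1 - 'X) * C l).

(** The derivative of the coefficients is only known to exist; all of its use is through
    its defining property. *)
Lemma temperature_directionE l : exists D : {poly R},
  is_derive_coefs z (fun w => coef_poly l w W) D /\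
  temperature_direction l = - z ^+ 2 *: (D + (juttner z 'X^2 *: 1 - 'X) * C l).
Proof. by exists (C' l); split=> //; exact: dC. Qed.

Definition direction (j : 'I_(M.+1 + M)) (l : nat) : {poly R} :=
  coef_poly l z (delta_mx j ord0) + (j == 1%N :> nat)%:R *: velocity_direction l
  + (j == 2%N :> nat)%:R *: temperature_direction l.

Lemma Wcomp_line j t k :
  Wcomp (W + t *: delta_mx j ord0) k = Wcomp W k + t * (k == j)%:R.
Proof. by rewrite addrC Wcomp_linear Wcomp_delta addrC. Qed.

Lemma level_coef_congr (l : nat) (w : R) (V V' : 'cV[R]_(M.+1 + M)) n :
  (forall k, k != 1%N -> k != 2%N -> Wcomp V k = Wcomp V' k) ->
  level_coef l w V n = level_coef l w V' n.
Proof.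
move=> e; rewrite /level_coef /rho_of /Pi_of /n1_of !(e 0%N, e 3%N, e 4%N)//.
by case: ifP => _; case: n => [|[|[|n]]] /=; rewrite ?mul0r// doubleS e.
Qed.

Lemma coef_poly_congr (l : nat) (w : R) (V V' : 'cV[R]_(M.+1 + M)) :
  (forall k, k != 1%N -> k != 2%N -> Wcomp V k = Wcomp V' k) ->
  coef_poly l w V = coef_poly l w V'.
Proof. by move=> e; apply: eq_bigr => n _; rewrite (level_coef_congr _ _ _ e). Qed.

Lemma coef_poly_delta12 (l : nat) (w : R) (j : 'I_(M.+1 + M)) : (j == 1%N :> nat) || (j == 2%N :> nat) ->
  coef_poly l w (delta_mx j ord0) = 0.
Proof.
move=> j12; rewrite (@coef_poly_congr l w _ (0 : 'cV[R]_(M.+1 + M))) ?linear0// => k k1 k2.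
rewrite Wcomp_delta (_ : (k == j) = false).
  by rewrite -[0 in RHS](scale0r (0 : 'cV[R]_(M.+1 + M))) -[_ *: _]addr0 Wcomp_linear mul0r add0r /Wcomp; case: insub => //= i; rewrite mxE.
by apply/negbTE; case/orP: j12 => /eqP ->.
Qed.

Lemma dFdistE j p : dFdist W j p =
  distribution u theta (direction j 0) (direction j 1) p.
Proof.
rewrite /dFdist derive1E.
pose V t := W + t *: delta_mx j ord0.
have uV t : u_of (V t) = u + t * (1%N == j)%:R by exact: Wcomp_line.
have thV t : theta_of (V t) = theta + t * (2%N == j)%:R by exact: Wcomp_line.
suff H : is_derive (0 : R) (1 : R) (fun t => Fdist (V t) p)
    (distribution u theta (direction j 0) (direction j 1) p).
  by rewrite derive_val.
rewrite /direction.
have [j1|j1] := eqVneq (j : nat) 1%N.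
  have j2 : (j == 2%N :> nat) = false by rewrite j1.
  rewrite !coef_poly_delta12 ?j1// !scale1r !scale0r !add0r !addr0.
  have cV l w t : coef_poly l w (V t) = coef_poly l w W.
    apply: coef_poly_congr => k k1 _.
    by rewrite Wcomp_line j1 (negPf k1) mulr0 addr0.
  have -> : (fun t => Fdist (V t) p) = (fun t => distribution (u + t) theta (C 0) (C 1) p).
    apply/funext => t; have tht : theta_of (V t) = theta by rewrite thV j1 mulr0 addr0.
    by rewrite FdistE /zeta_of tht// !cV uV j1 eqxx mulr1.
  have dsh : is_derive (0:R) (1:R) (fun t => u + t) 1.
    exact: (is_derive_eq (is_deriveD (is_derive_cst u (0:R) (1:R)) (is_derive_id (0:R) (1:R))) (add0r _)).
  have du := is_derive_distribution_u theta (C 0) (C 1) p u1.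
  rewrite -[u in is_derive u](addr0 u) in du.
  apply: (is_derive_eq (@is_derive1_comp _ (fun v => distribution v theta (C 0) (C 1) p)
    (fun t => u + t) _ _ _ du dsh)).
  by rewrite mulr1.
have [j2|j2] := eqVneq (j : nat) 2%N.
  rewrite !coef_poly_delta12 ?j2// !scale1r !scale0r !add0r.
  have cV l w t : coef_poly l w (V t) = coef_poly l w W.
    apply: coef_poly_congr => k _ k2.
    by rewrite Wcomp_line j2 (negPf k2) mulr0 addr0.
  pose H w := distribution u w^-1 (coef_poly 0 w W) (coef_poly 1 w W) p.
  have near0 : \forall t \near (0 : R), H (theta + t)^-1 = Fdist (V t) p.
    near=> t.
    have tht : theta_of (V t) = theta + t by rewrite thV j2 eqxx mulr1.
    have ut : u_of (V t) = u by rewrite uV j2 mulr0 addr0.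
    rewrite FdistE /zeta_of tht ?ut ?cV /H ?invrK//.
    have : - theta < t by near: t; apply: lt_nbhsr; rewrite oppr_lt0.
    by move=> ?; lra.
  apply: near_eq_is_derive near0 _.
  have dsh : is_derive (0:R) (1:R) (fun t => theta + t) 1.
    exact: (is_derive_eq (is_deriveD (is_derive_cst theta (0:R) (1:R)) (is_derive_id (0:R) (1:R))) (add0r _)).
  have thn0 : theta + 0 != 0 by rewrite addr0 gt_eqF.
  have dinv := @is_deriveV _ (fun t => theta + t) _ _ _ thn0 dsh.
  have dz := is_derive_distribution_zeta u p z0 (dC 0) (dC 1).
  have zE : z = (theta + 0)^-1 by rewrite addr0.
  rewrite [X in is_derive X]zE in dz.
  apply: (is_derive_eq (@is_derive1_comp _ H (fun t => (theta + t)^-1) _ _ _ dz dinv)).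
  rewrite addr0 /distribution /temperature_direction -/(C 0) -/(C 1) /z /zeta_of invrK -/theta.
  rewrite !hornerZ /GRing.scale/= -exprVn; ring.
rewrite !scale0r !addr0.
have -> : (fun t => Fdist (V t) p) = (fun t => Fdist W p +
    t * distribution u theta (coef_poly 0 z (delta_mx j ord0)) (coef_poly 1 z (delta_mx j ord0)) p).
  apply/funext => t.
  have ut : u_of (V t) = u by rewrite uV eq_sym (negPf j1) mulr0 addr0.
  have tht : theta_of (V t) = theta by rewrite thV eq_sym (negPf j2) mulr0 addr0.
  rewrite !FdistE ?tht// /zeta_of ut tht /V addrC !linearP/= /distribution.
  by rewrite !hornerD !hornerZ -/theta -/u -/(zeta_of W) -/z; ring.
apply: (is_derive_eq (is_deriveD (is_derive_cst (Fdist W p) (0:R) (1:R))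
  (is_derive_mul (is_derive_id (0:R) (1:R)) (is_derive_cst _ (0:R) (1:R))))).
by rewrite add0r mul1r [_ * 0]mulr0 addr0.
Unshelve. all: by end_near. Qed.

Lemma DmatE k j : Dmat W k j =
  juttner_level (interleaved k).1 z
    (direction j (interleaved k).1 * opoly (interleaved k).1 z (interleaved k).2).
Proof.
rewrite mxE -/u -/theta.
rewrite (_ : dFdist W j = distribution u theta (direction j 0) (direction j 1)); last first.
  by apply/funext => p; exact: dFdistE.
rewrite basis_ipg//; congr (juttner_level _ _ (_ * _)).
have [->|->]// : (interleaved k).1 = 0%N \/ (interleaved k).1 = 1%N.
by rewrite /interleaved; case: eqP => _; [left|case: odd; [left|right]].
Qed.

End ChangeOfUnknowns.

(** * Invertibility of the change of unknowns *)

Section Moments.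
Variables (R : realType) (z : R).
Hypothesis z0 : 0 < z.

Lemma juttnerX2 : juttner z 'X^2 = juttner z 1 + z^-1.
Proof.
have := juttner_integration_by_parts 1 z0.
rewrite -[X in X^`()]/(1%:P) derivC sub0r mulr1 -scaleNr -scalerAr mulr1 linearD/= linearZ/=.
rewrite linearB/= juttnerX// => h.
by apply: (mulfI (lt0r_neq0 z0)); rewrite mulrDr mulfV ?gt_eqF//; lra.
Qed.

(** Strict Cauchy-Schwarz, here and in the next lemma. *)
Lemma moment01_gt0 : 0 < juttner z 1 * juttner z 'X^2 - 1.
Proof.
have m0 : 0 < juttner z 1.
  apply: juttner_gt0 => //; first exact: oner_neq0.
  by move=> x _; rewrite hornerC.
pose r := (juttner z 1)^-1.
have := positive_functional_sqr (juttner_positive z0) (negbT (polyXsubC_eq0 r)).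
rewrite (_ : _ * _ = 'X^2 - (r + r) *: 'X + (r * r) *: 1); last first.
  by rewrite -!mul_polyC mulr1 polyCD polyCM; ring.
rewrite linearD linearB !linearZ/= juttnerX// -mulrA mulVf ?gt_eqF// /GRing.scale/= => h.
have : 0 < juttner z 'X^2 - r by lra.
by rewrite -(pmulr_rgt0 _ m0) mulrBr mulfV// gt_eqF.
Qed.

Lemma moment12_gt0 : 0 < juttner z 'X^3 - juttner z 'X^2 ^+ 2.
Proof.
pose r := juttner z 'X^2.
pose p : {poly R} := 'X * ('X - r%:P) ^+ 2.
have pE : p = 'X^3 - (r + r) *: 'X^2 + (r * r) *: 'X.
  by rewrite /p -!mul_polyC polyCD polyCM; ring.
have p0 : p != 0 by rewrite mulf_neq0 ?expf_neq0 ?polyX_eq0 ?polyXsubC_eq0.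
have : 0 < juttner z p.
  apply: juttner_gt0 => // x x1.
  by rewrite /p hornerM hornerX horner_exp mulr_ge0 ?sqr_ge0// (le_trans ler01).
rewrite pE linearD linearB !linearZ/= juttnerX// -/r /GRing.scale/=; lra.
Qed.

End Moments.

Section Invertibility.
Variables (R : realType) (M : nat) (W : 'cV[R]_(M.+1 + M)).
Hypothesis hM : (1 <= M)%N.
Hypothesis hW : admissible W.
Let u := u_of W.
Let theta := theta_of W.
Let z := zeta_of W.

Let u1 : `|u| < 1. Proof. by case: hW. Qed.
Let th0 : 0 < theta. Proof. by case: hW. Qed.
Let z0 : 0 < z. Proof. by rewrite invr_gt0. Qed.
Let C (l : nat) := coef_poly l z W.

Lemma size_deriv_le n (q : {poly R}) : (size q <= n.+1)%N -> (size q^`() <= n)%N.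
Proof.
move=> sq; have [->|q0] := eqVneq q 0; first by rewrite deriv0 size_poly0.
by rewrite -ltnS; exact: leq_trans (lt_size_deriv q0) sq.
Qed.

(** Integration by parts moves the derivative from the coefficient polynomial to q. *)
Lemma velocity_direction0_test (q : {poly R}) : (size q <= minn 3 M.+1)%N ->
  juttner z (velocity_direction W 0 * q) = U0 u ^+ 2 * (n1_of W * q^`().[0]).
Proof.
move=> sq; rewrite /velocity_direction/= -scalerAl linearZ/=; congr (_ * _).
rewrite -/z -/(C 1).
rewrite (_ : (_ + _) * q = (('X^2 - 1) * ((C 1 * q)^`() - z *: (C 1 * q)) + 'X * (C 1 * q))
   - ('X^2 - 1) * (C 1 * q^`())); last first.
  by rewrite derivM -!mul_polyC; ring.
rewrite linearB/= juttner_integration_by_parts// sub0r.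
rewrite -juttner_level1 coef_poly1_reproduce//; first by rewrite mulNr opprK.
by move: sq; rewrite !leq_min => /andP[s3 sM]; rewrite !size_deriv_le.
Qed.

Lemma velocity_direction1_test (q : {poly R}) : (size q <= minn 2 M)%N ->
  let h := ('X^2 - 1) * q^`() + 'X * q in
  juttner_level 1 z (velocity_direction W 1 * q) =
  - (U0 u ^+ 2 * (rho_of W * juttner z h - Pi_of W * h.[0])).
Proof.
move=> sq h; rewrite /velocity_direction/= -scalerAl linearZ/= -mulrN; congr (_ * _).
rewrite -/z -/(C 0) juttner_level1.
rewrite (_ : ('X^2 - 1) * (_ * q) =
   (('X^2 - 1) * ((C 0 * q)^`() - z *: (C 0 * q)) + 'X * (C 0 * q)) - C 0 * h); last first.
  by rewrite derivM -!mul_polyC /h; ring.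
rewrite linearB/= juttner_integration_by_parts// sub0r coef_poly0_reproduce//.
move: sq; rewrite !leq_min => /andP[s2 sM].
have sh n : (size q <= n)%N -> (size h <= n.+1)%N.
  move=> sqn; have [qE|q0] := eqVneq q 0.
    by rewrite /h qE !(deriv0, mulr0) addr0 size_poly0.
  have s0 : (0 < size q)%N by rewrite size_poly_gt0.
  rewrite (leq_trans (size_polyD _ _))// geq_max; apply/andP; split.
    rewrite (leq_trans (size_polyMleq _ _))// size_XnsubC// !addSn add0n /= ltnS.
    exact: leq_trans (lt_size_deriv q0) sqn.
  rewrite (leq_trans (size_polyMleq _ _))// size_polyX/=.
  by rewrite ltnS.
by rewrite !sh.
Qed.

(** The derivative of the coefficients is unknown, but its mean against q is found by
    differentiating in z the reproduction formula. *)
Lemma temperature_direction0_test (q : {poly R}) : (size q <= minn 3 M.+1)%N ->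
  juttner z (temperature_direction hW 0 * q) =
  - z ^+ 2 * (rho_of W * juttner z ((juttner z 'X^2 *: 1 - 'X) * q)).
Proof.
move=> sq; have [D [dD ->]] := temperature_directionE hW 0.
rewrite -/z in dD *; rewrite -/(C 0) -scalerAl linearZ/=; congr (_ * _).
have dDq := is_derive_coefsM dD (is_derive_coefs_cst z q).
have d1 := is_derive_juttner z0 dDq.
have d2 : is_derive z (1 : R) (fun w => juttner w (coef_poly 0 w W * q))
    (rho_of W * juttner z ((juttner z 'X^2 *: 1 - 'X) * q)).
  have dq := is_derive_juttner z0 (is_derive_coefs_cst z q).
  have d3 := is_deriveB (is_derive_mul (is_derive_cst (rho_of W) z (1 : R)) dq)
     (is_derive_cst (Pi_of W * q.[0]) z (1 : R)).
  have nE : \forall w \near z, rho_of W * juttner w q - Pi_of W * q.[0] =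
      juttner w (coef_poly 0 w W * q).
    by apply: near_gt0 => // w w0; rewrite coef_poly0_reproduce.
  apply: near_eq_is_derive nE _.
  by apply: (is_derive_eq d3); rewrite linear0 mul0r !add0r subr0.
rewrite -(derive_val (is_derive := d2)) (derive_val (is_derive := d1)).
by rewrite mulr0 addr0 -linearD; congr (juttner z _); ring.
Qed.

Lemma temperature_direction1_test (q : {poly R}) : (size q <= minn 2 M)%N ->
  juttner_level 1 z (temperature_direction hW 1 * q) = 0.
Proof.
move=> sq; have [D [dD ->]] := temperature_directionE hW 1.
rewrite -/z in dD *; rewrite -/(C 1) -scalerAl linearZ/=.
have dDq := is_derive_coefsM (is_derive_coefs_cst z ('X^2 - 1))
  (is_derive_coefsM dD (is_derive_coefs_cst z q)).
have d1 := is_derive_juttner z0 dDq.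
have d2 : is_derive z (1 : R) (fun w => juttner w (('X^2 - 1) * (coef_poly 1 w W * q))) 0.
  have nE : \forall w \near z, - n1_of W * q.[0] =
      juttner w (('X^2 - 1) * (coef_poly 1 w W * q)).
    by apply: near_gt0 => // w w0; rewrite -juttner_level1 coef_poly1_reproduce.
  exact: (near_eq_is_derive nE (is_derive_cst (- n1_of W * q.[0]) z (1 : R))).
rewrite juttner_level1 (_ : juttner z _ = 0) ?mulr0//.
rewrite -[RHS](derive_val (is_derive := d2)) (derive_val (is_derive := d1)).
rewrite mul0r add0r mulr0 addr0 -linearD; congr (juttner z _); ring.
Qed.

Lemma sum_Wcomp (c : 'cV[R]_(M.+1 + M)) k :
  \sum_j c j ord0 * (j == k :> nat)%:R = Wcomp c k.
Proof.
rewrite /Wcomp; case: insubP => [i _ ik|kM] /=.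
  rewrite (bigD1 i)//= ik eqxx mulr1 big1 ?addr0// => j ji.
  by rewrite -ik (negPf ji : (j == i :> nat) = false) mulr0.
rewrite big1// => j _; case: eqP => [jk|_]; last by rewrite mulr0.
by move: kM; rewrite -jk ltn_ord.
Qed.

(** A kernel vector makes two polynomials orthogonal to all tested degrees. Level 1 tested
    against X (against 1 if M = 1) gives the velocity component, whose coefficient is
    positive because of Pi > - rho theta; then level 0 tested against X gives the density
    and against X^2 (against 1 if M = 1) the temperature, by Cauchy-Schwarz. The constants
    give the two nonequilibrium moments, and the others are read off one by one. *)
Lemma Dmat_injective (c : 'cV[R]_(M.+1 + M)) : Dmat W *m c = 0 -> c = 0.
Proof.
move=> Dc.
pose S l := coef_poly l z c + Wcomp c 1 *: velocity_direction W l
  + Wcomp c 2 *: temperature_direction hW l.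
have SE l : S l = \sum_j c j ord0 *: direction hW j l.
  rewrite /direction /S.
  move: (velocity_direction W l) (temperature_direction hW l) => V T.
  under eq_bigr do rewrite !scalerDr !scalerA.
  rewrite !big_split/= -!scaler_suml !sum_Wcomp; congr (_ + _ + _).
  have {1}-> : c = \sum_j c j ord0 *: delta_mx j ord0.
    apply/colP => i; rewrite summxE (bigD1 i)//= big1 => [|j ji].
      by rewrite !mxE !eqxx mulr1 addr0.
    by rewrite !mxE eq_sym (negPf ji) mulr0.
  by rewrite linear_sum; apply: eq_bigr => j _; rewrite linearZ.
have base (i n : nat) : (i < 2)%N -> (n < if i == 0%N then M.+1 else M)%N ->
    juttner_level i z (S i * opoly i z n) = 0.
  move=> l2 nl; have [k kE] := interleaved_surj l2 nl.
  have := congr1 (fun A : 'cV[R]_(M.+1 + M) => A k ord0) Dc; rewrite !mxE => <-.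
  rewrite SE mulr_suml linear_sum; apply: eq_bigr => j _.
  by rewrite (DmatE hW) kE -scalerAl linearZ/= mulrC.
have test (i : nat) (q : {poly R}) : (i < 2)%N ->
    (size q <= if i == 0%N then M.+1 else M)%N -> juttner_level i z (S i * q) = 0.
  move=> l2 sq; rewrite (orthonormal_expansion (opoly_orthonormal_level i z0) sq).
  rewrite mulr_sumr linear_sum big1// => n _.
  by rewrite -scalerAr linearZ/= base ?mulr0.
have distr (A V T q : {poly R}) (a b : R) :
    (A + a *: V + b *: T) * q = A * q + a *: (V * q) + b *: (T * q).
  by rewrite !mulrDl -!scalerAl.
set m0 := juttner z 1; set m2 := juttner z 'X^2.
have E0 (q : {poly R}) : (size q <= minn 3 M.+1)%N ->
    Wcomp c 0 * juttner z q - Wcomp c 3 * q.[0]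
    + Wcomp c 1 * (U0 u ^+ 2 * (n1_of W * q^`().[0]))
    + Wcomp c 2 * (- z ^+ 2 * (rho_of W * juttner z ((m2 *: 1 - 'X) * q))) = 0.
  move=> sq; have := sq; rewrite leq_min => /andP[_ sM].
  rewrite -velocity_direction0_test// -temperature_direction0_test//.
  rewrite -(coef_poly0_reproduce c z0 sq) -!linearZ/= -!linearD/= -distr.
  by have := test 0%N q isT sM; rewrite juttner_level0.
have E1 (q : {poly R}) : (size q <= minn 2 M)%N ->
    let h := ('X^2 - 1) * q^`() + 'X * q in
    - Wcomp c 4 * q.[0] - Wcomp c 1 *
      (U0 u ^+ 2 * (rho_of W * juttner z h - Pi_of W * h.[0])) = 0.
  move=> sq h; have := sq; rewrite leq_min => /andP[_ sM].
  have decomp : juttner_level 1 z (S 1%N * q) =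
      juttner_level 1 z (coef_poly 1 z c * q)
      + Wcomp c 1 * juttner_level 1 z (velocity_direction W 1 * q)
      + Wcomp c 2 * juttner_level 1 z (temperature_direction hW 1 * q).
    by rewrite -!linearZ/= -!linearD/= -distr.
  rewrite -[RHS](test 1%N q isT sM) decomp coef_poly1_reproduce//.
  by rewrite velocity_direction1_test// temperature_direction1_test// mulr0 addr0 mulrN.
have [rho0 _ _ Pi0] := hW.
have w0 : U0 u ^+ 2 != 0 by rewrite expf_neq0// gt_eqF// U0_gt0.
have nz : - z ^+ 2 != 0 by rewrite oppr_eq0 expf_neq0// gt_eqF.
move: (U0 u ^+ 2) (- z ^+ 2) w0 nz E0 E1 => w v w0 nz E0 E1.
have m1 : juttner z 'X = 1 by exact: juttnerX.
have m2E : m2 = m0 + z^-1 by exact: juttnerX2.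
have m2gt0 : 0 < m2.
  apply: juttner_gt0 => //; first by rewrite -size_poly_gt0 size_polyXn.
  by move=> x _; rewrite hornerXn sqr_ge0.
have Wbeyond (V : 'cV[R]_(M.+1 + M)) k : (M.+1 + M <= k)%N -> Wcomp V k = 0.
  by move=> Mk; rewrite /Wcomp insubN// -leqNgt.
have c4 : Wcomp c 1 = 0 -> Wcomp c 4 = 0.
  move=> c1; have := E1 1; rewrite size_poly1 leq_min hM => /(_ isT) /=.
  by rewrite c1 mul0r subr0 hornerC mulr1 => /eqP; rewrite oppr_eq0 => /eqP.
have c1 : Wcomp c 1 = 0.
  have [M2|M1] := ltnP 1 M.
    have := E1 'X; rewrite size_polyX leq_min M2 => /(_ isT) /=.
    rewrite derivX mulr1; set h : {poly R} := _ + _.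
    have Lh : juttner z h = 2 * m2 - m0.
      by rewrite /h linearD linearB/= -expr2 -/m2 -/m0; ring.
    have h0 : h.[0] = -1.
      by rewrite /h !(hornerD, hornerN, hornerM, hornerX, hornerXn, hornerC); ring.
    rewrite Lh h0 hornerX mulr0 sub0r => /eqP; rewrite oppr_eq0 !mulf_eq0 (negPf w0)/=.
    case/orP => [/eqP//|/eqP e]; exfalso.
    have := Pi0 M2; have := mulr_gt0 rho0 m2gt0.
    have thE : theta_of W = z^-1 by rewrite /z /zeta_of invrK.
    rewrite thE => p1 p2.
    (* as m2 - m0 = theta, this is rho m2 + (rho theta + Pi) *)
    suff : 0 < rho_of W * (2 * m2 - m0) - Pi_of W * -1 by rewrite e ltxx.
    rewrite (_ : m0 = m2 - z^-1); last by rewrite m2E addrK.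
    by rewrite (_ : _ - _ = rho_of W * m2 + (rho_of W * z^-1 + Pi_of W)); [lra|ring].
  have := E1 1; rewrite size_poly1 leq_min hM => /(_ isT) /=.
  rewrite derivC mulr0 add0r mulr1 m1 hornerX mulr0 subr0 mulr1 Wbeyond.
    rewrite oppr0 mul0r sub0r => /eqP; rewrite oppr_eq0 !mulf_eq0 (negPf w0)/=.
    by rewrite (gt_eqF rho0) orbF => /eqP.
  by rewrite addSn (leq_ltn_trans (leq_add M1 M1)).
have c0 : Wcomp c 0 = 0.
  have := E0 'X; rewrite size_polyX leq_min /= ltnS hM => /(_ isT).
  rewrite c1 mul0r addr0 hornerX mulr0 subr0 m1 mulr1.
  rewrite mulrBl linearB -scalerAl mul1r linearZ/= m1 mulr1 -expr2 -/m2 subrr.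
  by rewrite !mulr0 addr0.
have c2 : Wcomp c 2 = 0.
  have [M2|M1] := ltnP 1 M.
    have := E0 'X^2; rewrite size_polyXn leq_min /= ltnS M2 => /(_ isT).
    rewrite c0 c1 !mul0r hornerXn expr0n mulr0 subr0 !add0r => /eqP.
    rewrite !mulf_eq0 (negPf nz) (gt_eqF rho0)/= => /orP[/eqP//|].
    rewrite mulrBl linearB -scalerAl mul1r linearZ/= -exprS -/m2 -expr2 subr_eq0 eq_sym.
    by have := moment12_gt0 z0; rewrite subr_gt0 => /gt_eqF ->.
  have := E0 1; rewrite size_poly1 leq_min => /(_ isT).
  rewrite c0 c1 !mul0r [Wcomp c 3]Wbeyond ?mul0r ?subr0 ?add0r; last first.
    by rewrite addSn (leq_ltn_trans (leq_add M1 M1)).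
  move=> /eqP; rewrite !mulf_eq0 (negPf nz) (gt_eqF rho0)/= => /orP[/eqP//|].
  rewrite mulr1 linearB linearZ/= m1 mulrC.
  by have := moment01_gt0 z0 => /gt_eqF ->.
have c3 : Wcomp c 3 = 0.
  have := E0 1; rewrite size_poly1 leq_min => /(_ isT).
  by rewrite c0 c1 c2 !mul0r sub0r !addr0 hornerC mulr1 => /eqP; rewrite oppr_eq0 => /eqP.
have Sc l : S l = coef_poly l z c by rewrite /S c1 c2 !scale0r !addr0.
apply/colP => j; rewrite mxE -Wcomp_ord.
case: (nat_of_ord j) (ltn_ord j) => [|[|[|[|[|k]]]]]// kM; first exact: c4.
have [l2 nl] := interleaved_bound kM.
rewrite -(level_coef_interleaved z) -(coef_poly_opoly c z0 nl).
by have := base _ _ l2 nl; rewrite Sc.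
Qed.

End Invertibility.

(** * The spectrum of the moment system *)

Lemma unitmx_of_injective (F : fieldType) n (A : 'M[F]_n) :
  (forall c : 'cV[F]_n, A *m c = 0 -> c = 0) -> A \in unitmx.
Proof.
move=> inj; rewrite -unitmx_tr unitmxE unitfE.
apply/negP => /det0P[v v0 vA]; case/eqP: v0; apply: trmx_inj.
by rewrite trmx0; apply: inj; apply: trmx_inj; rewrite trmx_mul trmxK vA trmx0.
Qed.

(** A regular pencil of size n has at most n eigenvalues, by the degree of the
    characteristic polynomial; n known ones are therefore all. *)
Lemma regular_pencil_spectrum (F : fieldType) n (A0 A1 : 'M[F]_n) (s : seq F) (l : F)
    (y : 'cV[F]_n) :
  A0 \in unitmx -> uniq s -> size s = n ->
  (forall m, m \in s -> exists2 v : 'cV[F]_n, v != 0 & A1 *m v = m *: (A0 *m v)) ->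
  y != 0 -> A1 *m y = l *: (A0 *m y) -> l \in s.
Proof.
move=> uA us ss hs y0 hy; apply: contraT => ls.
pose B := (invmx A0 *m A1)^T.
have rootB m (v : 'cV[F]_n) : v != 0 -> A1 *m v = m *: (A0 *m v) -> root (char_poly B) m.
  move=> v0 hv; rewrite -eigenvalue_root_char; apply/eigenvalueP; exists v^T.
    by rewrite -trmx_mul -mulmxA hv -scalemxAr mulKmx// linearZ.
  by apply: contra v0 => /eqP v0; apply/eqP/trmx_inj; rewrite v0 trmx0.
have := @max_poly_roots _ (char_poly B) (l :: s).
rewrite monic_neq0 ?char_poly_monic// size_char_poly /= ss ltnn ls us.
rewrite (rootB _ _ y0 hy)/= => /(_ isT) H; apply/H => //.
by apply/allP => m /hs[v v0 hv]; exact: rootB v0 hv.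
Qed.

Section Permutation.
Variables (R : realType) (M : nat).

Lemma stacked_lshift (a : 'I_M.+1) : stacked (lshift M a) = (0%N, a : nat).
Proof. by rewrite /stacked (unsplitK (inl a)). Qed.

Lemma stacked_rshift (b : 'I_M) : stacked (rshift M.+1 b) = (1%N, b : nat).
Proof. by rewrite /stacked (unsplitK (inr b)). Qed.

Lemma stacked_inj : injective (@stacked M).
Proof.
move=> s t; rewrite -[s]splitK -[t]splitK.
case: (fintype.split s) => a; case: (fintype.split t) => b /=.
all: rewrite ?stacked_lshift ?stacked_rshift => -[] // /val_inj -> //.
Qed.

Lemma sum_stacked (V : nmodType) (G : nat * nat -> V) :
  \sum_s G (@stacked M s) =
  \sum_(n < M.+1) G (0%N, n : nat) + \sum_(n < M) G (1%N, n : nat).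
Proof.
rewrite big_split_ord/=; congr (_ + _); apply: eq_bigr => n _.
  by rewrite stacked_lshift.
by rewrite stacked_rshift.
Qed.

(** The interleaved and the stacked numberings enumerate the same pairs, so a sum over one
    is a sum over the other. *)
Lemma Pperm_trK : (Pperm R M)^T *m Pperm R M = 1%:M.
Proof.
apply/matrixP => s t; rewrite !mxE.
under eq_bigr do rewrite !mxE.
pose G ln : R := (ln == stacked s)%:R * (ln == stacked t)%:R.
rewrite (sum_interleaved G) -(sum_stacked G) /G.
rewrite (bigD1 s)//= eqxx mul1r (inj_eq stacked_inj) big1 ?addr0// => r rs.
by rewrite (inj_eq stacked_inj) (negPf rs) mul0r.
Qed.

Lemma PpermK : Pperm R M *m (Pperm R M)^T = 1%:M.
Proof. by apply: mulmx1C; exact: Pperm_trK. Qed.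

End Permutation.

Section Boost.
Variables (R : realType) (u : R).
Hypothesis u1 : `|u| < 1.

(** Relativistic difference of velocities; as a map in l it is an involution of (-1, 1). *)
Definition boost (l : R) : R := (u - l) / (1 - u * l).

Lemma boost_denom_gt0 l : `|l| < 1 -> 0 < 1 - u * l.
Proof.
move=> l1; rewrite subr_gt0 (le_lt_trans (ler_norm _))// normrM.
by rewrite mulr_ilt1.
Qed.

Lemma boost_norm_lt1 l : `|l| < 1 -> `|boost l| < 1.
Proof.
move=> l1; have d0 := boost_denom_gt0 l1.
rewrite /boost normrM normfV [`|1 - _|]gtr0_norm// ltr_pdivrMr// mul1r.
move: u1 l1; rewrite !ltr_norml => /andP[? ?] /andP[? ?].
by apply/andP; split; nra.
Qed.

Lemma boostK l : 1 - u * l != 0 -> boost (boost l) = l.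
Proof.
move=> d0; have u2 : 1 - u ^+ 2 != 0 by rewrite gt_eqF// sqr_lt1.
have e : 1 - u * boost l = (1 - u ^+ 2) / (1 - u * l) by rewrite /boost; field.
rewrite {1}/boost e {1}/boost; field.
by rewrite d0 u2.
Qed.

End Boost.

Section MomentSystem.
Variables (R : realType) (M : nat) (W : 'cV[R]_(M.+1 + M)).
Hypothesis hM : (1 <= M)%N.
Hypothesis hW : admissible W.
Let u := u_of W.
Let z := zeta_of W.
Let P := Pperm R M.

Let u1 : `|u| < 1. Proof. by case: hW. Qed.
Let z0 : 0 < z. Proof. by case: hW => _ _ th0 _; rewrite invr_gt0. Qed.

Lemma Dmat_unit : Dmat W \in unitmx.
Proof. by apply: unitmx_of_injective => c; exact: Dmat_injective. Qed.

Lemma Amat0_unit : Amat0 M z \in unitmx.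
Proof. by apply: unitmx_of_injective => y; exact: Amat0_injective. Qed.

(** D and the permutation cancel, and so does the common factor U0. *)
Lemma gen_eigenvector_pencil lambda (y : 'cV[R]_(M.+1 + M)) : y != 0 ->
  gen_eigenvector (Bmat0 W) (Bmat1 W) lambda (invmx (Dmat W) *m P *m y) <->
  (lambda - u) *: (Amat0 M z *m y) = (lambda * u - 1) *: (Amat1 M z *m y).
Proof.
move=> y0; set r := invmx _ *m _ *m y.
have r0 : r != 0.
  apply: contra y0 => /eqP e.
  have := congr1 (mulmx (P^T *m Dmat W)) e.
  by rewrite /r !mulmxA mulmxK ?Dmat_unit// Pperm_trK mul1mx mulmx0 => ->.
have B0r : Bmat0 W *m r = P *m ((U0 u *: Amat0 M z - U1 u *: Amat1 M z) *m y).
  rewrite /Bmat0 /Mt /r -!mulmxA (mulmxA (Dmat W)) mulmxV ?Dmat_unit// mul1mx.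
  by rewrite (mulmxA P^T) Pperm_trK mul1mx.
have B1r : Bmat1 W *m r = P *m ((U1 u *: Amat0 M z - U0 u *: Amat1 M z) *m y).
  rewrite /Bmat1 /Mx /r -!mulmxA (mulmxA (Dmat W)) mulmxV ?Dmat_unit// mul1mx.
  by rewrite (mulmxA P^T) Pperm_trK mul1mx.
have w0 : U0 u != 0 by rewrite gt_eqF// U0_gt0.
rewrite /gen_eigenvector B0r B1r scalemxAr !mulmxBl -!scalemxAl /U1.
set a := Amat0 M z *m y; set b := Amat1 M z *m y.
split=> [[_]|e].
  move=> /(congr1 (mulmx P^T)); rewrite !mulmxA Pperm_trK !mul1mx => e.
  apply/eqP; rewrite -subr_eq0; apply/eqP/(scalerI w0); rewrite scaler0.
  move/eqP: e; rewrite -subr_eq0 => /eqP <-.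
  by apply/colP => i; rewrite !mxE; ring.
split=> //; congr (_ *m _); apply/eqP; rewrite -subr_eq0; apply/eqP.
move/eqP: e; rewrite -subr_eq0 => /eqP e.
transitivity (U0 u *: 0 : 'cV[R]_(M.+1 + M)); last exact: scaler0.
by rewrite -e; apply/colP => i; rewrite !mxE; ring.
Qed.

End MomentSystem.

Theorem theorem5p1 (R : realType) (M : nat) (W : 'cV[R]_(M.+1 + M))
    (hM : (1 <= M)%N) (hW : admissible W) :
  [/\ forall lambda : R,
        gen_eigenvalue (Bmat0 W) (Bmat1 W) lambda <->
        exists2 i : int, (`|i| <= M)%N & lambda = lambda_of W i,
      forall i j : int, (`|i| <= M)%N -> (`|j| <= M)%N ->
        lambda_of W i = lambda_of W j -> i = j,
      forall i : int, (`|i| <= M)%N -> `|lambda_of W i| < 1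
    & forall i : int, (`|i| <= M)%N ->
        gen_eigenvector (Bmat0 W) (Bmat1 W) (lambda_of W i) (rvec_of W i)].
Proof.
have [_ u1 th0 _] := hW.
have z0 : 0 < zeta_of W by rewrite invr_gt0.
set u := u_of W in u1; set z := zeta_of W in z0.
pose lh i := lambdahat M z i.
have lh1 i : (`|i| <= M)%N -> `|lh i| < 1 by exact: lambdahat_norm_lt1.
have lE i : lambda_of W i = boost u (lh i) by [].
have dn i : (`|i| <= M)%N -> 1 - u * lh i != 0.
  by move=> iM; rewrite gt_eqF// boost_denom_gt0// lh1.
have vec i : (`|i| <= M)%N ->
    gen_eigenvector (Bmat0 W) (Bmat1 W) (lambda_of W i) (rvec_of W i).
  move=> iM; apply/gen_eigenvector_pencil => //; first exact: yvec_neq0.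
  rewrite pencil_eigenvector// scalerA; congr (_ *: _).
  rewrite lE /boost -/u -/z -/(lh i); field; exact: dn.
split=> //.
- move=> lambda; split=> [[r rB]|[i iM ->]]; last by eexists; exact: vec.
  pose y := (Pperm R M)^T *m (Dmat W *m r).
  have rE : r = invmx (Dmat W) *m Pperm R M *m y.
    by rewrite /y -mulmxA (mulmxA _ (_^T)) PpermK mul1mx mulKmx// Dmat_unit.
  have y0 : y != 0.
    by have [r0 _] := rB; apply: contra r0 => /eqP e; rewrite rE e mulmx0.
  rewrite rE in rB; move/(gen_eigenvector_pencil hM hW _ y0): rB; rewrite -/u -/z => e.
  have u2 : 1 - u ^+ 2 != 0 by rewrite gt_eqF// sqr_lt1.
  have d0 : 1 - u * lambda != 0.
    (* if lambda u = 1, the equation reduces to A0 y = 0 *)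
    apply/eqP => d0; case/eqP: y0; apply: (Amat0_injective z0).
    have lu : lambda * u = 1 by rewrite mulrC; apply/esym/eqP; rewrite -subr_eq0 d0.
    have lu0 : lambda - u != 0.
      by apply: contra u2 => /eqP/subr0_eq h; rewrite expr2 -{1}h lu subrr.
    by apply: (scalerI lu0); rewrite e lu subrr scale0r scaler0.
  (* the equation says that boost u lambda is an eigenvalue of the pencil (A0, A1) *)
  have : boost u lambda \in [seq lh (k%:Z - M%:Z) | k <- iota 0 (M.+1 + M)].
    apply: (regular_pencil_spectrum (Amat0_unit hW) _ _ _ y0).
    - rewrite map_inj_in_uniq ?iota_uniq// => j k.
      rewrite !mem_iota => /andP[_ jM] /andP[_ kM] ejk.
      have e2 : j%:Z - M%:Z = k%:Z - M%:Z by apply: (lambdahat_inj z0 hM) ejk; lia.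
      by move/addIr: e2 => -[].
    - by rewrite size_map size_iota.
    - move=> m /mapP[k]; rewrite mem_iota => /andP[_ kM] ->.
      have kM' : (`|k%:Z - M%:Z| <= M)%N by lia.
      exists (yvec M z (k%:Z - M%:Z)); first exact: yvec_neq0.
      exact: pencil_eigenvector.
    - have d1 : lambda * u - 1 != 0 by rewrite -opprB oppr_eq0 mulrC.
      apply: (scalerI d1); rewrite -/z -e scalerA; congr (_ *: _).
      rewrite /boost; field; exact: d0.
  case/mapP => k; rewrite mem_iota => /andP[_ kM] bl.
  exists (k%:Z - M%:Z); first by lia.
  by rewrite lE -bl boostK.
- move=> i j iM jM; rewrite !lE => /(congr1 (boost u)); rewrite !boostK ?dn//.
  exact: lambdahat_inj.
- by move=> i iM; rewrite lE boost_norm_lt1// lh1.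
Qed.
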